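(* For every $n\in\mathbb N_{>0}$ there are $k=k(n)\in\mathbb N_{>0}$ and $p=p(n)>1$ for which the one-parameter property $R(n,k,p)$ (defined in the context) holds and for which, moreover, the following holds. Let $m\in\mathbb N_{>0}$, let $U\subset\mathbb R^m$ be open and let $$P_{a(x)}(Z)=Z^n+\sum_{j=1}^n a_j(x)Z^{n-j}\in C^k(U)[Z]$$ be a monic polynomial with (complex-valued) coefficients $a_j\in C^k(U)$, $j=1,\dots,n$. (1) Let $\lambda\in C^0(V)$ represent a root of $P_a$, i.e., $P_a(\lambda)=0$, on a relatively compact open subset $V\Subset U$. Then the distributional gradient of $\lambda$ in $V$ is a measurable function $\nabla\lambda\in[L^q(V)]^m$ for every $q\in[1,p)$. In particular, $\lambda\in W^{1,q}(V)$ for every $q\in[1,p)$. (2) The regularity of the roots is uniform: let $\{P_{a_\nu};\nu\in\mathcal N\}$, $P_{a_\nu(x)}(Z)=Z^n+\sum_{j=1}^n a_{\nu,j}(x)Z^{n-j}\in C^k(U)[Z]$, be a family of polynomials, indexed by $\nu$ in some set $\mathcal N$, such that the set of coefficients $\{a_{\nu,j};\nu\in\mathcal N,\ j=1,\dots,n\}$ is bounded in $C^k(U)$. Let $V\Subset U$ be open. Then the set $$\{\lambda_\nu\in C^0(V);\ P_{a_\nu}(\lambda_\nu)=0\text{ on }V,\ \nu\in\mathcal N\}$$ is bounded in $W^{1,q}(V)$ for every $q\in[1,p)$.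
   Context: All functions are complex-valued. $L^q$ and $W^{1,q}$ are the Lebesgue and Sobolev spaces with respect to Lebesgue measure. $V\Subset U$ means that $\overline V$ is compact and contained in $U$. A set of functions is bounded in $C^k(U)$, $U$ open, if all partial derivatives of order $\le k$ of its members are uniformly bounded on every compact subset of $U$. Property $R(n,k,p)$: for every compact interval $I\subset\mathbb R$: (i) if $P_{a(t)}(Z)=Z^n+\sum_{j=1}^n a_j(t)Z^{n-j}$ with $a_j\in C^k(I)$ and $\lambda_1,\dots,\lambda_n\in C^0(I)$ satisfy $P_{a(t)}(Z)=\prod_j(Z-\lambda_j(t))$ for all $t\in I$, then the distributional derivative of each $\lambda_j$ is a function in $L^q(I)$ for every $q\in[1,p)$; (ii) if $\{P_{a_\nu};\nu\in\mathcal N\}$ is a family of such curves of polynomials whose set of coefficients $\{a_{\nu,j}\}$ is bounded in $C^k(I)$ (with the norm given by the supremum over $I$ of all derivatives of order $\le k$), then the set of all $\lambda\in C^0(I)$ such that $P_{a_\nu}(\lambda)=0$ on $I$ for some $\nu\in\mathcal N$ is bounded in $W^{1,q}(I)$ for every $q\in[1,p)$. *)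

(* Defs.v *)
From HB Require Import structures.
From mathcomp Require Import all_boot all_order all_algebra.
From mathcomp Require Import complex.
From mathcomp Require Import all_classical all_reals all_analysis.

Set Implicit Arguments.
Unset Strict Implicit.
Unset Printing Implicit Defensive.

Import Order.TTheory GRing.Theory Num.Theory.
Import numFieldNormedType.Exports.

Local Open Scope classical_set_scope.
Local Open Scope ring_scope.

Definition measure_rV_display : measure_display.
Proof. exact: default_measure_display. Qed.

Section measurable_rV.
Context {R : realType} {m : nat}.

Let coors : 'I_m -> 'rV[R]_m -> R := fun i v => v ord0 i.

Let rV_set0 : g_sigma_preimage coors set0.
Proof. exact: sigma_algebra0. Qed.

Let rV_setC A : g_sigma_preimage coors A -> g_sigma_preimage coors (~` A).
Proof. exact: sigma_algebraC. Qed.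

Let rV_bigcup (F : _^nat) : (forall i, g_sigma_preimage coors (F i)) ->
  g_sigma_preimage coors (\bigcup_i (F i)).
Proof. exact: sigma_algebra_bigcup. Qed.

(* The sigma-algebra generated by the coordinates, i.e. the Borel sets. *)
HB.instance Definition _ := @isMeasurable.Build measure_rV_display
  'rV[R]_m (g_sigma_preimage coors) rV_set0 rV_setC rV_bigcup.

Lemma measurable_coord i : measurable_fun [set: 'rV[R]_m] (fun v => v ord0 i).
Proof.
move=> _ Y mY; rewrite setTI; apply: sub_sigma_algebra => /=.
rewrite -bigcup_seq/=; exists i => /=; first by rewrite mem_index_enum.
by exists Y => //; rewrite setTI.
Qed.

Lemma measurable_fun_coordP d (T : measurableType d) (f : T -> 'rV[R]_m) :
  (forall i, measurable_fun [set: T] (fun x => f x ord0 i)) ->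
  measurable_fun [set: T] f.
Proof.
move=> mf.
have H : g_sigma_preimage (fun i => coors i \o f) `<=` measurable.
  apply: smallest_sub; first exact: sigma_algebra_measurable.
  move=> A; rewrite -bigcup_seq => -[i _ [B mB <-]]; exact: mf.
move: H; rewrite g_sigma_preimage_comp => H _ A mA.
by apply: H; exists A.
Qed.

End measurable_rV.

Section lebesgue_rV.
Context {R : realType}.

Definition rV_cons m (p : R * 'rV[R]_m) : 'rV[R]_m.+1 :=
  \row_i oapp (p.2 ord0) p.1 (unlift ord0 i).

Definition rV_uncons m (v : 'rV[R]_m.+1) : R * 'rV[R]_m :=
  (v ord0 ord0, \row_j v ord0 (lift ord0 j)).

Lemma rV_cons0 m (p : R * 'rV[R]_m) : rV_cons p ord0 ord0 = p.1.
Proof. by rewrite mxE unlift_none. Qed.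

Lemma rV_consS m (p : R * 'rV[R]_m) j :
  rV_cons p ord0 (lift ord0 j) = p.2 ord0 j.
Proof. by rewrite mxE liftK. Qed.

Lemma rV_consK m : cancel (@rV_cons m) (@rV_uncons m).
Proof.
move=> [x v]; rewrite /rV_uncons rV_cons0; congr pair.
by apply/rowP => j; rewrite mxE rV_consS.
Qed.

Lemma rV_unconsK m : cancel (@rV_uncons m) (@rV_cons m).
Proof.
move=> v; apply/rowP => i.
by have [j ->|->] := unliftP ord0 i; rewrite ?rV_cons0 // rV_consS mxE.
Qed.

Lemma measurable_rV_cons m : measurable_fun setT (@rV_cons m).
Proof.
apply: measurable_fun_coordP => i.
have [j ->|->] := unliftP ord0 i; last first.
- under eq_fun do rewrite rV_cons0; exact: measurable_fst.
- under eq_fun do rewrite rV_consS.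
  by apply: (measurableT_comp (measurable_coord j)); exact: measurable_snd.
Qed.

Lemma measurable_rV_uncons m : measurable_fun setT (@rV_uncons m).
Proof.
apply: measurable_fun_pair; first exact: measurable_coord.
apply: measurable_fun_coordP => i.
under eq_fun do rewrite mxE; exact: measurable_coord.
Qed.

Section cons_measure.
Variables (m : nat) (mu : {sigma_finite_measure set 'rV[R]_m -> \bar R}).

Definition cons_measure : set 'rV[R]_m.+1 -> \bar R :=
  pushforward (lebesgue_measure \x mu)%E (@rV_cons m).

Let cons_measure0 : cons_measure set0 = 0%E.
Proof. by rewrite /cons_measure /pushforward preimage_set0 measure0. Qed.

Let cons_measure_ge0 A : (0 <= cons_measure A)%E.
Proof. by rewrite /cons_measure /pushforward measure_ge0. Qed.

Let cons_measure_sigma_additive : semi_sigma_additive cons_measure.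
Proof.
move=> F mF tF mUF; rewrite /cons_measure /pushforward preimage_bigcup.
have mcons A : measurable A -> measurable (@rV_cons m @^-1` A).
  by move=> mA; rewrite -[X in measurable X]setTI; exact: measurable_rV_cons.
apply: measure_semi_sigma_additive.
- by move=> n; exact: mcons.
- apply/trivIsetP => /= i j _ _ ij; rewrite -preimage_setI.
  by move/trivIsetP : tF => /(_ _ _ _ _ ij) ->//; rewrite preimage_set0.
- by rewrite -preimage_bigcup; exact: mcons.
Qed.

HB.instance Definition _ := isMeasure.Build _ _ _ cons_measure
  cons_measure0 cons_measure_ge0 cons_measure_sigma_additive.

Let cons_measure_sigma_finite : sigma_finite setT cons_measure.
Proof.
have /sigma_finiteP[F [TF ndF Foo]] := sigma_finiteT (@lebesgue_measure R).
have /sigma_finiteP[G [TG ndG Goo]] := sigma_finiteT mu.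
exists (fun n => @rV_uncons m @^-1` (F n `*` G n)).
  apply/esym; rewrite -subTset => v _.
  have : setT (rV_uncons v).1 by []; rewrite {1}TF => -[i _ Fi].
  have : setT (rV_uncons v).2 by []; rewrite {1}TG => -[j _ Gj].
  exists (maxn i j) => //; split.
  - by move: Fi; exact/subsetPset/ndF/leq_maxl.
  - by move: Gj; exact/subsetPset/ndG/leq_maxr.
move=> n; have [mF Fn] := Foo n; have [mG Gn] := Goo n; split.
  rewrite -[X in measurable X]setTI.
  by apply: measurable_rV_uncons => //; exact: measurableX.
rewrite /cons_measure /pushforward -comp_preimage.
rewrite (_ : _ \o _ = id) ?preimage_id; last exact/funext/rV_consK.
by rewrite product_measure1E// lte_mul_pinfty// ge0_fin_numE.
Qed.

HB.instance Definition _ := Measure_isSigmaFinite.Build _ _ _ cons_measure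
  cons_measure_sigma_finite.

End cons_measure.

(* m-fold product of the Lebesgue measure on R; see [lebesgue_rV_box]. *)
Fixpoint lebesgue_rV m : {sigma_finite_measure set 'rV[R]_m -> \bar R} :=
  match m with
  | 0 => @dirac _ 'rV[R]_0 0 R
  | m'.+1 => cons_measure (lebesgue_rV m')
  end.

Lemma measurable_box m (A : 'I_m -> set R) : (forall i, measurable (A i)) ->
  measurable [set v : 'rV[R]_m | forall i, A i (v ord0 i)].
Proof.
move=> mA; rewrite [X in measurable X](_ : _ =
    \big[setI/setT]_(i < m) ((fun v : 'rV[R]_m => v ord0 i) @^-1` A i)).
  apply: bigsetI_measurable => i _.
  by rewrite -[X in measurable X]setTI; exact: measurable_coord.
rewrite -bigcap_seq; apply/seteqP; split => v /= Av; first by move=> i _; exact: Av.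
by move=> i; apply: Av; rewrite /= mem_index_enum.
Qed.

Lemma lebesgue_rV_box m (A : 'I_m -> set R) : (forall i, measurable (A i)) ->
  lebesgue_rV m [set v | forall i, A i (v ord0 i)] =
  (\prod_(i < m) lebesgue_measure (A i))%E.
Proof.
elim: m A => [|m IH] A mA.
  by rewrite big_ord0 /= diracE mem_set// => -[].
rewrite big_ord_recl -IH; last by move=> i; exact: mA.
rewrite /= /cons_measure /pushforward -product_measure1E; last 2 first.
- exact: mA.
- by apply: (measurable_box (A := fun i => A (lift ord0 i))) => i; exact: mA.
congr (_ _); apply/seteqP; split => -[x v] /= H.
  split; first by have := H ord0; rewrite rV_cons0.
  by move=> i; have := H (lift ord0 i); rewrite rV_consS.
move=> i; have [j ->|->] := unliftP ord0 i; last by rewrite rV_cons0; case: H.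
by rewrite rV_consS; case: H.
Qed.

End lebesgue_rV.

Section complex_valued.
Context {R : realType}.
Local Notation C := R[i].

(* [R[i]] carries no normed R-module structure in the library, so properties of
   complex-valued functions and real-linear operators on them are taken on the
   real and imaginary parts. *)
Definition cpart_all T (P : (T -> R) -> Prop) (f : T -> C) : Prop :=
  P (@complex.Re R \o f) /\ P (@complex.Im R \o f).

Definition cpart_map T (D : (T -> R) -> T -> R) (f : T -> C) : T -> C :=
  fun x => (D (@complex.Re R \o f) x +i* D (@complex.Im R \o f) x)%C.

Definition cmodulus (z : C) : R := ComplexField.Normc.normc z.

(* [a] is indexed from 0: [a j] is the coefficient a_(j+1) of Z^(n-(j+1)). *)
Definition monic_poly n (a : 'I_n -> C) : {poly C} :=
  'X^n + \sum_(j < n) a j *: 'X^(n - j.+1).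

Section Lebesgue_spaces.
Context d (T : measurableType d) (mu : {measure set T -> \bar R}).
Implicit Types (V : set T) (f : T -> C).

Definition cintegrable V f : Prop :=
  cpart_all (fun h => mu.-integrable V (EFin \o h)) f.

Definition cintegral V f : C :=
  ((\int[mu]_(x in V) complex.Re (f x)) +i*
   (\int[mu]_(x in V) complex.Im (f x)))%C.

Definition Lq_norm V (q : R) f : \bar R :=
  ('N[mu]_(q%:E)[(fun x => (cmodulus (f x))%:E) \_ V])%E.

Definition in_Lq V (q : R) f : Prop :=
  cpart_all (measurable_fun V) f /\ (Lq_norm V q f < +oo)%E.

End Lebesgue_spaces.

Section several_variables.
Context {m : nat}.
Local Notation mu := (lebesgue_rV m : {measure set 'rV[R]_m -> \bar R}).
Implicit Types (U V : set 'rV[R]_m) (f g : 'rV[R]_m -> C).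
Implicit Types (F : set ('rV[R]_m -> C)) (k : nat) (q : R).

(* All functions are total; only their values on the open set [U] (or [V])
   matter in the definitions below. *)
Definition continuous_on U f : Prop :=
  cpart_all (fun h => forall x, U x -> {for x, continuous h}) f.

Definition has_partial U (i : 'I_m) f : Prop :=
  cpart_all (fun h => forall x, U x -> derivable h x (delta_mx ord0 i)) f.

Definition partial (i : 'I_m) f : 'rV[R]_m -> C :=
  cpart_map (fun h x => 'D_(delta_mx ord0 i) h x) f.

Definition iter_partial (s : seq 'I_m) f : 'rV[R]_m -> C := foldr partial f s.

Definition in_Ck k U f : Prop := forall s : seq 'I_m,
  ((size s <= k)%N -> continuous_on U (iter_partial s f)) /\
  ((size s < k)%N -> forall i, has_partial U i (iter_partial s f)).

Definition bounded_in_Ck k U F : Prop :=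
  (forall f, F f -> in_Ck k U f) /\
  forall K, compact K -> K `<=` U -> exists M : R,
    forall f, F f -> forall s : seq 'I_m, (size s <= k)%N ->
    forall x, K x -> cmodulus (iter_partial s f x) <= M.

Definition relatively_compact_in V U : Prop :=
  compact (closure V) /\ closure V `<=` U.

(* Test functions are extended by zero outside [V]. *)
Definition test_function V (phi : 'rV[R]_m -> C) : Prop :=
  (forall k, in_Ck k setT phi) /\
  exists2 K, compact K /\ K `<=` V & forall x, ~ K x -> phi x = 0.

Definition locally_cintegrable V f : Prop :=
  forall K, compact K -> K `<=` V -> cintegrable mu K f.

Definition weak_partial V (i : 'I_m) f g : Prop :=
  [/\ locally_cintegrable V f, locally_cintegrable V g &
  forall phi, test_function V phi ->
    cintegral mu V (fun x => f x * partial i phi x) =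
    - cintegral mu V (fun x => g x * phi x)].

Definition weak_gradient V f (g : 'I_m -> 'rV[R]_m -> C) : Prop :=
  forall i, weak_partial V i f (g i).

Definition in_W1q V q f : Prop :=
  in_Lq mu V q f /\
  exists2 g : 'I_m -> 'rV[R]_m -> C, weak_gradient V f g &
    forall i, in_Lq mu V q (g i).

(* A weak gradient is unique almost everywhere, so that the norm does not
   depend on the choice of [g]. *)
Definition bounded_in_W1q V q F : Prop :=
  exists M : R, forall f, F f -> in_Lq mu V q f /\
    exists g : 'I_m -> 'rV[R]_m -> C, [/\ weak_gradient V f g, forall i, in_Lq mu V q (g i) &
      (Lq_norm mu V q f + \sum_(i < m) Lq_norm mu V q (g i) <= M%:E)%E].

End several_variables.

Section one_variable.
Variables (a b : R).
Local Notation mu := (@lebesgue_measure R).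
Local Notation I := (`[a, b]%classic : set R).
Local Notation J := (`]a, b[%classic : set R).
Implicit Types (f g : R -> C) (F : set (R -> C)) (k : nat) (q : R).

Definition continuous_itv f : Prop :=
  cpart_all (fun h => {within I, continuous h}) f.

Definition diff_quotient (h : R -> R) (x y : R) : R := (h y - h x) / (y - x).

(* Derivatives relative to [a, b]: one-sided at the endpoints. *)
Definition derivable_itv f : Prop :=
  cpart_all (fun h => forall x, I x ->
    cvg (diff_quotient h x y @[y --> within I x^'])) f.

Definition derive_itv f : R -> C :=
  cpart_map (fun h x => lim (diff_quotient h x y @[y --> within I x^'])) f.

Definition in_Ck_itv k f : Prop := forall j,
  ((j <= k)%N -> continuous_itv (iter j derive_itv f)) /\
  ((j < k)%N -> derivable_itv (iter j derive_itv f)).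

Definition bounded_in_Ck_itv k F : Prop :=
  (forall f, F f -> in_Ck_itv k f) /\
  exists M : R, forall f, F f -> forall j, (j <= k)%N ->
    forall x, I x -> cmodulus (iter j derive_itv f x) <= M.

Definition derive1c f : R -> C := cpart_map (fun h => derive1 h) f.

Definition test_function_itv (phi : R -> C) : Prop :=
  (forall j, cpart_all (fun h : R -> R => forall x : R, derivable h x 1)
    (iter j derive1c phi)) /\
  exists2 K, compact K /\ K `<=` J & forall x, ~ K x -> phi x = 0.

Definition locally_cintegrable_itv f : Prop :=
  forall K, compact K -> K `<=` J -> cintegrable mu K f.

Definition weak_derivative_itv f g : Prop :=
  [/\ locally_cintegrable_itv f, locally_cintegrable_itv g &
  forall phi, test_function_itv phi ->
    cintegral mu J (fun x => f x * derive1c phi x) =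
    - cintegral mu J (fun x => g x * phi x)].

Definition bounded_in_W1q_itv q F : Prop :=
  exists M : R, forall f, F f -> in_Lq mu J q f /\
    exists g, [/\ weak_derivative_itv f g, in_Lq mu J q g &
      (Lq_norm mu J q f + Lq_norm mu J q g <= M%:E)%E].

End one_variable.

Definition one_parameter_regularity (n k : nat) (p : R) : Prop :=
  forall a b : R, a < b ->
  (forall (c l : 'I_n -> R -> C),
    (forall j, in_Ck_itv a b k (c j)) ->
    (forall j, continuous_itv a b (l j)) ->
    (forall t, a <= t <= b ->
      monic_poly (c ^~ t) = \prod_(j < n) ('X - (l j t)%:P)) ->
    forall j, exists2 g, weak_derivative_itv a b (l j) g &
      forall q, 1 <= q -> q < p -> in_Lq (@lebesgue_measure R) `]a, b[%classic q g)
  /\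
  (forall (N : Type) (c : N -> 'I_n -> R -> C),
    bounded_in_Ck_itv a b k [set h | exists nu j, h = c nu j] ->
    forall q, 1 <= q -> q < p ->
    bounded_in_W1q_itv a b q
      [set l | continuous_itv a b l /\ exists nu, forall t, a <= t <= b ->
        (monic_poly (c nu ^~ t)).[l t] = 0]).

End complex_valued.

(* Main.v *)
(* A root is compared with the roots of the Taylor polynomials of the coefficients.
   When the coefficients are polynomials in t, the increment over a step tau of the
   j-th smallest real part of a root crosses a given level boundedly often, since the
   crossing parameters are zeros of a nonzero determinant of bounded degree.  For
   coefficients of class C^k, using Taylor polynomials on the pieces of all dyadic
   scales, one obtains on every grid of step tau, with b = 3 (2 n! - 1) and k = 4 n!:
   the proportion of grid intervals on which the real part of a continuous root varies
   by more than C 2^(b m) tau is O(2^(- (b + 1) m)), uniformly in tau.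
   Averaging over translations turns this into a weak-type bound for the difference
   quotients of a root along a direction.  The quotients are therefore uniformly
   integrable, their limit along an ultrafilter is an absolutely continuous charge, and
   its Radon-Nikodym density is the weak derivative.  The density inherits the weak-type
   bound, hence is in L^q for q < 1 + 1 / b.  Imaginary parts are the real parts of the
   roots multiplied by -i. *)
Require Import Defs.
From HB Require Import structures.
From mathcomp Require Import all_boot all_order all_algebra.
From mathcomp Require Import complex perm.
From mathcomp Require Import all_classical all_reals all_analysis.
From mathcomp Require Import measurable_realfun.
From mathcomp Require Import ring lra zify.

Set Implicit Arguments.
Unset Strict Implicit.
Unset Printing Implicit Defensive.

Import Order.TTheory GRing.Theory Num.Theory.
Import numFieldNormedType.Exports.

Local Open Scope classical_set_scope.
Local Open Scope ring_scope.

(** * Perturbation of roots *)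

Local Notation nc := (@ComplexField.Normc.normc _).

Section Modulus.
Variable R : realType.
Implicit Types x y z : R[i].

(** The real parts of the roots, once sorted, depend on the polynomial alone, so no labelling of the
    roots has to be chosen. The constants are a budget in powers of [2 ^ m]. Matching roots costs an
    exponent [1 / n!], so Taylor polynomials with [k = 4 n!] coefficients on [2 ^ I] pieces give the
    sorted real parts up to [O(16 ^ (- I))], while the steep steps of the approximation form
    [O(4 ^ I)] runs. Put [s = 2 ^ (b m)]. At scale [m] a run of steps steeper than [s] has length
    [O(s ^ (- N / (N - 1)))] by Holder continuity of exponent [1 / N]; with [N = 2 n!] and
    [b = 3 (N - 1)] this is [O(1 / (s 8 ^ m))]. The [4 ^ m] runs use two of the three factors
    [2 ^ m]; the third makes the total [O(2 ^ (- (b + 1) m))], slightly better than the [O(1 / s)]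
    of a function of bounded variation. This gain excludes a singular part of the derivative and
    yields an exponent above 1. The factor 2 in [N] keeps [N > 1] when [n = 1]. For each
    approximation the levels at which a crossing determinant vanishes identically are finitely many,
    and a small shift of the level avoids them. *)

Lemma nc_ge0 z : 0 <= nc z.
Proof. by case: z => a b; exact: sqrtr_ge0. Qed.

Lemma ncM x y : nc (x * y) = nc x * nc y.
Proof. exact: ComplexField.Normc.normcM. Qed.

Lemma nc0 : nc (0 : R[i]) = 0. Proof. exact: ComplexField.Normc.normc0. Qed.
Lemma nc1 : nc (1 : R[i]) = 1. Proof. exact: ComplexField.Normc.normc1. Qed.

Lemma ncN x : nc (- x) = nc x. Proof. exact: normcN. Qed.

Lemma ncD x y : nc (x + y) <= nc x + nc y. Proof. exact: le_normcD. Qed.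

Lemma ncB x y : nc (x - y) <= nc x + nc y.
Proof. by rewrite -[leRHS]/(nc x + nc y) -(ncN y); exact: ncD. Qed.

Lemma nc_distC x y : nc (x - y) = nc (y - x).
Proof. by rewrite -ncN opprB. Qed.

Lemma ncX z k : nc (z ^+ k) = nc z ^+ k.
Proof. by elim: k => [|k IH]; rewrite ?expr0 ?nc1// !exprS ncM IH. Qed.

Lemma nc_prod I (r : seq I) (P : pred I) (F : I -> R[i]) :
  nc (\prod_(i <- r | P i) F i) = \prod_(i <- r | P i) nc (F i).
Proof. by elim/big_rec2 : _ => [|i u v _ <-]; rewrite ?nc1// ncM. Qed.

Lemma nc_sum I (r : seq I) (P : pred I) (F : I -> R[i]) :
  nc (\sum_(i <- r | P i) F i) <= \sum_(i <- r | P i) nc (F i).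
Proof.
elim/big_rec2 : _ => [|i u v _ h]; first by rewrite nc0.
by rewrite (le_trans (ncD _ _))// lerD2l.
Qed.

Lemma ler_ncRe z : `|complex.Re z| <= nc z.
Proof.
case: z => a b /=; rewrite -sqrtr_sqr ler_sqrt ?addr_ge0 ?sqr_ge0//.
by rewrite lerDl sqr_ge0.
Qed.

Lemma ler_ncIm z : `|complex.Im z| <= nc z.
Proof.
case: z => a b /=; rewrite -sqrtr_sqr ler_sqrt ?addr_ge0 ?sqr_ge0//.
by rewrite lerDr sqr_ge0.
Qed.

Lemma nc_leReIm z : nc z <= `|complex.Re z| + `|complex.Im z|.
Proof.
case: z => a b /=; rewrite -(ger0_norm (addr_ge0 (normr_ge0 a) (normr_ge0 b))).
rewrite -sqrtr_sqr ler_sqrt ?sqr_ge0// sqrrD !real_normK ?num_real//.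
by rewrite lerD2r lerDl mulrn_wge0// mulr_ge0.
Qed.

Lemma nc_real (a : R) : nc (a%:C)%C = `|a|.
Proof. by rewrite /= expr0n addr0 sqrtr_sqr. Qed.

End Modulus.

Section RootPerturbation.
Variable R : realType.
Local Notation C := R[i].
Implicit Types (p q : {poly C}) (rs : seq C).

Definition coef_bounded (M : R) p := forall i, nc p`_i <= M.

Definition coef_close (d : R) p q := forall i, nc (p`_i - q`_i) <= d.

Lemma nc_horner_le (B d : R) p m : 0 <= d -> 1 <= B -> (size p <= m)%N ->
  coef_bounded d p -> forall z, nc z <= B -> nc p.[z] <= d * (m%:R * B ^+ m).
Proof.
move=> d0 B1 sp pd z zB; rewrite (horner_coef_wide _ sp).
apply: (le_trans (nc_sum _ _ _)).
apply: (@le_trans _ _ (\sum_(i < m) d * B ^+ m)).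
  apply: ler_sum => i _; rewrite ncM ncX; apply: ler_pM => //; rewrite ?nc_ge0//.
    by rewrite exprn_ge0// nc_ge0.
  apply: (@le_trans _ _ (B ^+ i)); first by apply: lerXn2r; rewrite ?nnegrE ?nc_ge0// (le_trans (nc_ge0 z)).
  by rewrite ler_weXn2l// ltnW.
by rewrite sumr_const card_ord mulrCA mulr_natl.
Qed.

(** Cauchy's bound. Where [nc z > 1], every lower power of [z] is at most [nc z ^+ n.-1] in modulus,
    so this power can be cancelled. *)
Lemma root_bound p n M z : 0 <= M -> p \is monic -> size p = n.+1 ->
  coef_bounded M p -> root p z -> nc z <= 1 + n%:R * M.
Proof.
move=> M0 mp sp pM /rootP pz0.
have nM0 : 0 <= n%:R * M by rewrite mulr_ge0.
have [z1|z1] := leP (nc z) 1; first by rewrite (le_trans z1)// lerDl.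
suff : nc z <= n%:R * M by move=> /le_trans; apply; rewrite lerDr.
have : z ^+ n = - \sum_(i < n) p`_i * z ^+ i.
  move: pz0; rewrite horner_coef sp big_ord_recr/=.
  have -> : p`_n = 1 by have /monicP := mp; rewrite lead_coefE sp.
  by rewrite mul1r addrC => /eqP; rewrite addr_eq0 => /eqP.
move=> /(congr1 (fun z => nc z)); rewrite ncN ncX => zn.
have n0 : (0 < n)%N.
  case: n {nM0 sp} zn => // ; rewrite big_ord0 expr0 nc0 => /eqP.
  by rewrite oner_eq0.
have : nc z ^+ n <= n%:R * M * nc z ^+ n.-1.
  rewrite zn (le_trans (nc_sum _ _ _))//.
  apply: (@le_trans _ _ (\sum_(i < n) M * nc z ^+ n.-1)).
    apply: ler_sum => i _; rewrite ncM ncX; apply: ler_pM => //; rewrite ?nc_ge0//.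
      by rewrite exprn_ge0// nc_ge0.
    by rewrite ler_weXn2l// ?(ltW z1)// -ltnS prednK.
  by rewrite sumr_const card_ord -mulrA mulr_natl.
rewrite -{1}(prednK n0) exprS ler_pM2r//.
by rewrite exprn_gt0// (lt_trans ltr01).
Qed.

(** The modulus of the polynomial at [z] is the product of the distances from [z] to its roots, each
    at least the distance to the nearest one. *)
Lemma near_root rs z : rs != [::] -> exists2 w, w \in rs &
  nc (z - w) ^+ size rs <= nc (\prod_(w <- rs) ('X - w%:P)).[z].
Proof.
move=> rs0.
have [w wrs wmin] : exists2 w, w \in rs & forall v, v \in rs -> nc (z - w) <= nc (z - v).
  elim: rs rs0 => // v rs IH _; have [->|/IH[w wrs wmin]] := eqVneq rs [::].
    by exists v; rewrite ?mem_head// => u; rewrite inE => /eqP ->.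
  have [h|h] := leP (nc (z - v)) (nc (z - w)).
    exists v; first by rewrite mem_head.
    by move=> u; rewrite inE => /predU1P[->//|/wmin]; apply: le_trans.
  exists w; first by rewrite inE wrs orbT.
  by move=> u; rewrite inE => /predU1P[->|/wmin//]; exact: ltW.
exists w => //; rewrite horner_prod nc_prod.
have -> : nc (z - w) ^+ size rs = \prod_(v <- rs) nc (z - w).
  by rewrite big_const_seq count_predT iter_mulr_1.
rewrite big_seq [leRHS]big_seq; apply: ler_prod => v vrs.
by rewrite nc_ge0 hornerXsubC wmin.
Qed.

Lemma deflate_coef z p j : (('X - z%:P) * p)`_j.+1 = p`_j - z * p`_j.+1.
Proof. by rewrite mulrBl coefB coefXM coefCM. Qed.

(** The coefficients of the quotient by ['X - z%:P] are recovered from the top down through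
    [deflate_coef]; [l] counts how far the descent has gone, and [K] is found before [z] and [p]. *)
Lemma deflate_bounded (B M : R) l : 0 <= B -> 0 <= M -> exists2 K : R, 0 <= K &
  forall z p n, nc z <= B -> size p = n.+1 -> coef_bounded M (('X - z%:P) * p) ->
  forall j, (n < j + l)%N -> nc p`_j <= K.
Proof.
move=> B0 M0; elim: l => [|l [K K0 IH]].
  by exists 0 => // z p n _ sp _ j; rewrite addn0 => nj; rewrite nth_default ?nc0// sp.
exists (M + B * K); first by rewrite addr_ge0// mulr_ge0.
move=> z p n zB sp pM j njl.
have -> : p`_j = (('X - z%:P) * p)`_j.+1 + z * p`_j.+1 by rewrite deflate_coef subrK.
rewrite (le_trans (ncD _ _))// lerD// ncM ler_pM ?nc_ge0//.
by apply: (IH _ _ n) zB sp pM _ _; rewrite addSnnS.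
Qed.

(** The same descent for a difference of two quotients; moving the root that is divided out from [z]
    to [w] adds a multiple of [nc (z - w)]. *)
Lemma deflate_close (B A : R) l : 0 <= B -> 0 <= A -> exists2 K : R, 0 <= K &
  forall z w p q n d, nc z <= B -> size p = n.+1 -> size q = n.+1 -> 0 <= d ->
  coef_bounded A q ->
  coef_close d (('X - z%:P) * p) (('X - w%:P) * q) ->
  forall j, (n < j + l)%N -> nc (p`_j - q`_j) <= K * (d + nc (z - w)).
Proof.
move=> B0 A0; elim: l => [|l [K K0 IH]].
  exists 0 => // z w p q n d zB sp sq d0 _ _ j; rewrite addn0 => nj.
  by rewrite !nth_default ?sp ?sq// subrr nc0 mul0r.
exists (1 + B * K + A); first by rewrite !addr_ge0// mulr_ge0.
move=> z w p q n d zB sp sq d0 qA pq j njl.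
have -> : p`_j - q`_j = ((('X - z%:P) * p)`_j.+1 - (('X - w%:P) * q)`_j.+1)
    + z * (p`_j.+1 - q`_j.+1) + (z - w) * q`_j.+1.
  rewrite !deflate_coef; ring.
have h0 := nc_ge0 (z - w).
have h1 : nc (p`_j.+1 - q`_j.+1) <= K * (d + nc (z - w)).
  by apply: (IH z w p q n) => //; rewrite addSnnS.
have h2 : nc (z * (p`_j.+1 - q`_j.+1)) <= B * (K * (d + nc (z - w))).
  by rewrite ncM ler_pM ?nc_ge0.
have h3 : nc ((z - w) * q`_j.+1) <= nc (z - w) * A by rewrite ncM ler_pM ?nc_ge0.
rewrite (le_trans (ncD _ _))// (le_trans (lerD (ncD _ _) (lexx _)))//.
rewrite (le_trans (lerD (lerD (pq _) h2) h3))//.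
by nra.
Qed.

Lemma powD_le (a b : R) m : 0 <= a -> 0 <= b ->
  (a + b) ^+ m <= 2 ^+ m * (a ^+ m + b ^+ m).
Proof.
move=> a0 b0; wlog ab : a b a0 b0 / a <= b.
  move=> h; have [/h|/ltW/h] := leP a b; first exact.
  by rewrite addrC [X in _ * X]addrC; exact.
apply: (@le_trans _ _ ((2 * b) ^+ m)).
  by rewrite lerXn2r ?nnegrE ?addr_ge0 ?mulr_ge0// mulr_natl mulr2n lerD2r.
by rewrite exprMn ler_wpM2l ?exprn_ge0// lerDr exprn_ge0.
Qed.

Lemma monic_size1 p : p \is monic -> size p = 1%N -> p = 1.
Proof.
by move=> + sp; rewrite (size1_polyC (eq_leq sp)) monicE lead_coefC => /eqP ->.
Qed.

(** A root [z] of [p] is almost a root of [q], hence close to a root [w] of [q], with the loss of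
    one exponent equal to the inverse of the degree. Dividing both out leaves quotients whose
    coefficients differ by [O(d + nc (z - w))], and the induction goes on. The exponents multiply,
    which produces the factorial; what matters later is only that the exponent is fixed. *)
Lemma roots_close n (M : R) : 0 <= M -> exists2 K : R, 0 <= K &
  forall p q d, p \is monic -> q \is monic -> size p = n.+1 -> size q = n.+1 ->
  coef_bounded M p -> coef_bounded M q -> 0 <= d -> d <= M -> coef_close d p q ->
  exists rs ss, [/\ size rs = n, size ss = n,
    p = \prod_(w <- rs) ('X - w%:P), q = \prod_(w <- ss) ('X - w%:P) &
    forall i, (i < n)%N -> nc (rs`_i - ss`_i) ^+ n`! <= K * d].
Proof.
elim: n M => [|n IH] M M0.
  exists 0 => // p q d mp mq sp sq _ _ _ _ _; exists [::], [::].
  rewrite !big_nil; split => //.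
  - exact: monic_size1.
  - exact: monic_size1.
pose B := 1 + n.+1%:R * M.
have B1 : 1 <= B by rewrite lerDl mulr_ge0.
have B0 : 0 <= B by rewrite (le_trans _ B1).
have [A A0 HA] := @deflate_bounded B M n.+1 B0 M0.
have [E E0 HE] := @deflate_close B A n.+1 B0 A0.
(* [M'] bounds the coefficients of both quotients and also [E * (d + nc (z - w))], since the
   induction hypothesis wants the distance to stay below the coefficient bound. *)
pose M' := A + E * (M + (B + B)).
have M'0 : 0 <= M' by rewrite !(addr_ge0, mulr_ge0).
have [K K0 HK] := IH _ M'0.
pose K1 := n.+2%:R * B ^+ n.+2.
have K10 : 0 <= K1 by rewrite mulr_ge0// exprn_ge0.
(* The first term is for the pair [z], [w], the second for the pairs given by induction; [d <= M]
   trades surplus powers of [d] for powers of [M]. *)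
exists (K1 ^+ n`! * M ^+ n`!.-1 + (K * E) ^+ n.+1 * (2 ^+ n.+1 * (M ^+ n + K1))).
  apply: addr_ge0; first by apply: mulr_ge0; apply: exprn_ge0.
  apply: mulr_ge0; first by apply: exprn_ge0; apply: mulr_ge0.
  apply: mulr_ge0; first exact: exprn_ge0.
  by apply: addr_ge0 => //; apply: exprn_ge0.
move=> p q d mp mq sp sq pM qM d0 dM pq.
have [z pz] : exists z, root p z by apply/closed_rootP; rewrite sp.
have zB : nc z <= B by exact: root_bound pM pz.
have [ss0 qss0] := closed_field_poly_normal q.
move: qss0; rewrite (monicP mq) scale1r => qss0.
have sss0 : size ss0 = n.+1.
  by have := congr1 (fun r : {poly C} => size r) qss0; rewrite size_prod_XsubC sq => -[].
have ss00 : ss0 != [::] by rewrite -size_eq0 sss0.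
have [w wss0 zw] := near_root z ss00.
have qw : root q w by rewrite qss0 root_prod_XsubC.
have wB : nc w <= B by exact: root_bound qM qw.
have zwK1 : nc (z - w) ^+ n.+1 <= K1 * d.
  rewrite -sss0 (le_trans zw)// -qss0.
  have -> : q.[z] = (q - p).[z] by rewrite hornerD hornerN (rootP pz) subr0.
  rewrite mulrC; apply: nc_horner_le => //.
    by rewrite (leq_trans (size_polyD _ _))// size_polyN sp sq maxnn.
  by move=> i; rewrite coefB nc_distC.
have [p' pE] : exists p', p = ('X - z%:P) * p'.
  by move/factor_theorem : pz => [p' ->]; exists p'; rewrite mulrC.
have [q' qE] : exists q', q = ('X - w%:P) * q'.
  by move/factor_theorem : qw => [q' ->]; exists q'; rewrite mulrC.
have mp' : p' \is monic by move: mp; rewrite pE monicMl ?monicXsubC.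
have mq' : q' \is monic by move: mq; rewrite qE monicMl ?monicXsubC.
have sp' : size p' = n.+1.
  move: sp; rewrite pE size_monicM ?monicXsubC ?monic_neq0// size_XsubC.
  by rewrite add2n/= => -[].
have sq' : size q' = n.+1.
  move: sq; rewrite qE size_monicM ?monicXsubC ?monic_neq0// size_XsubC.
  by rewrite add2n/= => -[].
have p'A : coef_bounded A p'.
  by move=> i; apply: (HA z p' n) => //; rewrite -?pE// addnS ltnS leq_addl.
have q'A : coef_bounded A q'.
  by move=> i; apply: (HA w q' n) => //; rewrite -?qE// addnS ltnS leq_addl.
pose e := nc (z - w).
have e0 : 0 <= e by exact: nc_ge0.
have eB : e <= B + B by rewrite (le_trans (ncB _ _))// lerD.
have [] := HK p' q' (E * (d + e)) => //.
- by move=> i; rewrite (le_trans (p'A i))// lerDl !(mulr_ge0, addr_ge0).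
- by move=> i; rewrite (le_trans (q'A i))// lerDl !(mulr_ge0, addr_ge0).
- by rewrite mulr_ge0// addr_ge0.
- by rewrite ler_wpDl// ler_wpM2l// lerD.
- move=> i; apply: (HE z w p' q' n) => //; rewrite -?pE -?qE//.
  by rewrite addnS ltnS leq_addl.
move=> rs [ss [srs sss prs qss rss]].
exists (z :: rs), (w :: ss); split => //=; rewrite ?srs ?sss ?big_cons -?prs -?qss//.
have fE : n.+1`! = (n.+1 * n`!)%N by rewrite factS.
case=> [_|i] /=; last first.
  rewrite ltnS => /rss h.
  rewrite fE mulnC exprM.
  apply: (@le_trans _ _ ((K * (E * (d + e))) ^+ n.+1)).
    by rewrite lerXn2r ?nnegrE ?exprn_ge0 ?nc_ge0 ?mulr_ge0 ?addr_ge0.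
  rewrite mulrA exprMn mulrDl ler_wpDl ?mulr_ge0 ?exprn_ge0//.
  rewrite -mulrA ler_wpM2l ?exprn_ge0 ?mulr_ge0//.
  rewrite (le_trans (powD_le _ _ _))// -mulrA ler_wpM2l ?exprn_ge0//.
  rewrite mulrDl; apply: lerD => //.
  rewrite exprSr; apply: ler_wpM2r => //. by apply: lerXn2r; rewrite ?nnegrE.
rewrite fE exprM mulrDl -[leLHS]addr0; apply: lerD; last first.
  apply: mulr_ge0 => //; apply: mulr_ge0; first by apply: exprn_ge0; apply: mulr_ge0.
  apply: mulr_ge0; first exact: exprn_ge0.
  by apply: addr_ge0 => //; exact: exprn_ge0.
apply: (@le_trans _ _ ((K1 * d) ^+ n`!)).
  apply: lerXn2r => //; rewrite nnegrE; [exact: exprn_ge0 (nc_ge0 _)|exact: mulr_ge0].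
rewrite exprMn -mulrA; apply: ler_wpM2l; first exact: exprn_ge0.
rewrite -[in d ^+ _](prednK (fact_gt0 n)) exprSr; apply: ler_wpM2r => //.
by apply: lerXn2r; rewrite ?nnegrE.
Qed.

End RootPerturbation.

(** * Sorted real parts of the roots *)

Section SortedRealParts.
Variable R : realType.
Local Notation C := R[i].

(** A count ignores the order of the entries, so this converts inequalities between sorted sequences
    into inequalities between counts of the unsorted ones. *)
Lemma sorted_nth_le_count (s : seq R) (c : R) j : sorted <=%R s ->
  (j < size s)%N -> (nth 0 s j <= c) = (j < count (fun x => (x <= c)%R) s)%N.
Proof.
elim: s j => // x s IH j /= xs; have ss := path_sorted xs.
have xle : all (>= x) s by apply: order_path_min xs; exact: le_trans.
have [xc|xc] := leP x c.
  by case: j => [|j] js /=; rewrite ?xc// IH.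
have -> : count (fun y => (y <= c)%R) s = 0%N.
  apply/eqP; rewrite -leqn0 leqNgt -has_count; apply/hasPn => y ys.
  by rewrite -ltNge (lt_le_trans xc)//; exact: (allP xle).
rewrite addn0 ltn0 => js; apply/negbTE; rewrite -ltNge (lt_le_trans xc)//.
by case: j js => //= j js; apply: (allP xle); apply: mem_nth.
Qed.

Lemma count_le_shift (s s' : seq R) (c e : R) : size s = size s' ->
  (forall i, (i < size s)%N -> s`_i <= s'`_i + e) ->
  (count (fun x => (x <= c)%R) s' <= count (fun x => (x <= c + e)%R) s)%N.
Proof.
elim: s s' => [|x s IH] [|x' s']//= [ss'] h.
rewrite leq_add//; last by apply: IH => // i; exact: (h i.+1).
have := h 0%N isT; rewrite /= => xx'.
by case: (leP x' c) => //= x'c; rewrite (le_trans xx')// lerD2r.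
Qed.

Lemma sort_shift (s s' : seq R) (e : R) j : size s = size s' ->
  (forall i, (i < size s)%N -> s`_i <= s'`_i + e) -> (j < size s)%N ->
  (sort <=%R s)`_j <= (sort <=%R s')`_j + e.
Proof.
move=> ss' h js.
have srt t : sorted <=%R (sort <=%R t : seq R) by apply: sort_sorted; exact: le_total.
rewrite sorted_nth_le_count ?srt ?size_sort// count_sort.
apply: leq_trans (count_le_shift _ ss' h).
rewrite -(count_sort <=%R) -sorted_nth_le_count ?srt ?size_sort -?ss'//.
Qed.

(** Sorting does not increase the maximal distance. The bound is phrased with an index attaining the
    maximum, so that a bound on a power of each distance applies directly. *)
Lemma sort_close (s s' : seq R) j : size s = size s' -> (j < size s)%N ->
  exists2 i, (i < size s)%N &
    `|(sort <=%R s)`_j - (sort <=%R s')`_j| <= `|s`_i - s'`_i|.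
Proof.
move=> ss' js; pose F (i : 'I_(size s)) := `|s`_i - s'`_i|.
case: (@Order.TotalTheory.arg_maxP _ _ _ (Ordinal js) xpredT F isT) => i _ imax.
exists i => //.
have H k : (k < size s)%N -> `|s`_k - s'`_k| <= F i.
  by move=> ks; exact: (imax (Ordinal ks)).
rewrite -/(F i); move: (F i) H => e H.
have h1 : (sort <=%R s)`_j <= (sort <=%R s')`_j + e.
  by apply: sort_shift => // k /H; rewrite ler_norml => /andP[_]; rewrite lerBlDl.
have h2 : (sort <=%R s')`_j <= (sort <=%R s)`_j + e.
  apply: sort_shift; rewrite -?ss'// => k /H; rewrite ler_norml => /andP[].
  by rewrite lerNl opprB lerBlDl.
by rewrite ler_norml; apply/andP; split; lra.
Qed.

Definition root_seq (p : {poly C}) : seq C := sval (closed_field_poly_normal p).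

Lemma root_seqE (p : {poly C}) : p \is monic ->
  p = \prod_(z <- root_seq p) ('X - z%:P).
Proof.
move=> mp; rewrite /root_seq; case: closed_field_poly_normal => /= s.
by rewrite (monicP mp) scale1r.
Qed.

Lemma size_root_seq n (p : {poly C}) : p \is monic -> size p = n.+1 ->
  size (root_seq p) = n.
Proof. by move=> /root_seqE {1}-> ; rewrite size_prod_XsubC => -[]. Qed.

(* The j-th smallest real part of a root, counted with multiplicity. *)
Definition sorted_Re (p : {poly C}) (j : nat) : R :=
  (sort <=%R [seq complex.Re z | z <- root_seq p])`_j.

(** [root_seq] is an arbitrary choice of enumeration; sorting forgets it. *)
Lemma sorted_ReE (p : {poly C}) (rs : seq C) j :
  p = \prod_(z <- rs) ('X - z%:P) ->
  sorted_Re p j = (sort <=%R [seq complex.Re z | z <- rs])`_j.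
Proof.
move=> prs; have mp : p \is monic by rewrite prs monic_prod_XsubC.
have pe : perm_eq (root_seq p) rs by apply: prod_XsubC_eq; rewrite -root_seqE.
congr nth; apply/perm_sortP; rewrite ?perm_map//.
- exact: le_total.
- exact: le_trans.
- exact: le_anti.
Qed.

Lemma sorted_Re_root n (p : {poly C}) j : p \is monic -> size p = n.+1 ->
  (j < n)%N -> exists2 z, root p z & sorted_Re p j = complex.Re z.
Proof.
move=> mp sp jn; set s := [seq complex.Re z | z <- root_seq p].
have : sorted_Re p j \in s.
  by rewrite -(mem_sort <=%R) mem_nth// size_sort size_map (size_root_seq mp sp).
by case/mapP => z zs ->; exists z => //; rewrite (root_seqE mp) root_prod_XsubC.
Qed.

Lemma root_sorted_Re n (p : {poly C}) z : p \is monic -> size p = n.+1 ->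
  root p z -> exists2 j, (j < n)%N & complex.Re z = sorted_Re p j.
Proof.
move=> mp sp; rewrite {1}(root_seqE mp) root_prod_XsubC => zp.
set s := [seq complex.Re z | z <- root_seq p].
have zs : complex.Re z \in sort <=%R s by rewrite mem_sort map_f.
exists (index (complex.Re z) (sort <=%R s)).
  by rewrite -(size_root_seq mp sp) -(size_map (@complex.Re R)) -(size_sort <=%R) index_mem.
by rewrite /sorted_Re nth_index.
Qed.

Lemma sorted_Re_close n (M : R) : 0 <= M -> exists2 K : R, 0 <= K &
  forall p q d j, p \is monic -> q \is monic -> size p = n.+1 -> size q = n.+1 ->
  coef_bounded M p -> coef_bounded M q -> 0 <= d -> d <= M -> coef_close d p q ->
  (j < n)%N -> `|sorted_Re p j - sorted_Re q j| ^+ n`! <= K * d.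
Proof.
move=> M0; have [K K0 HK] := roots_close n M0; exists K => //.
move=> p q d j mp mq sp sq pM qM d0 dM pq jn.
have [rs [ss [srs sss prs qss rss]]] := HK p q d mp mq sp sq pM qM d0 dM pq.
rewrite (sorted_ReE _ prs) (sorted_ReE _ qss).
have [||i] := @sort_close [seq complex.Re z | z <- rs] [seq complex.Re z | z <- ss] j.
- by rewrite !size_map srs sss.
- by rewrite size_map srs.
rewrite size_map srs => i_n h; apply: le_trans (rss i i_n).
apply: lerXn2r; rewrite ?nnegrE ?nc_ge0//; apply: (le_trans h).
rewrite (nth_map 0) ?srs// (nth_map 0) ?sss//.
by have := ler_ncRe (rs`_i - ss`_i); rewrite raddfB.
Qed.

End SortedRealParts.

Section MonicPoly.
Variable R : realType.
Local Notation C := R[i].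
Variable n : nat.
Implicit Types a : 'I_n -> C.

Let size_tail a : (size (\sum_(j < n) a j *: 'X^(n - j.+1) : {poly C})%R <= n)%N.
Proof.
apply: (leq_trans (size_sum _ _ _)); apply/bigmax_leqP => j _.
rewrite (leq_trans (size_scale_leq _ _))// size_polyXn.
by have := ltn_ord j; lia.
Qed.

Lemma size_monic_poly a : size (monic_poly a) = n.+1.
Proof. by rewrite size_polyDl size_polyXn// ltnS. Qed.

Lemma monic_monic_poly a : monic_poly a \is monic.
Proof. by rewrite monicE lead_coefDl ?size_polyXn ?ltnS// lead_coefXn. Qed.

Lemma coef_monic_poly a i : (monic_poly a)`_i =
  (i == n)%:R + \sum_(j < n) a j * (i == n - j.+1)%N%:R.
Proof.
rewrite coefD coefXn coef_sum; congr +%R.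
by apply: eq_bigr => j _; rewrite coefZ coefXn.
Qed.

Lemma coef_monic_poly_lt a (j : 'I_n) : (monic_poly a)`_(n - j.+1) = a j.
Proof.
have jn := ltn_ord j; rewrite coef_monic_poly.
have -> : (n - j.+1 == n)%N = false by lia.
rewrite add0r (bigD1 j)//= eqxx mulr1 big1 ?addr0// => i ij.
have -> : (n - j.+1 == n - i.+1)%N = false; last by rewrite mulr0.
by apply/negbTE; move: ij; rewrite -val_eqE/=; have := ltn_ord i; lia.
Qed.

Lemma coef_bounded_monic_poly (M : R) a : 1 <= M -> (forall j, nc (a j) <= M) ->
  coef_bounded M (monic_poly a).
Proof.
move=> M1 aM i; have M0 : 0 <= M by rewrite (le_trans _ M1).
have [i_n|n_i] := ltnP i n.
  have k : (n - i.+1 < n)%N by lia.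
  have -> : i = (n - (Ordinal k).+1)%N by rewrite /=; lia.
  by rewrite coef_monic_poly_lt.
have [->|ni] := eqVneq i n.
  have := monic_monic_poly a; rewrite monicE lead_coefE size_monic_poly => /eqP ->.
  by rewrite nc1.
by rewrite nth_default ?nc0// size_monic_poly; lia.
Qed.

Lemma coef_close_monic_poly (d : R) a b : 0 <= d ->
  (forall j, nc (a j - b j) <= d) -> coef_close d (monic_poly a) (monic_poly b).
Proof.
move=> d0 ab i; have [i_n|n_i] := ltnP i n.
  have k : (n - i.+1 < n)%N by lia.
  have -> : i = (n - (Ordinal k).+1)%N by rewrite /=; lia.
  by rewrite !coef_monic_poly_lt.
suff -> : (monic_poly a)`_i = (monic_poly b)`_i by rewrite subrr nc0.
rewrite !coef_monic_poly; congr +%R; apply: eq_bigr => j _.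
have -> : (i == n - j.+1)%N = false by have := ltn_ord j; lia.
by rewrite !mulr0.
Qed.

Lemma root_monic_poly a z : root (monic_poly a) z ->
  z ^+ n = - \sum_(j < n) a j * z ^+ (n - j.+1).
Proof.
rewrite rootE hornerD hornerXn horner_sum addr_eq0 => /eqP ->; congr -%R.
by apply: eq_bigr => j _; rewrite hornerZ hornerXn.
Qed.

End MonicPoly.

(** * Polynomial coefficients: crossings of increments *)

Section Crossing.
Variable R : realType.
Local Notation C := R[i].

Lemma size_det_le N d (A : 'M[{poly C}]_N) :
  (forall i j, (size (A i j) <= d.+1)%N) -> (size (\det A) <= (N * d).+1)%N.
Proof.
move=> Ad; rewrite (leq_trans (size_sum _ _ _))//; apply/bigmax_leqP => s _.
rewrite size_Msign.
rewrite (leq_trans (size_prod_leq _ _))// leq_subLR cardT size_enum_ord.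
have : (\sum_(i < N) size (A i (s i)) <= \sum_(i < N) d.+1)%N.
  by apply: leq_sum => i _; exact: Ad.
by rewrite sum_nat_const card_ord mulnS addnS ltnS.
Qed.

Variables (n r : nat).
Hypothesis n_gt0 : (0 < n)%N.
Local Notation I := {ffun 'I_r -> 'I_n}.

(** Entry [(a, c)] of the companion matrix: row [a] expresses the power [a.+1] of a root in the
    powers below [n]. In the last row [rev_ord] appears because [al] is indexed from the leading
    side, [al j] being the coefficient of degree [n - j.+1]. *)
Definition companion (A : pzRingType) (al : 'I_n -> A) (a c : 'I_n) : A :=
  if (a.+1 < n)%N then (c == a.+1 :> nat)%:R else - al (rev_ord c).

Lemma companionP (al : 'I_n -> C) z a : root (monic_poly al) z ->
  \sum_(c < n) companion al a c * z ^+ c = z ^+ a.+1.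
Proof.
move=> /root_monic_poly zn; rewrite /companion; case: ltnP => an.
  rewrite (bigD1 (Ordinal an))//= eqxx mul1r big1 ?addr0// => c ca.
  have -> : (c == a.+1 :> nat) = false by apply/negbTE; rewrite -val_eqE in ca.
  by rewrite mul0r.
have -> : a.+1 = n by have := ltn_ord a; lia.
rewrite zn -sumrN (reindex_inj rev_ord_inj)/=; apply: eq_bigr => c _.
by rewrite rev_ordK mulNr.
Qed.

Definition update (a : I) (i : 'I_r) (c : 'I_n) : I :=
  [ffun i' => if i' == i then c else a i'].

(* Multiplication by [\sum_i w i * x_i] on the monomials [\prod_i x_i ^ (a i)]
   with all exponents below [n], where [x_i] is a root of [monic_poly (al i)]. *)
Definition sum_mx (A : pzRingType) (w : 'I_r -> A) (al : 'I_r -> 'I_n -> A)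
  (a b : I) : A :=
  \sum_(i < r) \sum_(c < n) w i * companion (al i) (a i) c * (b == update a i c)%:R.

Definition monomial (la : 'I_r -> C) (a : I) : C := \prod_(i < r) la i ^+ a i.

(** Read as an eigenvector equation, this turns a linear relation between roots into the vanishing
    of a determinant. Exponents that reach [n] are lowered by [companionP]. *)
Lemma sum_mxP (w : 'I_r -> C) (al : 'I_r -> 'I_n -> C) (la : 'I_r -> C) a :
  (forall i, root (monic_poly (al i)) (la i)) ->
  \sum_b sum_mx w al a b * monomial la b = (\sum_i w i * la i) * monomial la a.
Proof.
move=> rla; under eq_bigr do rewrite big_distrl/=.
rewrite exchange_big/= big_distrl/=; apply: eq_bigr => i _.
under eq_bigr do rewrite big_distrl/=.
rewrite exchange_big/=.
have E c : \sum_(b : I) w i * companion (al i) (a i) c * (b == update a i c)%:R * monomial la b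
    = w i * companion (al i) (a i) c * monomial la (update a i c).
  rewrite (bigD1 (update a i c))//= eqxx mulr1 big1 ?addr0// => b /negbTE ->.
  by rewrite mulr0 mul0r.
under eq_bigr do rewrite E.
have F c : monomial la (update a i c) = la i ^+ c * \prod_(i' < r | i' != i) la i' ^+ a i'.
  rewrite /monomial (bigD1 i)//= ffunE eqxx; congr *%R.
  by apply: eq_bigr => i' /negbTE i'i; rewrite ffunE i'i.
under eq_bigr do rewrite F mulrA -(mulrA (w i)) -mulrA.
rewrite -big_distrr/= -[RHS]mulrA; congr *%R.
rewrite -big_distrl/= companionP// exprS -mulrA; congr *%R.
by rewrite /monomial [in RHS](bigD1 i).
Qed.

(** [W] is the characteristic determinant of [sum_mx] at the level [c], as a polynomial in [x]. It
    can vanish identically only if [c] is an eigenvalue at [x = 0], which gives the finite set [X].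
    While [X] depends on the polynomials, [D] does not: this is the source of all uniform counts. *)
Lemma crossing_poly d : exists D : nat, forall (w : 'I_r -> C)
    (al : 'I_r -> 'I_n -> {poly C}), (forall i j, (size (al i j) <= d.+1)%N) ->
  exists X : seq C, forall c, c \notin X -> exists W : {poly C},
    [/\ W != 0, (size W <= D.+1)%N &
     forall x la, (forall i, root (monic_poly (fun j => (al i j).[x])) (la i)) ->
       \sum_i w i * la i = c -> root W x].
Proof.
pose N := #|{: I}|; exists (N * d)%N => w al ald.
pose wP i : {poly C} := (w i)%:P.
pose M : 'M[{poly C}]_N := \matrix_(i, j) sum_mx wP al (enum_val i) (enum_val j).
pose Mx x : 'M[C]_N := \matrix_(i, j)
  sum_mx w (fun i j => (al i j).[x]) (enum_val i) (enum_val j).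
have MxE x : map_mx (horner_eval x) M = Mx x.
  apply/matrixP => i j; rewrite !mxE /horner_eval horner_sum.
  apply: eq_bigr => k _; rewrite horner_sum; apply: eq_bigr => c _.
  rewrite !hornerM hornerC; congr (_ * _ * _).
    by rewrite /companion; case: ifP => _; rewrite ?hornerN// -(rmorph_nat polyC) hornerC.
  by rewrite -(rmorph_nat polyC) hornerC.
exists (root_seq (char_poly (Mx 0))) => c cX; exists (\det (M - c%:P%:M)).
have detE x : (\det (M - c%:P%:M)).[x] = \det (Mx x - c%:M).
  rewrite -[LHS]/(horner_eval x _) -det_map_mx map_mxB MxE map_scalar_mx.
  by rewrite /= /horner_eval hornerC.
split.
- apply: contra cX => /eqP d0; have := detE 0; rewrite d0 horner0 => /esym/eqP.
  move=> /det0P[v v0]; rewrite mulmxBr => /eqP; rewrite subr_eq0 => /eqP vM.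
  rewrite -root_prod_XsubC -root_seqE ?char_poly_monic// -eigenvalue_root_char.
  by apply/eigenvalueP; exists v => //; rewrite vM mul_mx_scalar.
- apply: size_det_le => i j; rewrite !mxE.
  rewrite (leq_trans (size_polyD _ _))// geq_max; apply/andP; split; last first.
    by rewrite size_polyN; case: eqP => _; rewrite ?mulr1n ?mulr0n ?size_poly0// (leq_trans (size_polyC_leq1 _)).
  rewrite (leq_trans (size_sum _ _ _))//; apply/bigmax_leqP => k _.
  rewrite (leq_trans (size_sum _ _ _))//; apply/bigmax_leqP => e _.
  have h : (size (wP k * companion (al k) (enum_val i k) e)%R <= d.+1)%N.
    rewrite mul_polyC (leq_trans (size_scale_leq _ _))// /companion.
    case: ifP => _; last by rewrite size_polyN.
    by case: eqP; rewrite ?size_poly1 ?size_poly0.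
  by case: eqP; rewrite ?mulr1// mulr0 size_poly0.
(* The eigenvector is a column and [det0P] gives rows, hence the transposition. The vector of
   monomials is nonzero because its entry with all exponents 0 is 1. *)
- move=> x la rla lac; rewrite rootE detE -det_tr; apply/det0P.
  exists (\row_j monomial la (enum_val j)).
    have a0 : I by exact: [ffun _ => Ordinal n_gt0].
    pose a1 : I := [ffun _ => Ordinal n_gt0].
    apply/eqP => /rowP /(_ (enum_rank a1)); rewrite !mxE enum_rankK /monomial.
    under eq_bigr do rewrite ffunE expr0.
    by rewrite big1// => /eqP; rewrite oner_eq0.
  rewrite linearB/= tr_scalar_mx mulmxBr mul_mx_scalar; apply/eqP; rewrite subr_eq0; apply/eqP.
  apply/rowP => j; rewrite !mxE -lac.
  rewrite -(sum_mxP w (enum_val j) rla) [RHS](reindex_onto (@enum_val _ predT) enum_rank)/=; last first.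
    by move=> b _; rewrite enum_rankK.
  apply: eq_big => [b|b _]; first by rewrite enum_valK eqxx.
  by rewrite !mxE mulrC.
Qed.

End Crossing.

Section SignChanges.
Variable R : realType.
Local Notation C := R[i].

Lemma poly_lipschitz (B : R) (p : {poly C}) : 0 <= B -> exists2 L : R, 0 <= L &
  forall t s : R, `|t| <= B -> `|s| <= B ->
  nc (p.[t%:C%C] - p.[s%:C%C]) <= L * `|t - s|.
Proof.
move=> B0; elim/poly_ind: p => [|p c [L L0 IH]].
  by exists 0 => // t s _ _; rewrite !horner0 subr0 nc0 mul0r.
exists (L * B + (nc p.[0] + L * B)).
  by apply: addr_ge0; [exact: mulr_ge0|apply: addr_ge0; [exact: nc_ge0|exact: mulr_ge0]].
move=> t s tB sB; rewrite !hornerMXaddC.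
have -> : p.[t%:C%C] * t%:C%C + c - (p.[s%:C%C] * s%:C%C + c) =
  (p.[t%:C%C] - p.[s%:C%C]) * t%:C%C + p.[s%:C%C] * (t - s)%:C%C.
  by rewrite rmorphB/=; ring.
rewrite (le_trans (ncD _ _))// !ncM !nc_real mulrDl; apply: lerD.
  rewrite mulrAC; apply: ler_pM => //; [exact: nc_ge0|exact: IH].
apply: ler_wpM2r => //.
have -> : p.[s%:C%C] = p.[0] + (p.[s%:C%C] - p.[0]) by rewrite addrC subrK.
rewrite (le_trans (ncD _ _))// lerD2l (le_trans (IH s 0 _ _)) ?normr0// subr0.
by apply: ler_wpM2l.
Qed.

Lemma continuous_dist (f : R -> R) (t0 : R) :
  (forall e : R, 0 < e -> exists2 d : R, 0 < d &
    forall t, `|t0 - t| < d -> `|f t0 - f t| < e) -> {for t0, continuous f}.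
Proof.
move=> H; apply/cvgrPdist_lt => e /H[d d0 h].
by exists d => //= t; exact: h.
Qed.

Variable n : nat.
Hypothesis n_gt0 : (0 < n)%N.

Definition poly_at (T : 'I_n -> {poly C}) (t : R) : {poly C} :=
  monic_poly (fun j => (T j).[t%:C%C]).

Lemma sorted_Re_continuous (T : 'I_n -> {poly C}) j : (j < n)%N ->
  continuous (fun t : R => sorted_Re (poly_at T t) j).
Proof.
move=> jn t0; pose B := `|t0| + 1.
have B0 : 0 <= B by rewrite addr_ge0.
have /choice[L HL] : forall i : 'I_n, exists L : R, 0 <= L /\
    forall t s : R, `|t| <= B -> `|s| <= B ->
    nc ((T i).[t%:C%C] - (T i).[s%:C%C]) <= L * `|t - s|.
  by move=> i; have [L ? ?] := poly_lipschitz (T i) B0; exists L.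
pose Ls := \sum_i L i.
have LLs i : L i <= Ls.
  by rewrite /Ls (bigD1 i)//= lerDl sumr_ge0// => k _; have [] := HL k.
have Ls0 : 0 <= Ls by rewrite sumr_ge0// => k _; have [] := HL k.
pose M := 1 + Ls + \sum_i nc (T i).[t0%:C%C].
have S0 : 0 <= \sum_i nc (T i).[t0%:C%C] by rewrite sumr_ge0// => k _; exact: nc_ge0.
have M1 : 1 <= M by rewrite /M -addrA lerDl addr_ge0.
have M0 : 0 <= M by rewrite (le_trans _ M1).
have [K K0 HK] := @sorted_Re_close R n M M0.
have t0B : `|t0| <= B by rewrite lerDl.
have T0M i : nc (T i).[t0%:C%C] <= \sum_i nc (T i).[t0%:C%C].
  by rewrite (bigD1 i)//= lerDl sumr_ge0// => k _; exact: nc_ge0.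
apply: continuous_dist => e e0.
pose del := e ^+ n`! / (K * Ls + 1).
have KL1 : 0 < K * Ls + 1 by rewrite ltr_wpDl// mulr_ge0.
have del0 : 0 < del by rewrite divr_gt0// exprn_gt0.
exists (Num.min 1 del); first by rewrite lt_min ltr01.
move=> t; rewrite lt_min => /andP[tt0 tdel].
have tB : `|t| <= B.
  have -> : t = t0 - (t0 - t) by rewrite opprB addrC subrK.
  by rewrite (le_trans (ler_normB _ _))// lerD2l ltW.
have dist i : nc ((T i).[t0%:C%C] - (T i).[t%:C%C]) <= Ls * `|t0 - t|.
  have [_ h] := HL i; rewrite (le_trans (h _ _ _ _))//.
  by apply: ler_wpM2r.
have Lt : Ls * `|t0 - t| <= Ls by rewrite -[leRHS]mulr1 ler_wpM2l// ltW.
rewrite -(@ltr_pXn2r _ n`!) ?nnegrE ?(ltW e0) ?fact_gt0//.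
have := HK (poly_at T t0) (poly_at T t) (Ls * `|t0 - t|) j.
move=> /(_ (monic_monic_poly _) (monic_monic_poly _) (size_monic_poly _) (size_monic_poly _)).
move=> h; apply: le_lt_trans (h _ _ _ _ _ jn) _.
- apply: coef_bounded_monic_poly => // i; apply: (le_trans (T0M i)).
  by rewrite /M lerDr addr_ge0.
- apply: coef_bounded_monic_poly => // i.
  have -> : (T i).[t%:C%C] = (T i).[t0%:C%C] - ((T i).[t0%:C%C] - (T i).[t%:C%C]).
    by rewrite opprB addrC subrK.
  rewrite (le_trans (ncB _ _))// /M [leRHS]addrC; apply: lerD; first exact: T0M.
  by rewrite (le_trans (dist i))// (le_trans Lt)// lerDr.
- exact: mulr_ge0.
- by rewrite (le_trans Lt)// /M -addrA addrCA lerDl addr_ge0.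
- by apply: coef_close_monic_poly => //; exact: mulr_ge0.
rewrite mulrA; apply: (@le_lt_trans _ _ ((K * Ls + 1) * `|t0 - t|)).
  by apply: ler_wpM2r => //; rewrite lerDl.
by rewrite -ltr_pdivlMl// mulrC.
Qed.

(** Twice a real part is a root plus its conjugate, and the conjugate is a root of the polynomial
    with conjugate coefficients, which at real parameters are again polynomials in the parameter. *)
Lemma root_monic_conj (a : 'I_n -> C) z : root (monic_poly a) z ->
  root (monic_poly (fun j => (a j)^*%C)) (z^*%C).
Proof.
move=> az; suff -> : monic_poly (fun j => (a j)^*%C) = map_poly conjc (monic_poly a).
  by rewrite fmorph_root.
rewrite /monic_poly rmorphD/= map_polyXn rmorph_sum/=; congr +%R.
by apply: eq_bigr => j _; rewrite map_polyZ map_polyXn.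
Qed.

Lemma horner_conj (p : {poly C}) (t : R) :
  (map_poly conjc p).[t%:C%C] = (p.[t%:C%C])^*%C.
Proof.
rewrite -[RHS](horner_map (@conjc R))/=; congr (_.[_]).
by rewrite /= oppr0.
Qed.

(** [H t = c] says that [z1 + conj z1 - z2 - conj z2 = 2 c] for roots of four polynomials with
    coefficients polynomial in [t], so [t] is a zero of the [W] of [crossing_poly]. On a grid
    interval without such a zero the intermediate value theorem keeps [H - c] of one sign. Each zero
    can spoil two indices, whence [2 * D0]. *)
Lemma sign_changes d : exists D : nat,
  forall (T T' : 'I_n -> {poly C}) j (a tau : R), (j < n)%N -> 0 < tau ->
  (forall i, (size (T i) <= d.+1)%N) -> (forall i, (size (T' i) <= d.+1)%N) ->
  let H t := sorted_Re (poly_at T (t + tau)) j - sorted_Re (poly_at T' t) j in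
  exists X : seq R, forall c, c \notin X -> exists2 Z : seq nat, (size Z <= D)%N &
    forall i, i \notin Z -> (c < H (a + tau *+ i)) = (c < H (a + tau *+ i.+1)) /\
      (H (a + tau *+ i) < c) = (H (a + tau *+ i.+1) < c).
Proof.
have [D0 HD] := @crossing_poly R n 4 n_gt0 d; exists (2 * D0)%N => T T' j a tau jn tau0 sT sT' H.
pose shift (p : {poly C}) := p \Po ('X + tau%:C%C%:P).
have shiftE p t : (shift p).[t%:C%C] = p.[(t + tau)%:C%C].
  by rewrite horner_comp !hornerE rmorphD.
pose w (i : 'I_4) : C := if (i < 2)%N then 1 else -1.
pose al (i : 'I_4) (k : 'I_n) : {poly C} := nth 0
  [:: shift (T k); map_poly conjc (shift (T k)); T' k; map_poly conjc (T' k)] i.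
have [|X HX] := HD w al.
  have sTs k : (size (shift (T k)) <= d.+1)%N.
    by rewrite size_comp_poly2 ?sT// size_XaddC.
  by case=> [[|[|[|[|]]]]]//= ilt k; rewrite /al/= ?size_map_poly.
exists [seq complex.Re c / 2 | c <- X] => c cX.
have [|W [W0 sW HW]] := HX (2 * c)%:C%C.
  apply: contra cX => cX; apply/mapP; exists (2 * c)%:C%C => //=.
  by rewrite mulrAC divff ?mul1r// pnatr_eq0.
have [rs Wrs] := closed_field_poly_normal W.
have lW0 : lead_coef W != 0 by rewrite lead_coef_eq0.
(* The index of the grid interval containing the zero. Its predecessor is listed too, because a zero
   at a grid point also belongs to the closed interval on its left. *)
pose f (z : C) := Num.truncn ((complex.Re z - a) / tau).
exists (flatten [seq [:: f z; (f z).-1] | z <- rs]).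
  have srs : size rs = (size W).-1.
    by rewrite Wrs size_scale// size_prod_XsubC.
  rewrite size_flatten /shape -map_comp.
  have -> : [seq (size \o (fun z => [:: f z; (f z).-1])) z | z <- rs] = nseq (size rs) 2%N.
    by elim: rs {Wrs srs} => //= z rs ->.
  by rewrite sumn_nseq srs leq_mul2l/=; case: (size W) sW.
have key t : H t = c -> t%:C%C \in rs.
  move=> Htc.
  have [z1 z1r E1] := sorted_Re_root (monic_monic_poly _) (size_monic_poly _) jn
     (p := poly_at T (t + tau)).
  have [z2 z2r E2] := sorted_Re_root (monic_monic_poly _) (size_monic_poly _) jn
     (p := poly_at T' t).
  pose la (i : 'I_4) : C := nth 0 [:: z1; z1^*%C; z2; z2^*%C] i.
  have : root W t%:C%C.
    apply: (HW _ la).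
      case=> [[|[|[|[|]]]]]//= ilt; rewrite /al /la/=.
      - by under eq_fun do rewrite shiftE.
      - by under eq_fun do rewrite horner_conj shiftE; exact: root_monic_conj.
      - by under eq_fun do rewrite horner_conj; exact: root_monic_conj.
    rewrite !big_ord_recl big_ord0 /w /la /= -Htc /H E1 E2.
    case: z1 {z1r E1 la} => x1 y1; case: z2 {z2r E2} => x2 y2 /=.
    by rewrite !mul1r !mulN1r addr0; simpc; congr (_ +i* _)%C; ring.
  by rewrite Wrs rootZ// root_prod_XsubC.
have contH : continuous H.
  move=> t; apply: cvgB; last exact: sorted_Re_continuous.
  apply: (@continuous_comp _ _ _ (fun t => t + tau) (fun t => sorted_Re (poly_at T t) j)).
    by apply: cvgD; [exact: cvg_id|exact: cvg_cst].
  exact: sorted_Re_continuous.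
move=> i iZ.
have step : a + tau *+ i <= a + tau *+ i.+1 by rewrite lerD2l mulrS lerDr ltW.
suff noroot r : r \in `[a + tau *+ i, a + tau *+ i.+1] -> H r = c -> False.
  have cross : ~ (Num.min (H (a + tau *+ i)) (H (a + tau *+ i.+1)) <= c <=
      Num.max (H (a + tau *+ i)) (H (a + tau *+ i.+1))).
    move=> h; have [|r ri Hr] := IVT step _ h; first exact: continuous_subspaceT.
    exact: (noroot r).
  move: cross; rewrite ge_min le_max.
  by case: (ltgtP c (H (a + tau *+ i))) => h1; case: (ltgtP c (H (a + tau *+ i.+1))) => h2;
    rewrite ?orbT //= => /(_ isT).
move=> ri Hr; move/negP: iZ; apply.
apply/flattenP; exists [:: f r%:C%C; (f r%:C%C).-1].
  by apply: map_f; exact: key.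
have /andP[ri1 ri2] : i%:R <= (r - a) / tau <= i.+1%:R.
  move: ri; rewrite in_itv/= => /andP[r1 r2]; apply/andP; split.
    by rewrite ler_pdivlMr// mulr_natl lerBrDl.
  by rewrite ler_pdivrMr// mulr_natl lerBlDl.
have rat0 : 0 <= (r - a) / tau by rewrite (le_trans _ ri1).
rewrite !inE /f/=; move: ri2; rewrite le_eqVlt => /predU1P[E|ri2].
  by rewrite E natrK/= eqxx orbT.
by rewrite (@truncn_def _ _ i) ?eqxx// ri1.
Qed.

End SignChanges.

(** * Counting large increments *)

Section MultiScale.
Variable R : realType.

Lemma avoid_seq (X : seq R) (a b : R) : a < b ->
  exists c, [/\ a < c, c <= b & c \notin X].
Proof.
elim: X b => [|x X IH] b ab; first by exists b.
pose b' := if a < x <= b then (a + x) / 2 else b.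
have ab' : a < b' by rewrite /b'; case: ifP => // /andP[ax xb]; lra.
have b'b : b' <= b by rewrite /b'; case: ifP => // /andP[ax xb]; lra.
have [c [ac cb' cX]] := IH _ ab'; exists c; split => //; first exact: le_trans b'b.
rewrite inE negb_or cX andbT; apply/eqP => cx; move: cb'; rewrite /b'.
by case: ifP => [/andP[ax xb]|]; [lra|rewrite -cx ac => /= /negbT; rewrite -ltNge; lra].
Qed.

(* A run starts at 0 or just after a change point, and has at most l / tau elements. *)
Lemma card_runs (N : nat) (P : pred nat) (Z : seq nat) (tau l : R) :
  0 < tau -> 0 <= l ->
  (forall i, (i.+1 < N)%N -> i \notin Z -> P i = P i.+1) ->
  (forall u e, (u <= e)%N -> (e < N)%N -> (forall i, (u <= i <= e)%N -> P i) ->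
     (e - u).+1%:R * tau <= l) ->
  #|[set i : 'I_N | P i]%SET|%:R * tau <= (size Z).+1%:R * l.
Proof.
move=> tau0 l0 PZ run.
pose K := Num.truncn (l / tau).
have lt0 : 0 <= l / tau by rewrite divr_ge0// ltW.
have Kl : K%:R * tau <= l.
  by rewrite -ler_pdivlMr//; have /andP[] := truncn_itv lt0.
pose starts := 0%N :: map S Z.
have cover e : (e < N)%N -> P e -> exists2 u, u \in starts &
    ((u <= e)%N /\ forall i, (u <= i <= e)%N -> P i).
  elim: e => [_ P0|e IH eN Pe].
    exists 0%N; first by rewrite mem_head.
    by split => // i; rewrite leqn0 => /eqP ->.
  have [eZ|eZ] := boolP (e \in Z).
    exists e.+1; first by rewrite inE map_f ?orbT.
    by split => // i; rewrite -eqn_leq => /eqP <-.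
  have [|u us [ue uP]] := IH (ltnW eN); first by rewrite PZ.
  exists u => //; split; first exact: leqW.
  move=> i /andP[ui]; rewrite leq_eqVlt => /predU1P[->//|ie].
  by apply: uP; rewrite ui.
pose A u : {set 'I_N} := [set i : 'I_N | (u <= i < u + K)%N]%SET.
have cA u : (#|A u| <= K)%N.
  rewrite cardE -(size_map val) -[leqRHS](size_iota u); apply: uniq_leq_size.
    by rewrite map_inj_uniq ?enum_uniq//; exact: val_inj.
  by move=> i /mapP[j]; rewrite mem_enum inE => ju ->; rewrite mem_iota.
have sub : [set i : 'I_N | P i]%SET \subset (\bigcup_(u <- starts) A u)%SET.
  apply/fintype.subsetP => i; rewrite inE => Pi.
  have [u us [ui uP]] := cover _ (ltn_ord i) Pi.
  suff iAu : i \in A u.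
    elim: starts us {cover} => // v t IH; rewrite inE big_cons finset.in_setU.
    by move=> /predU1P[<-|/IH ->]; rewrite ?iAu// orbT.
  rewrite inE ui/=.
  have := run _ _ ui (ltn_ord i) uP; rewrite -ler_pdivlMr// => h.
  have : ((i - u).+1 <= K)%N by rewrite truncn_ge_nat.
  by move: ui; lia.
apply: (@le_trans _ _ ((size Z).+1%:R * (K%:R * tau))); last by rewrite ler_wpM2l.
rewrite mulrA -natrM ler_wpM2r// ?(ltW tau0)// ler_nat.
apply: (leq_trans (subset_leq_card sub)).
have -> : (size Z).+1 = size starts by rewrite /= size_map.
elim: starts {cover sub} => [|u s IH]; first by rewrite big_nil cards0.
rewrite big_cons (leq_trans (leq_card_setU _ _).1)// mulSn leq_add//; exact: cA.
Qed.

Lemma sum_half L (a : R) : 0 <= a -> \sum_(1 <= l < L) a / 2 ^+ l <= a.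
Proof.
move=> a0; have [->|L0] := posnP L; first by rewrite big_geq.
suff -> : \sum_(1 <= l < L) a / 2 ^+ l = a - a / 2 ^+ L.-1.
  by rewrite gerBl divr_ge0// exprn_ge0.
elim: L L0 => // L IH _; have [->|L0] := posnP L; first by rewrite big_geq// expr0 divr1 subrr.
rewrite big_nat_recr//= IH// -[in 2 ^+ L](prednK L0) exprS.
by field; rewrite expf_neq0.
Qed.

Lemma bernoulli_root (w A : R) N : (0 < N)%N -> 0 <= w -> 0 <= A ->
  w ^+ N <= A -> w <= 1 + A.
Proof.
move=> N0 w0 A0 wA; have [w1|w1] := leP w 1; first by rewrite (le_trans w1)// lerDl.
rewrite (@le_trans _ _ A)// ?lerDr// (le_trans _ wA)//.
by rewrite ler_eXnr// ltW.
Qed.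

Lemma telescope_lower (g : nat -> R) (c : R) u e : (u <= e)%N ->
  (forall i, (u <= i <= e)%N -> c <= g i.+1 - g i) ->
  (e - u).+1%:R * c <= g e.+1 - g u.
Proof.
move=> ue H; have := telescope_sumr g (leqW ue) => <-.
rewrite mulr_natl -subSn// -sumr_const_nat big_nat [leRHS]big_nat.
by apply: ler_sum => i; rewrite ltnS; exact: H.
Qed.

(** [x] holds the true values and [z I] their approximations at scale [I]. With
    [s = 2 ^ (3 (N0 - 1) m)], a steep interval is assigned to the first [l] at which the
    approximation at scale [m + l] has an increment above a threshold [c l] somewhat below [s tau].
    For [l = 0] runs are short by the Holder bound. For later [l] the thresholds differ enough for
    consecutive approximations to drift apart along a run, which their closeness to [x] forbids for
    long. *)
Lemma steep_count (N0 D : nat) (E H : R) : (1 < N0)%N -> 0 <= E -> 0 <= H ->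
  exists2 C : R, 0 <= C &
  forall (x : nat -> R) (z : nat -> nat -> R) (tau : R) (N : nat), 0 < tau ->
  (forall I i, (i <= N)%N -> `|x i - z I i| <= E / 16 ^+ I) ->
  (forall I, exists X : seq R, forall c, c \notin X -> exists2 Z : seq nat,
     (size Z <= D * 4 ^ I)%N & forall i, (i.+1 < N)%N -> i \notin Z ->
       (c < z I i.+1 - z I i) = (c < z I i.+2 - z I i.+1)) ->
  (forall i j, (i <= j)%N -> (j <= N)%N ->
     `|x j - x i| ^+ N0 <= H * ((j - i)%:R * tau)) ->
  forall m, #|[set i : 'I_N | 2 ^+ (3 * N0.-1 * m) * tau < x i.+1 - x i]%SET|%:R * tau
    <= C / 2 ^+ ((3 * N0.-1).+1 * m).
Proof.
move=> N01 E0 H0.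
(* [8 * E] answers the case where the approximation error dominates, the rest the case where the
   Holder bound applies. *)
pose A0 := 8 * E + 1 + 4 ^+ N0 * H.
have A00 : 0 <= A0 by rewrite !addr_ge0// mulr_ge0// exprn_ge0.
exists (D.+1%:R * A0 + (2 * D).+1%:R * (256 * E)).
  have E256 : 0 <= 256 * E := mulr_ge0 (ler0n _ _) E0.
  exact: addr_ge0 (mulr_ge0 (ler0n _ _) A00) (mulr_ge0 (ler0n _ _) E256).
move=> x z tau N tau0 xz cross holder m.
pose s : R := 2 ^+ (3 * N0.-1 * m); pose p : R := 2 ^+ m.
have s0 : 0 < s by rewrite exprn_gt0.
have p0 : 0 < p by rewrite exprn_gt0.
have p1 : 1 <= p by rewrite exprn_ege1// ler1n.
have sE : 2 ^+ ((3 * N0.-1).+1 * m) = s * p :> R.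
  by rewrite mulSn addnC exprD.
have st0 : 0 < s * tau by rewrite mulr_gt0.
have q0 l : 0 < (2 : R) ^+ l by rewrite exprn_gt0.
(* The thresholds rise from about [s * tau / 2] towards [s * tau]. Each may move in a small
   interval, so as to avoid the exceptional levels; consecutive ones stay at least
   [s * tau / 2 ^+ l.+3] apart. *)
have /choice[c Hc] : forall l, exists c, [/\ s * tau * (1 - 1 / 2 ^+ l.+1) < c,
    c <= s * tau * (1 - 1 / 2 ^+ l.+1 + 1 / 2 ^+ l.+3) &
    exists2 Z : seq nat, (size Z <= D * 4 ^ (m + l))%N &
      forall i, (i.+1 < N)%N -> i \notin Z ->
       (c < z (m + l)%N i.+1 - z (m + l)%N i) = (c < z (m + l)%N i.+2 - z (m + l)%N i.+1)].
  move=> l; have [X HX] := cross (m + l)%N.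
  have [|c [c1 c2 /HX HZ]] := @avoid_seq X (s * tau * (1 - 1 / 2 ^+ l.+1))
      (s * tau * (1 - 1 / 2 ^+ l.+1 + 1 / 2 ^+ l.+3)).
    by rewrite ltr_pM2l// ltrDl divr_gt0.
  by exists c.
have cS l : s * tau / 2 ^+ l.+3 <= c l.+1 - c l.
  have [_ h1 _] := Hc l; have [h2 _ _] := Hc l.+1.
  have -> : s * tau / 2 ^+ l.+3 = s * tau * (1 - 1 / 2 ^+ l.+2) -
     s * tau * (1 - 1 / 2 ^+ l.+1 + 1 / 2 ^+ l.+3).
    by rewrite !exprS; field; rewrite expf_neq0.
  by apply: lerB => //; exact: ltW.
have c0 : s * tau / 2 <= c 0%N.
  by have [h _ _] := Hc 0%N; apply/ltW/(le_lt_trans _ h); rewrite expr1; lra.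
pose good l i := c l < z (m + l)%N i.+1 - z (m + l)%N i.
pose Elev l i := good l i && (if l is l'.+1 then ~~ good l' i else true).
(* At scale [m + l0] the error is smaller than the gap between [c l0] and [s * tau], so every steep
   interval is caught at a level up to [l0]. *)
have [l0 Hl0] : exists l0 : nat, 8 * E < s * tau * 2 ^+ l0.
  have [k Hk] : exists k : nat, 8 * E / (s * tau) < k%:R.
    by exists (Num.truncn (8 * E / (s * tau))).+1; exact: truncnS_gt.
  exists k; rewrite [ltRHS]mulrC -ltr_pdivrMr// (lt_le_trans Hk)//.
  by rewrite -natrX ler_nat ltnW// ltn_expl.
have coverE (i : 'I_N) : s * tau < x i.+1 - x i -> exists2 l, (l < l0.+1)%N & Elev l i.
  move=> sx.
  have gl0 : good l0 i.
    rewrite /good; have [_ h _] := Hc l0; apply: (le_lt_trans h).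
    have h1 := xz (m + l0)%N i (ltnW (ltn_ord i)).
    have h2 := xz (m + l0)%N i.+1 (ltn_ord i).
    set e := E / 16 ^+ (m + l0) in h1 h2.
    have e0 : 0 <= e by rewrite divr_ge0// exprn_ge0.
    have he : 8 * e < s * tau / 2 ^+ l0.
      rewrite ltr_pdivlMr// /e exprD.
      have -> : (16 : R) ^+ l0 = 2 ^+ l0 * (2 ^+ l0 * 4 ^+ l0).
        by rewrite -!exprMn; congr (_ ^+ _); ring.
      have m16 : 1 <= (16 : R) ^+ m by rewrite exprn_ege1// ler1n.
      have l4 : 1 <= (4 : R) ^+ l0 by rewrite exprn_ege1// ler1n.
      rewrite -(@ltr_pM2r _ (2 ^+ l0))//; apply: le_lt_trans Hl0.
      have -> : 8 * (E / (16 ^+ m * (2 ^+ l0 * (2 ^+ l0 * 4 ^+ l0)))) * 2 ^+ l0 * 2 ^+ l0 =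
         8 * E / (16 ^+ m * 4 ^+ l0) by field; rewrite !expf_neq0.
      rewrite ler_pdivrMr ?mulr_gt0 ?exprn_gt0//.
      rewrite ler_peMr ?mulr_ge0// mulr_ege1//.
    have -> : s * tau * (1 - 1 / 2 ^+ l0.+1 + 1 / 2 ^+ l0.+3) =
      s * tau - 3 / 8 * (s * tau / 2 ^+ l0) by rewrite !exprS; field; rewrite expf_neq0.
    move: h1 h2; rewrite !ler_norml => /andP[h11 h12] /andP[h21 h22].
    by lra.
  have exg : exists l, good l i by exists l0.
  case: (ex_minnP exg) => l gl lmin; exists l; first by rewrite ltnS lmin.
  rewrite /Elev gl; case: l gl lmin => // l gl lmin.
  by apply/negP => /lmin; rewrite ltnn.
have bound0 : #|[set i : 'I_N | Elev 0%N i]%SET|%:R * tau <= D.+1%:R * A0 / (s * p).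
  have [_ _ [Z sZ HZ]] := Hc 0%N.
  (* The bound for one run: [p ^+ 3] is [8 ^ m], of which the number of runs will take [p ^+ 2]. *)
  pose l := A0 / (s * p ^+ 3).
  have l_ge0 : 0 <= l by apply: divr_ge0 => //; apply/ltW/mulr_gt0 => //; apply: exprn_gt0.
  have := @card_runs N (Elev 0%N) Z tau l tau0 l_ge0.
  move=> /(_ _ _)/le_trans; apply.
  - by move=> i iN /(HZ _ iN); rewrite /Elev !andbT.
  - move=> u e ue eN Pue; set y := _ * tau.
    have y0 : 0 <= y by rewrite mulr_ge0// ltW.
    have h1 : (e - u).+1%:R * (s * tau / 2) <= z m e.+1 - z m u.
      apply: telescope_lower => // i /Pue; rewrite /Elev/= andbT /good addn0 => /ltW.
      exact: le_trans.
    have h2 := xz m u (ltnW (leq_ltn_trans ue eN)); have h3 := xz m e.+1 eN.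
    have yE : (e - u).+1%:R * (s * tau / 2) = y * s / 2 by rewrite /y; ring.
    rewrite yE in h1.
    have e16 : E / 16 ^+ m = E / (p ^+ 4).
      by rewrite /p -exprM mulnC exprM; congr (E / _ ^+ _); rewrite -natrX.
    rewrite e16 in h2 h3; set ep := E / p ^+ 4 in h2 h3.
    have h4 : y * s / 2 <= `|x e.+1 - x u| + 2 * ep.
      move: h2 h3; rewrite !ler_norml => /andP[? ?] /andP[? ?].
      have := ler_norm (x e.+1 - x u); lra.
    rewrite /l ler_pdivlMr ?mulr_gt0 ?exprn_gt0//.
    (* Either the approximation error explains a fixed share of the rise along the run, or [x]
       itself moves by at least [y * s / 4]. *)
    have [h5|h5] := leP (y * s / 4) (2 * ep).
      apply: (@le_trans _ _ (8 * E)); last first.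
        by rewrite /A0 -addrA lerDl addr_ge0// mulr_ge0// exprn_ge0.
      have h6 : y * s * p ^+ 4 <= 8 * E.
        have -> : 8 * E = (8 * ep) * p ^+ 4 by rewrite /ep; field; rewrite gt_eqF.
        by rewrite ler_pM2r ?exprn_gt0//; lra.
      apply: le_trans h6; rewrite mulrA; apply: ler_wpM2l.
        by apply: mulr_ge0 => //; exact: ltW.
      exact: ler_weXn2l.
    have h6 : (y * s / 4) ^+ N0 <= H * y.
      have -> : y = (e.+1 - u)%:R * tau by rewrite /y subSn.
      have xle : y * s / 4 <= `|x e.+1 - x u| by lra.
      apply: le_trans (holder _ _ (leqW ue) eN).
      have -> : (e.+1 - u)%:R * tau = y by rewrite /y subSn.
      by apply: lerXn2r => //; rewrite nnegrE// divr_ge0// mulr_ge0// ltW.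
    have [->|yn0] := eqVneq y 0; first by rewrite mul0r.
    have ygt0 : 0 < y by rewrite lt_neqAle eq_sym yn0.
    (* The run length in its natural unit: the exponent [3 * N0.-1] in [s] makes [s ^+ N0] the power
       [N0.-1] of [p ^+ (3 * N0)], so that [w] is bounded by a constant. *)
    pose w := y * p ^+ (3 * N0).
    have w0 : 0 <= w by rewrite mulr_ge0// exprn_ge0// ltW.
    have hw : w ^+ N0.-1 <= 4 ^+ N0 * H.
      have N00 : (0 < N0)%N by exact: ltnW.
      have sN : s ^+ N0 = p ^+ (3 * N0) ^+ N0.-1.
        rewrite /s /p -!exprM; congr (_ ^+ _); ring.
      have : (y * s) ^+ N0 <= 4 ^+ N0 * H * y.
        by rewrite -mulrA [leRHS]mulrC -ler_pdivrMr ?exprn_gt0// -expr_div_n.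
      have yN : y ^+ N0 = y * y ^+ N0.-1 by rewrite -exprS prednK.
      rewrite /w (exprMn N0 y s) (exprMn N0.-1 y) sN yN => h; rewrite -(@ler_pM2r _ y)//; apply: le_trans h.
      by rewrite mulrC mulrA.
    have N1 : (0 < N0.-1)%N by move: N01; case: (N0) => // -[].
    have h7 := bernoulli_root N1 w0 (mulr_ge0 (exprn_ge0 _ (ler0n _ _)) H0) hw.
    have -> : y * (s * p ^+ 3) = w.
      rewrite /w /s /p -!exprM -exprD; congr (_ * _ ^+ _).
      by rewrite -[in RHS](prednK (ltnW N01)); ring.
    by rewrite (le_trans h7)// /A0 -addrA lerDr mulr_ge0.
  have -> : D.+1%:R * A0 / (s * p) = D.+1%:R * p ^+ 2 * l.
    by rewrite /l; field; rewrite !gt_eqF.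
  rewrite ler_wpM2r// /p -exprM mulnC exprM -natrX -natrX -natrM ler_nat.
  rewrite addn0 in sZ; rewrite mulSn -addn1 addnC leq_add// ?expn_gt0//.
have boundS l : #|[set i : 'I_N | Elev l.+1 i]%SET|%:R * tau <=
    (2 * D).+1%:R * (256 * E) / (s * p) / 2 ^+ l.+1.
  have [_ _ [Z sZ HZ]] := Hc l.+1; have [_ _ [Z' sZ' HZ']] := Hc l.
  pose r : R := 2 ^+ l.+1.
  have r0 : 0 < r by rewrite exprn_gt0.
  pose len := 256 * E / (s * p ^+ 4 * r ^+ 3).
  have len0 : 0 <= len.
    apply: divr_ge0; first exact: mulr_ge0 (ler0n _ _) E0.
    by apply/ltW/mulr_gt0; [apply: mulr_gt0 => //|]; apply: exprn_gt0.
  have := @card_runs N (Elev l.+1) (Z ++ Z') tau len tau0 len0.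
  move=> /(_ _ _)/le_trans; apply.
  - move=> i iN; rewrite mem_cat negb_or => /andP[/(HZ _ iN) h1 /(HZ' _ iN) h2].
    by rewrite /Elev /good h1 h2.
  - move=> u e ue eN Pue.
    (* Along a run assigned to [l.+1], [g] gains at least [s * tau / 2 ^+ l.+3] at each step, while
       its size stays within [2 * (E / 16 ^+ (m + l))]. *)
    pose g i := z (m + l.+1)%N i - z (m + l)%N i.
    have h1 : (e - u).+1%:R * (s * tau / 2 ^+ l.+3) <= g e.+1 - g u.
      apply: telescope_lower => // i /Pue; rewrite /Elev /good -leNgt => /andP[a1 a2].
      by have := cS l; rewrite /g; lra.
    have gb i : (i <= N)%N -> `|g i| <= 2 * (E / 16 ^+ (m + l)).
      move=> iN; have h2 := xz (m + l.+1)%N i iN; have h3 := xz (m + l)%N i iN.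
      have h4 : E / 16 ^+ (m + l.+1) <= E / 16 ^+ (m + l).
        rewrite ler_wpM2l// lef_pV2 ?posrE ?exprn_gt0// addnS exprS.
        by rewrite ler_peMl ?exprn_ge0// ler1n.
      move: h2 h3; rewrite /g !ler_norml => /andP[? ?] /andP[? ?].
      by apply/andP; split; lra.
    have := gb u (ltnW (leq_ltn_trans ue eN)); have := gb e.+1 eN.
    rewrite !ler_norml => /andP[? ?] /andP[? ?].
    have h5 : (e - u).+1%:R * (s * tau / 2 ^+ l.+3) <= 4 * (E / 16 ^+ (m + l)) by lra.
    have e16 : 16 ^+ (m + l) = p ^+ 4 * r ^+ 4 / 16 :> R.
      have e4 k : (2 : R) ^+ k ^+ 4 = 16 ^+ k.
        by rewrite -exprM mulnC exprM; congr (_ ^+ _); rewrite -natrX.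
      by rewrite /p /r !e4 exprD exprS; field.
    rewrite e16 in h5; rewrite /len ler_pdivlMr ?mulr_gt0 ?exprn_gt0//.
    have -> : (e - u).+1%:R * tau * (s * p ^+ 4 * r ^+ 3) =
       (e - u).+1%:R * (s * tau / 2 ^+ l.+3) * (4 * p ^+ 4 * r ^+ 4).
      by rewrite /r !(exprS _ l.+2) !(exprS _ l.+1); field; rewrite expf_neq0.
    have -> : 256 * E = 4 * (E / (p ^+ 4 * r ^+ 4 / 16)) * (4 * p ^+ 4 * r ^+ 4).
      by field; rewrite !gt_eqF.
    by rewrite ler_wpM2r// !mulr_ge0// ?exprn_ge0 ?ltW.
  have -> : (2 * D).+1%:R * (256 * E) / (s * p) / 2 ^+ l.+1 =
     (2 * D).+1%:R * (p ^+ 2 * r ^+ 2) * (p * len).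
    by rewrite /len -/r; field; rewrite !gt_eqF.
  (* A surplus factor [p] is given away; what is left still decays geometrically in [l]. *)
  apply: ler_pM => //; last by rewrite ler_peMl.
  have -> : p ^+ 2 * r ^+ 2 = (4 ^ (m + l.+1))%N%:R.
    rewrite -exprMn /p /r -exprD -exprM mulnC exprM [RHS]natrX; congr (_ ^+ _).
    by rewrite -natrX.
  rewrite -natrM ler_nat.
  rewrite size_cat mulSn -addn1 addnC leq_add ?expn_gt0//.
  rewrite mul2n -addnn mulnDl leq_add// (leq_trans sZ')// leq_mul2l leq_exp2l//.
  by rewrite addnS leqnSn orbT.
have sub : [set i : 'I_N | s * tau < x i.+1 - x i]%SET \subset
    (\bigcup_(l < l0.+1) [set i : 'I_N | Elev l i])%SET.
  apply/fintype.subsetP => i; rewrite inE => /coverE[l ll0 El].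
  by apply/finset.bigcupP; exists (Ordinal ll0) => //; rewrite inE.
have card_le : (#|[set i : 'I_N | (s * tau < x i.+1 - x i)%R]%SET| <=
    \sum_(l < l0.+1) #|[set i : 'I_N | Elev l i]%SET|)%N.
  rewrite (leq_trans (subset_leq_card sub))//.
  elim/big_rec2 : _ => [|l a b _ h]; first by rewrite cards0.
  by rewrite (leq_trans (leq_card_setU _ _).1)// leq_add2l.
apply: (@le_trans _ _ (\sum_(l < l0.+1) #|[set i : 'I_N | Elev l i]%SET|%:R * tau)).
  by rewrite -big_distrl/= ler_wpM2r ?(ltW tau0)// -natr_sum ler_nat.
rewrite big_ord_recl sE mulrDl; apply: lerD; first exact: bound0.
apply: (@le_trans _ _ (\sum_(1 <= l < l0.+1) (2 * D).+1%:R * (256 * E) / (s * p) / 2 ^+ l)).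
  by rewrite big_add1/= big_mkord; apply: ler_sum => l _; exact: boundS.
apply: sum_half; apply: divr_ge0 (ltW (mulr_gt0 s0 p0)).
exact: mulr_ge0 (ler0n _ _) (mulr_ge0 (ler0n _ _) E0).
Qed.

End MultiScale.

Section RootSteps.
Variable R : realType.
Local Notation C := R[i].

(** All that the counting uses of a coefficient along a curve. One [M] serves every bound and every
    centre [t0], so uniformity over families reduces to that of [M]. *)
Definition taylor_like (a b : R) (k : nat) (M : R) (c : R -> C) : Prop :=
  [/\ forall t, a <= t <= b -> nc (c t) <= M,
      forall s t, a <= s <= b -> a <= t <= b -> nc (c t - c s) <= M * `|t - s| &
      forall t0, a <= t0 <= b -> exists2 T : {poly C}, (size T <= k)%N &
        forall t, a <= t <= b -> nc (c t - T.[t%:C%C]) <= M * `|t - t0| ^+ k].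

Variable n : nat.
Hypothesis n_gt0 : (0 < n)%N.
Local Notation F := (n`!).
Local Notation N0 := (2 * n`!)%N.

(** Matching roots gives the exponent [1 / n!]. Squaring, at the cost of a factor [L], weakens it to
    [1 / (2 n!)], which is below 1 even for [n = 1]. *)
Lemma sorted_Re_holder (M L : R) : 0 <= M -> 0 <= L -> exists2 H : R, 0 <= H &
  forall a b k (c : 'I_n -> R -> C), b - a <= L ->
  (forall j, taylor_like a b k M (c j)) -> forall j, (j < n)%N ->
  forall u v, a <= u <= b -> a <= v <= b ->
  `|sorted_Re (monic_poly (c ^~ v)) j - sorted_Re (monic_poly (c ^~ u)) j| ^+ N0
    <= H * `|v - u|.
Proof.
move=> M0 L0; pose M1 := 1 + M + M * L.
have ML0 : 0 <= M * L by exact: mulr_ge0.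
have M11 : 1 <= M1 by rewrite /M1 -addrA lerDl addr_ge0.
have M10 : 0 <= M1 by rewrite (le_trans _ M11).
have [K K0 HK] := sorted_Re_close n M10.
exists ((K * M) ^+ 2 * L); first by rewrite mulr_ge0// exprn_ge0// mulr_ge0.
move=> a b k c abL hc j jn u v uab vab.
have uvL : `|v - u| <= L.
  rewrite (le_trans _ abL)// ler_norml.
  by move: uab vab => /andP[? ?] /andP[? ?]; apply/andP; split; lra.
have cM1 t i : a <= t <= b -> nc (c i t) <= M1.
  by move=> tab; have [h _ _] := hc i; rewrite (le_trans (h _ tab))// /M1; lra.
have := HK (monic_poly (c ^~ v)) (monic_poly (c ^~ u)) (M * `|v - u|) j
  (monic_monic_poly _) (monic_monic_poly _) (size_monic_poly _) (size_monic_poly _)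
  (coef_bounded_monic_poly M11 (fun i => cM1 v i vab))
  (coef_bounded_monic_poly M11 (fun i => cM1 u i uab)) (mulr_ge0 M0 (normr_ge0 _)).
have h1 : M * `|v - u| <= M1.
  by have := ler_wpM2l M0 uvL; rewrite /M1; lra.
have h2 : coef_close (M * `|v - u|) (monic_poly (c ^~ v)) (monic_poly (c ^~ u)).
  apply: coef_close_monic_poly; first exact: mulr_ge0.
  by move=> i; have [_ h _] := hc i; exact: h.
move=> /(_ h1 h2 jn) h; rewrite mulnC exprM.
set e := _ ^+ F in h *; have e0 : 0 <= e by rewrite exprn_ge0.
apply: (@le_trans _ _ ((K * M * `|v - u|) ^+ 2)).
  by apply: lerXn2r; rewrite ?nnegrE ?mulr_ge0//; rewrite mulrA in h.
rewrite exprMn -mulrA; apply: ler_wpM2l; first by rewrite exprn_ge0// mulr_ge0.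
by rewrite expr2; apply: ler_wpM2r.
Qed.

(** At scale [I] the interval is cut into [2 ^ I] pieces, and the approximation at a grid point uses
    the Taylor polynomials at the left end of its piece. Level crossings come from [sign_changes] on
    each piece, plus the indices where the piece changes. Upward and downward steps are counted
    separately, whence [2 * C0]. *)
Lemma root_steps (M L : R) : 0 <= M -> 0 <= L -> exists2 C0 : R, 0 <= C0 &
  forall a b (c : 'I_n -> R -> C), a < b -> b - a <= L ->
  (forall j, taylor_like a b (4 * F) M (c j)) -> forall j, (j < n)%N ->
  forall N, (0 < N)%N -> let tau := (b - a) / N%:R in
  let x i := sorted_Re (monic_poly (c ^~ (a + tau *+ i))) j in
  forall m, #|[set i : 'I_N | 2 ^+ (3 * N0.-1 * m) * tau < `|x i.+1 - x i|]%SET|%:R * tau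
    <= C0 / 2 ^+ ((3 * N0.-1).+1 * m).
Proof.
move=> M0 L0; have [H H0 HH] := sorted_Re_holder M0 L0.
pose M1 := 1 + M + M * L ^+ (4 * F).
have ML0 : 0 <= M * L ^+ (4 * F) by rewrite mulr_ge0// exprn_ge0.
have M11 : 1 <= M1 by rewrite /M1 -addrA lerDl addr_ge0.
have M10 : 0 <= M1 by rewrite (le_trans _ M11).
have [K K0 HK] := sorted_Re_close n M10.
have KM0 : 0 <= K * M by exact: mulr_ge0.
(* The added 1 makes the first factor at least 1, hence at most its [n!]-th power, when the [n!]-th
   root of the perturbation bound is taken. *)
pose E := (1 + K * M) * L ^+ 4.
have E0 : 0 <= E by rewrite mulr_ge0 ?exprn_ge0// addr_ge0.
have [D HD] := @sign_changes R n n_gt0 (4 * F).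
have N01 : (1 < N0)%N by exact: leq_pmulr (fact_gt0 n).
(* Piece indices run from 0 to [2 ^ I], the last one for the endpoint [b]. [2 * D] pays for these
   pieces with [D] crossings each, 4 for the changes of piece. *)
have [C0 C00 HC] := @steep_count R N0 (4 + 2 * D) E H N01 E0 H0.
exists (2 * C0); first by rewrite mulr_ge0.
move=> a b c ab abL hc j jn N N_gt0 tau x m.
have tau0 : 0 < tau by rewrite divr_gt0 ?subr_gt0// ltr0n.
have ba0 : 0 < b - a by rewrite subr_gt0.
have tin i : (i <= N)%N -> a <= a + tau *+ i <= b.
  move=> iN; rewrite lerDl mulrn_wge0 ?(ltW tau0)//= -lerBrDl -mulr_natr.
  by rewrite /tau mulrAC ler_pdivrMr ?ltr0n// ler_wpM2l ?ler_nat// ltW.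
have qin t : 0 <= t <= 1 -> a <= a + (b - a) * t <= b.
  move=> /andP[t0 t1]; rewrite lerDl mulr_ge0 ?(ltW ba0)//= -lerBrDl.
  by rewrite ler_piMr// ltW.
have /choice[T HT] : forall t0, exists T : 'I_n -> {poly C}, a <= t0 <= b ->
    forall i, (size (T i) <= 4 * F)%N /\ forall t, a <= t <= b ->
      nc (c i t - (T i).[t%:C%C]) <= M * `|t - t0| ^+ (4 * F).
  move=> t0; have [t0ab|_] := boolP (a <= t0 <= b); last by exists (fun=> 0).
  have /choice[T HT] : forall i, exists T : {poly C}, (size T <= 4 * F)%N /\
      forall t, a <= t <= b -> nc (c i t - T.[t%:C%C]) <= M * `|t - t0| ^+ (4 * F).
    by move=> i; have [_ _ /(_ _ t0ab)[T ? ?]] := hc i; exists T.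
  by exists T.
pose ctr I q : R := a + (b - a) * (q%:R / 2 ^+ I).
pose q I i := Num.truncn (i%:R / N%:R * 2 ^+ I : R).
have q2 I : 0 < (2 : R) ^+ I by rewrite exprn_gt0.
have arg0 I i : 0 <= i%:R / N%:R * 2 ^+ I :> R by rewrite mulr_ge0 ?divr_ge0// ltW.
have qle I i : (i <= N)%N -> (q I i <= 2 ^ I)%N.
  move=> iN; rewrite -(ler_nat R) natrX.
  have /andP[h _] := truncn_itv (arg0 I i); apply: (le_trans h).
  by rewrite ler_piMl ?(ltW (q2 I))// ler_pdivrMr ?ltr0n// mul1r ler_nat.
have qmono I : {homo q I : i i' / (i <= i')%N}.
  move=> i i' ii'; apply: le_truncn.
  by rewrite ler_wpM2r ?(ltW (q2 I))// ler_wpM2r ?invr_ge0// ler_nat.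
have ctrin I v : (v <= 2 ^ I)%N -> a <= ctr I v <= b.
  move=> vI; apply: qin; rewrite divr_ge0 ?(ltW (q2 I))//= ler_pdivrMr//.
  by rewrite mul1r -natrX ler_nat.
have dist I i : (i <= N)%N -> `|a + tau *+ i - ctr I (q I i)| <= (b - a) / 2 ^+ I.
  move=> iN; have /andP[h1 h2] := truncn_itv (arg0 I i); rewrite -/(q I i) in h1 h2.
  have -> : a + tau *+ i - ctr I (q I i) = (b - a) / 2 ^+ I *
      (i%:R / N%:R * 2 ^+ I - (q I i)%:R).
    rewrite /ctr /tau -mulr_natr; field.
    by rewrite (lt0r_neq0 (q2 I)) pnatr_eq0 -lt0n N_gt0.
  rewrite normrM ger0_norm ?divr_ge0 ?(ltW ba0) ?(ltW (q2 I))//.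
  rewrite ler_piMr ?divr_ge0 ?(ltW ba0) ?(ltW (q2 I))//.
  by rewrite ler_norml -addn1 natrD in h2 *; apply/andP; split; lra.
pose z I i := sorted_Re (poly_at (T (ctr I (q I i))) (a + tau *+ i)) j.
have xz I i : (i <= N)%N -> `|x i - z I i| <= E / 16 ^+ I.
  move=> iN; have tab := tin _ iN; have cab := ctrin _ _ (qle I _ iN).
  have hT := HT _ cab; set t := a + tau *+ i in tab *.
  have cM i' : nc (c i' t) <= M by have [h _ _] := hc i'; exact: h.
  pose d := M * ((b - a) / 2 ^+ I) ^+ (4 * F).
  have bI0 : 0 <= (b - a) / 2 ^+ I by rewrite divr_ge0 ?(ltW ba0) ?(ltW (q2 I)).
  have bIL : (b - a) / 2 ^+ I <= L / 2 ^+ I by rewrite ler_wpM2r// invr_ge0 ltW.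
  have bIL1 : (b - a) / 2 ^+ I <= L.
    rewrite (le_trans bIL)// ler_pdivrMr// ler_peMr// exprn_ege1// ler1n//.
  have d0 : 0 <= d by rewrite mulr_ge0// exprn_ge0.
  have dML : d <= M * L ^+ (4 * F) by rewrite ler_wpM2l// lerXn2r.
  have cd i' : nc (c i' t - (T (ctr I (q I i)) i').[t%:C%C]) <= d.
    have [_ h] := hT i'; apply: (le_trans (h _ tab)).
    by apply: ler_wpM2l => //; apply: lerXn2r; rewrite ?nnegrE//; exact: dist.
  have := HK (monic_poly (c ^~ t)) (poly_at (T (ctr I (q I i))) t) d j
    (monic_monic_poly _) (monic_monic_poly _) (size_monic_poly _) (size_monic_poly _).
  have h1 : coef_bounded M1 (monic_poly (c ^~ t)).
    by apply: coef_bounded_monic_poly => // i'; rewrite (le_trans (cM i'))// /M1; lra.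
  have h2 : coef_bounded M1 (poly_at (T (ctr I (q I i))) t).
    apply: coef_bounded_monic_poly => // i'.
    rewrite -[X in nc X](subKr (c i' t)) (le_trans (ncB _ _))//.
    by have := cM i'; have := cd i'; rewrite /M1; lra.
  have h3 : d <= M1 by rewrite (le_trans dML)// /M1; lra.
  move=> /(_ h1 h2 d0 h3 (coef_close_monic_poly d0 cd) jn) h.
  have F0 : (0 < F)%N by exact: fact_gt0.
  rewrite -(@ler_pXn2r _ F)// ?nnegrE ?divr_ge0 ?exprn_ge0//.
  apply: (le_trans h); rewrite /d mulrA.
  have e16 : E / 16 ^+ I = (1 + K * M) * (L / 2 ^+ I) ^+ 4.
    have -> : (16 : R) ^+ I = (2 ^+ I) ^+ 4.
      by rewrite -exprM mulnC exprM; congr (_ ^+ _); rewrite -natrX.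
    by rewrite /E; field; rewrite gt_eqF.
  rewrite e16 [leRHS]exprMn -[in leRHS]exprM; apply: ler_pM => //.
  - exact: exprn_ge0.
  - rewrite (@le_trans _ _ (1 + K * M))// ?lerDr//.
    by rewrite ler_eXnr// lerDl.
  - by apply: lerXn2r; rewrite ?nnegrE// divr_ge0// ltW.
have piece I v : (v <= 2 ^ I)%N -> exists X : seq R, forall e, e \notin X ->
    exists2 Z : seq nat, (size Z <= D)%N & forall i, i \notin Z ->
    let H t := sorted_Re (poly_at (T (ctr I v)) (t + tau)) j -
               sorted_Re (poly_at (T (ctr I v)) t) j in
    (e < H (a + tau *+ i)) = (e < H (a + tau *+ i.+1)) /\
    (H (a + tau *+ i) < e) = (H (a + tau *+ i.+1) < e).
  move=> vI; have hT := HT _ (ctrin _ _ vI).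
  have sT i : (size (T (ctr I v) i) <= (4 * F).+1)%N by have [/leqW] := hT i.
  exact: (HD _ _ j a tau jn tau0 sT sT).
have cross I : exists X : seq R, forall e, e \notin X -> exists2 Z : seq nat,
     (size Z <= (4 + 2 * D) * 4 ^ I)%N & forall i, (i.+1 < N)%N -> i \notin Z ->
       (e < z I i.+1 - z I i) = (e < z I i.+2 - z I i.+1) /\
       (z I i.+1 - z I i < e) = (z I i.+2 - z I i.+1 < e).
  have /choice[X HX] : forall v, exists X : seq R, (v <= 2 ^ I)%N -> forall e, e \notin X ->
      exists2 Z : seq nat, (size Z <= D)%N & forall i, i \notin Z ->
      let H t := sorted_Re (poly_at (T (ctr I v)) (t + tau)) j -
               sorted_Re (poly_at (T (ctr I v)) t) j in
    (e < H (a + tau *+ i)) = (e < H (a + tau *+ i.+1)) /\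
    (H (a + tau *+ i) < e) = (H (a + tau *+ i.+1) < e).
    move=> v; have [vI|_] := leqP v (2 ^ I); last by exists [::].
    by have [X HX] := piece I v vI; exists X.
  pose vs := iota 0 (2 ^ I).+1.
  exists (flatten [seq X v | v <- vs]) => e eX.
  have /choice[Z HZ] : forall v, exists Z : seq nat, (size Z <= D)%N /\
      ((v <= 2 ^ I)%N -> forall i, i \notin Z ->
      let H t := sorted_Re (poly_at (T (ctr I v)) (t + tau)) j -
               sorted_Re (poly_at (T (ctr I v)) t) j in
    (e < H (a + tau *+ i)) = (e < H (a + tau *+ i.+1)) /\
    (H (a + tau *+ i) < e) = (H (a + tau *+ i.+1) < e)).
    move=> v; have [vI|_] := leqP v (2 ^ I); last by exists [::].
    have [|Z sZ HZ] := HX v vI e; last by exists Z.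
    apply: contra eX => eXv; apply/flattenP; exists (X v) => //.
    by apply: map_f; rewrite mem_iota.
  (* The last index before each change of piece. An increment and the next one involve [i], [i.+1]
     and [i.+2], so the predecessors of these indices are listed as well. *)
  pose Z1 := [seq find (fun i => v <= q I i.+1)%N (iota 0 N) | v <- vs].
  pose Z3 := flatten [seq Z v | v <- vs].
  exists (Z1 ++ map predn Z1 ++ Z3).
    rewrite size_cat (size_cat (map _ _)) size_map /Z1 size_map size_iota.
    have s3 : (size Z3 <= (2 ^ I).+1 * D)%N.
      have HS vs' : (size (flatten [seq Z v | v <- vs']) <= size vs' * D)%N.
        by elim: vs' => //= v vs' IH; rewrite size_cat mulSn leq_add//; have [] := HZ v.
      by apply: (leq_trans (HS vs)); rewrite size_iota.
    have p1 : (0 < 2 ^ I)%N by rewrite expn_gt0.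
    have p2 : (2 ^ I <= 4 ^ I)%N by elim: (I) => // k ih; rewrite !expnS leq_mul.
    have p3 : ((2 ^ I).+1 * D <= 2 * 4 ^ I * D)%N.
      rewrite leq_mul2r; apply/orP; right.
      by clear -p1 p2; move: (2 ^ I)%N (4 ^ I)%N p1 p2 => u v; lia.
    rewrite mulnDl mulnAC.
    have : (size Z3 <= 2 * 4 ^ I * D)%N by exact: leq_trans p3.
    clear -p1 p2; move: (2 * 4 ^ I * D)%N (2 ^ I)%N (4 ^ I)%N (size Z3) p1 p2.
    by move=> W u v w; lia.
  have qconst i : (i < N)%N -> i \notin Z1 -> q I i = q I i.+1.
    move=> iN; apply: contraNeq => qne.
    have qlt : (q I i < q I i.+1)%N by rewrite ltn_neqAle qne qmono.
    apply/mapP; exists (q I i.+1).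
      by rewrite mem_iota/= ltnS qle.
    set P := (fun i' : nat => _); apply/eqP; rewrite eqn_leq.
    have hasP : has P (iota 0 N) by apply/hasP; exists i; rewrite ?mem_iota /P.
    have fN : (find P (iota 0 N) < N)%N by rewrite -[ltnRHS](size_iota 0) -has_find.
    apply/andP; split; rewrite leqNgt; apply/negP => lti.
      have := nth_find 0%N hasP; rewrite nth_iota// add0n /P.
      by rewrite leqNgt (leq_ltn_trans _ qlt)// qmono.
    by have := before_find 0%N lti; rewrite nth_iota// add0n /P leqnn.
  move=> i iN; rewrite mem_cat => /norP[iZ1]; rewrite mem_cat => /norP[iZ2 iZ3].
  have q1 : q I i = q I i.+1 by exact: qconst (ltnW iN) iZ1.
  have q2' : q I i.+1 = q I i.+2.
    apply: qconst => //; apply: contra iZ2 => h; apply/mapP.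
    by exists i.+1.
  have vI : (q I i <= 2 ^ I)%N by rewrite qle// ltnW// ltnW.
  have [_ /(_ vI i)] := HZ (q I i).
  have iZ : i \notin Z (q I i).
    apply: contra iZ3 => h; apply/flattenP; exists (Z (q I i)) => //.
    by apply: map_f; rewrite mem_iota/= ltnS.
  move=> /(_ iZ) /=; rewrite /z -q2' -q1.
  have tS i' : a + tau *+ i' + tau = a + tau *+ i'.+1 by rewrite mulrSr addrA.
  by rewrite !tS.
have hold i i' : (i <= i')%N -> (i' <= N)%N -> `|x i' - x i| ^+ N0 <= H * ((i' - i)%:R * tau).
  move=> ii' iN; have := HH a b _ c abL hc j jn _ _ (tin _ (leq_trans ii' iN)) (tin _ iN).
  congr (_ <= H * _).
  rewrite opprD addrACA subrr add0r -mulrnBr// normrMn (gtr0_norm tau0).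
  by rewrite mulr_natl.
have up := HC x z tau N tau0 xz _ hold m.
have dn := HC (fun i => - x i) (fun I i => - z I i) tau N tau0 _ _ _ m.
have {}up : #|[set i : 'I_N | 2 ^+ (3 * N0.-1 * m) * tau < x i.+1 - x i]%SET|%:R * tau
    <= C0 / 2 ^+ ((3 * N0.-1).+1 * m).
  apply: up => I; have [X HX] := cross I; exists X => e /HX[Z sZ HZ].
  by exists Z => // i iN iZ; have [] := HZ i iN iZ.
have {}dn : #|[set i : 'I_N | 2 ^+ (3 * N0.-1 * m) * tau < - x i.+1 - - x i]%SET|%:R * tau
    <= C0 / 2 ^+ ((3 * N0.-1).+1 * m).
  apply: dn.
  - by move=> I i iN; rewrite -opprD normrN; exact: xz.
  - move=> I; have [X HX] := cross I; exists (map -%R X) => e eX.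
    have [|Z sZ HZ] := HX (- e).
      by apply: contra eX => h; apply/mapP; exists (- e) => //; rewrite opprK.
    exists Z => // i iN iZ; have [_ h] := HZ i iN iZ.
    by rewrite -!opprD ltrNr h [RHS]ltrNr.
  - by move=> i i' ii' iN; rewrite -opprD normrN; exact: hold.
rewrite -mulrA [2]mulr2n mulrDl mul1r.
apply: le_trans (lerD up dn); rewrite -mulrDl ler_wpM2r ?(ltW tau0)//.
rewrite -natrD ler_nat (leq_trans _ (leq_card_setU _ _).1)//.
apply: subset_leq_card; apply/fintype.subsetP => i; rewrite !inE.
by rewrite -opprD ltr_normr.
Qed.

End RootSteps.

(** * From sorted real parts to continuous roots *)

Section RootIncrements.
Variable R : realType.
Local Notation C := R[i].

Definition eps_delta (s t : R) (f : R -> R) : Prop :=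
  forall u, s <= u <= t -> forall e : R, 0 < e -> exists2 d : R, 0 < d &
  forall v, s <= v <= t -> `|u - v| < d -> `|f u - f v| < e.

Lemma eps_delta_sub s t s' t' f : s <= s' -> t' <= t ->
  eps_delta s t f -> eps_delta s' t' f.
Proof.
move=> ss' tt' H.
have sub v : s' <= v <= t' -> s <= v <= t.
  by move=> /andP[h1 h2]; rewrite (le_trans ss')// (le_trans h2).
move=> u /sub us e e0; have [d d0 Hd] := H u us e e0.
by exists d => // v /sub; exact: Hd.
Qed.

(* Split at the last time at which [f] meets the function it starts on: after it,
   [f] selects among the remaining functions only. *)
Lemma selection_increment (x : nat -> R -> R) (V : R -> R) (eta : R) (S : seq nat)
    (f : R -> R) (s t : R) : s <= t -> 0 <= eta -> eps_delta s t f ->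
  (forall j, j \in S -> eps_delta s t (x j)) ->
  (forall j u v, j \in S -> s <= u -> u <= v -> v <= t ->
     `|x j v - x j u| <= V v - V u + eta) ->
  (forall u v, s <= u -> u <= v -> v <= t -> V u <= V v) ->
  (forall u, s <= u <= t -> exists2 j, j \in S & f u = x j u) ->
  `|f t - f s| <= V t - V s + (size S)%:R * eta.
Proof.
move=> st eta0; have [N] := ubnP (size S); elim: N => // N IH in S s st * => SN.
move=> cf cx xV Vmono fS.
have [j jS fsj] : exists2 j, j \in S & f s = x j s by apply: fS; rewrite lexx.
pose E := [set u | s <= u <= t /\ f u = x j u]%classic.
have Es : E s by split => //; rewrite lexx.
have Eub : ubound E t by move=> u [/andP[]].
have Esup : has_sup E by split; [exists s|exists t].
pose u := sup E.
have su : s <= u by apply: ub_le_sup => //; exists t.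
have ut : u <= t by apply: ge_sup => //; exists s.
have uin : s <= u <= t by rewrite su ut.
have fu : f u = x j u.
  apply/eqP; rewrite -subr_eq0 -normr_le0 leNgt; apply/negP => e0.
  have e20 : 0 < `|f u - x j u| / 2 by rewrite divr_gt0.
  have [d d0 Hd] := cf u uin _ e20; have [d' d'0 Hd'] := cx j jS u uin _ e20.
  have dd : 0 < Num.min d d' by rewrite lt_min d0.
  have [v [vin fv] uv] := sup_adherent dd Esup.
  have vu : v <= u by apply: ub_le_sup; [exists t|].
  have uvd : `|u - v| < Num.min d d' by rewrite ger0_norm ?subr_ge0// ltrBlDr -ltrBlDl; exact: uv.
  have := Hd v vin; have := Hd' v vin; move: uvd; rewrite lt_min => /andP[-> ->].
  move=> /(_ isT) h1 /(_ isT) h2; rewrite fv in h2.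
  have : `|f u - x j u| <= `|f u - x j v| + `|x j u - x j v|.
    have -> : f u - x j u = (f u - x j v) - (x j u - x j v) by ring.
    exact: ler_normB.
  by lra.
have h1 : `|f u - f s| <= V u - V s + eta by rewrite fu fsj; apply: xV.
have sS : (0 < size S)%N by case: (S) jS.
suff h2 : `|f t - f u| <= V t - V u + (size S).-1%:R * eta.
  have -> : f t - f s = (f t - f u) + (f u - f s) by ring.
  rewrite (le_trans (ler_normD _ _))//.
  have -> : (size S)%:R = (size S).-1%:R + 1 :> R by rewrite -[in LHS](prednK sS) -addn1 natrD.
  by lra.
have [->|tu] := eqVneq t u; first by rewrite !subrr normr0 add0r mulr_ge0.
have {tu} ut' : u < t by rewrite lt_neqAle eq_sym tu.
pose S' := [seq i <- S | i != j].
have sS' : (size S' <= (size S).-1)%N.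
  rewrite -ltnS prednK// size_filter -(count_predC (fun i => i != j)) -addn1 leq_add2l.
  by rewrite -has_count; apply/hasP; exists j => //=; rewrite eqxx.
have after u' : u < u' -> u' <= t -> `|f t - f u'| <= V t - V u' + (size S')%:R * eta.
  move=> uu' u't.
  have su' : s <= u' by rewrite (le_trans su)// ltW.
  apply: IH => //.
  - by rewrite (leq_ltn_trans sS')// -ltnS prednK.
  - exact: eps_delta_sub cf.
  - by move=> i; rewrite mem_filter => /andP[_ iS]; apply: eps_delta_sub (cx i iS).
  - move=> i v w; rewrite mem_filter => /andP[_ iS] u'v vw wt.
    by apply: xV => //; exact: le_trans u'v.
  - by move=> v w u'v vw wt; apply: Vmono => //; exact: le_trans u'v.
  - move=> v /andP[u'v vt]; have [|i iS fv] := fS v; first by rewrite vt (le_trans su').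
    exists i => //; rewrite mem_filter iS andbT; apply/eqP => ij.
    have : v <= u.
      apply: ub_le_sup; first by exists t.
      by split; [rewrite vt (le_trans su')|rewrite fv ij].
    by rewrite leNgt (lt_le_trans uu').
(* [after] needs a start strictly beyond [u]; it is applied just to the right of [u], and continuity
   of [f] absorbs the difference. *)
apply/ler_addgt0Pr => e e0.
have [d d0 Hd] := cf u uin e e0.
pose u' := Num.min t (u + d / 2).
have uu' : u < u' by rewrite lt_min ut' ltrDl divr_gt0.
have u't : u' <= t by rewrite ge_min lexx.
have u'd : u' <= u + d / 2 by rewrite ge_min lexx orbT.
have hd : `|f u - f u'| < e.
  apply: Hd; first by rewrite u't (le_trans su)// ltW.
  by rewrite ler0_norm ?subr_le0 ?(ltW uu')// opprB; lra.
have Vuu' : V u <= V u' by apply: Vmono => //; exact: ltW.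
have h4 := after u' uu' u't.
have h5 : (size S')%:R * eta <= (size S).-1%:R * eta by rewrite ler_wpM2r// ler_nat.
have -> : f t - f u = (f t - f u') - (f u - f u') by ring.
rewrite (le_trans (ler_normB _ _))//; lra.
Qed.

Definition excess (a x : R) : R := Num.max 0 (x - a).

Lemma excess_ge0 a x : 0 <= excess a x. Proof. by rewrite le_max lexx. Qed.

Lemma le_excess a x : x <= a + excess a x.
Proof. by rewrite addrC -lerBlDr le_max lexx orbT. Qed.

(** Only the last level exceeded by [y] matters, since the next level bounds [y]. *)
Lemma excess_le (tau y : R) b m l : 0 < tau -> 0 <= y ->
  y <= 2 ^+ (b * (m + l)) * tau ->
  excess (2 ^+ (b * m) * tau) y <=
  \sum_(m <= i < m + l) 2 ^+ (b * i.+1) * tau * (2 ^+ (b * i) * tau < y)%R%:R.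
Proof.
move=> tau0 y0; elim: l => [|l IH] yB.
  by rewrite addn0 in yB *; rewrite big_geq// /excess ge_max lexx subr_le0.
rewrite addnS big_nat_recr ?leq_addr//=.
have [h|h] := leP y (2 ^+ (b * (m + l)) * tau).
  by rewrite mulr0 addr0 IH.
rewrite mulr1 -[leLHS]add0r; apply: lerD.
  apply: sumr_ge0 => i _; apply: mulr_ge0 => //; apply: mulr_ge0; last exact: ltW.
  exact: exprn_ge0.
rewrite -addnS (le_trans _ yB)// /excess ge_max y0 gerBl.
by apply: mulr_ge0; [exact: exprn_ge0|exact: ltW].
Qed.

Lemma geometric_half m l : \sum_(m <= i < m + l) (1 / 2 ^+ i : R) <= 2 / 2 ^+ m.
Proof.
suff -> : \sum_(m <= i < m + l) (1 / 2 ^+ i : R) = 2 / 2 ^+ m - 2 / 2 ^+ (m + l).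
  by rewrite gerBl divr_ge0// exprn_ge0.
elim: l => [|l IH]; first by rewrite addn0 big_geq// subrr.
rewrite addnS big_nat_recr ?leq_addr//= IH exprS; field.
by rewrite !expf_neq0.
Qed.

(** Level [i] contributes [2 ^ (b (i + 1)) C0 / 2 ^ ((b + 1) i) = 2 ^ b C0 / 2 ^ i]: the extra 1 in
    [b.+1] is what makes the tail summable. *)
Lemma excess_sum (C0 tau : R) b m N (y : nat -> R) : 0 < tau -> 0 <= C0 ->
  (forall l, 0 <= y l) ->
  (forall i, #|[set l : 'I_N | 2 ^+ (b * i) * tau < y l]%SET|%:R * tau <= C0 / 2 ^+ (b.+1 * i)) ->
  (0 < b)%N ->
  \sum_(l < N) excess (2 ^+ (b * m) * tau) (y l) <= 2 ^+ b * C0 * (2 / 2 ^+ m).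
Proof.
move=> tau0 C00 y0 H b0.
pose Y := \sum_(l < N) y l.
have yY (l : 'I_N) : y l <= Y by rewrite /Y (bigD1 l)//= lerDl sumr_ge0.
have [L HL] : exists L : nat, Y <= 2 ^+ (b * (m + L)) * tau.
  exists (Num.truncn (Y / tau)).+1; rewrite -ler_pdivrMr//.
  apply: (@le_trans _ _ (Num.truncn (Y / tau)).+1%:R); first exact/ltW/truncnS_gt.
  rewrite -natrX ler_nat; set k := _.+1.
  apply: (@leq_trans (2 ^ k)); first exact/ltnW/ltn_expl.
  rewrite leq_exp2l// (@leq_trans (m + k))// ?leq_addl// leq_pmull//.
apply: (@le_trans _ _ (\sum_(l < N) \sum_(m <= i < m + L)
    2 ^+ (b * i.+1) * tau * (2 ^+ (b * i) * tau < y l)%R%:R)).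
  by apply: ler_sum => l _; apply: excess_le => //; exact: le_trans (yY l) HL.
rewrite exchange_big/=.
apply: (@le_trans _ _ (\sum_(m <= i < m + L) 2 ^+ b * C0 * (1 / 2 ^+ i))); last first.
  rewrite -big_distrr/=; apply: ler_wpM2l; last exact: geometric_half.
  by apply: mulr_ge0 => //; exact: exprn_ge0.
apply: ler_sum => i _; rewrite -big_distrr/=.
have -> : \sum_(l < N) (2 ^+ (b * i) * tau < y l)%R%:R =
    #|[set l : 'I_N | 2 ^+ (b * i) * tau < y l]%SET|%:R :> R.
  rewrite -sum1dep_card natr_sum [RHS]big_mkcond/=.
  by apply: eq_bigr => l _; case: ifP.
rewrite -mulrA [tau * _]mulrC.
have -> : 2 ^+ b * C0 * (1 / 2 ^+ i) = 2 ^+ (b * i.+1) * (C0 / 2 ^+ (b.+1 * i)).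
  rewrite mulnS exprD mulSn [(2 : R) ^+ (i + _)]exprD; field.
  by rewrite !expf_neq0.
by apply: ler_wpM2l => //; exact: exprn_ge0.
Qed.

Variable n : nat.
Hypothesis n_gt0 : (0 < n)%N.
Local Notation N0 := (2 * n`!)%N.
Local Notation b0 := (3 * N0.-1)%N.

(** A continuous root may switch between the sorted real parts any number of times within a grid
    interval. On a fine subgrid its increment is still bounded, up to a small error, by the total
    variation of all sorted real parts. With [s = 2 ^ (b0 m)], this variation exceeds [n s tau] only
    through fine steps steeper than [s], whose total excess is [O(2 ^ (- m))] by [excess_sum].
    Continuity and the root property are asked only on the intervals of [A]: elsewhere the curve may
    leave the domain of the root. *)
Lemma root_increments_count (M L : R) : 0 <= M -> 0 <= L -> exists2 C0 : R, 0 < C0 &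
  forall a b (c : 'I_n -> R -> C), a < b -> b - a <= L ->
  (forall j, taylor_like a b (4 * n`!) M (c j)) -> 
  forall N, (0 < N)%N -> let tau := (b - a) / N%:R in
  forall (h : nat -> R -> C) (A : {set 'I_N}) m,
  (forall i, i \in A ->
     let s := a + tau *+ i in let t := a + tau *+ i.+1 in
     [/\ eps_delta s t (@complex.Re R \o h i),
         forall u, s <= u <= t -> root (monic_poly (c ^~ u)) (h i u) &
         C0 * 2 ^+ (b0 * m) * tau < `|complex.Re (h i t) - complex.Re (h i s)|]) ->
  #|A|%:R * tau <= 1 / 2 ^+ (b0.+1 * m).
Proof.
move=> M0 L0; have [C1 C10 HC1] := root_steps n_gt0 M0 L0.
have [H H0 HH] := sorted_Re_holder n M0 L0.
have N01 : (1 < N0)%N by exact: leq_pmulr (fact_gt0 n).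
have b00 : (0 < b0)%N by rewrite muln_gt0/=; move: N01; case: (N0) => // -[].
pose C2 := 2 ^+ b0 * C1 * 2.
have C20 : 0 <= C2 by apply: mulr_ge0 => //; apply: mulr_ge0 => //; exact: exprn_ge0.
pose C0 := n%:R * 2 + n%:R * C2 + 1.
exists C0.
  by apply: ltr_pwDr => //; apply: addr_ge0; apply: mulr_ge0.
move=> a b c ab abL hc N N_gt0 tau h A m hA.
have ba0 : 0 < b - a by rewrite subr_gt0.
have tau0 : 0 < tau by rewrite divr_gt0// ltr0n.
pose x j u := sorted_Re (monic_poly (c ^~ u)) j.
(* Chosen so that the selection errors, [n%:R * (eta *+ 2)] on each of at most [N] intervals, add up
   to at most [1 / 2 ^+ m]. *)
pose eta : R := 1 / (2 ^+ m * N%:R * n%:R * 2).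
have p0 : 0 < (2 : R) ^+ m by exact: exprn_gt0.
have NR0 : 0 < N%:R :> R by rewrite ltr0n.
have nR0 : 0 < n%:R :> R by rewrite ltr0n.
have eta0 : 0 < eta by apply: divr_gt0 => //; rewrite !mulr_gt0.
(* The refinement factor: along one fine step no sorted real part moves by more than [eta]. *)
have [M' M'0 HM'] : exists2 M' : nat, (0 < M')%N & H * (tau / M'%:R) <= eta ^+ N0.
  have e0 : 0 < eta ^+ N0 by exact: exprn_gt0.
  exists (Num.truncn (H * tau / eta ^+ N0)).+1 => //.
  rewrite mulrA ler_pdivrMr ?ltr0n// -ler_pdivrMl// mulrC.
  exact/ltW/truncnS_gt.
pose tau' := tau / M'%:R.
have M'R0 : 0 < M'%:R :> R by rewrite ltr0n.
have tau'0 : 0 < tau' by exact: divr_gt0.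
pose N' := (N * M')%N.
have N'0 : (0 < N')%N by rewrite muln_gt0 N_gt0.
have tauE : (b - a) / N'%:R = tau'.
  by rewrite /tau' /tau /N' natrM; field; rewrite !gt_eqF.
have xeta j u v : (j < n)%N -> a <= u <= b -> a <= v <= b -> `|v - u| <= tau' ->
    `|x j v - x j u| <= eta.
  move=> jn uab vab uv; rewrite -(@ler_pXn2r _ N0) ?nnegrE ?(ltW eta0)//; last exact: ltnW.
  apply: le_trans (HH a b _ c abL hc j jn u v uab vab) _.
  by apply: le_trans HM'; apply: ler_wpM2l.
pose y j l := `|x j (a + tau' *+ l.+1) - x j (a + tau' *+ l)|.
(* Accumulated variation of all sorted real parts on the fine grid. Composed with rounding down to
   the grid it gives the monotone [V], at the price of [eta] at each end. *)
pose G p := \sum_(l < p) \sum_(j < n) y j l.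
have y0 j l : 0 <= y j l by exact: normr_ge0.
have Gmono p p' : (p <= p')%N -> G p <= G p'.
  move=> pp'; rewrite /G -!(big_mkord xpredT (fun l => \sum_(j < n) y j l)).
  by rewrite (big_cat_nat (leq0n p) pp')//= lerDl sumr_ge0// => l _; apply: sumr_ge0.
have Gx j p p' : (j < n)%N -> (p <= p')%N ->
    `|x j (a + tau' *+ p') - x j (a + tau' *+ p)| <= G p' - G p.
  move=> jn pp'; rewrite -(telescope_sumr (fun p => x j (a + tau' *+ p)) pp').
  rewrite -(telescope_sumr G pp') (le_trans (ler_norm_sum _ _ _))//.
  apply: ler_sum => l _; rewrite /G big_ord_recr/= addrAC subrr add0r.
  by rewrite (bigD1 (Ordinal jn))//= lerDl sumr_ge0.
pose fl u := Num.truncn ((u - a) / tau').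
pose V u := G (fl u).
have fl_grid p : fl (a + tau' *+ p) = p.
  by rewrite /fl addrAC subrr add0r -mulr_natl mulfK ?gt_eqF// natrK.
have fl_mono u v : u <= v -> (fl u <= fl v)%N.
  by move=> uv; apply: le_truncn; rewrite ler_wpM2r ?invr_ge0 ?(ltW tau'0)// lerD2r.
have bE : b = a + tau' *+ N'.
  rewrite -tauE -mulr_natr divfK; last by rewrite pnatr_eq0 -lt0n.
  by rewrite addrC subrK.
have fl_close u : a <= u <= b -> a <= a + tau' *+ fl u <= b /\ `|u - (a + tau' *+ fl u)| <= tau'.
  move=> /andP[au ub]; have u0 : 0 <= (u - a) / tau' by rewrite divr_ge0 ?subr_ge0// ltW.
  have /andP[h1 h2] := truncn_itv u0; rewrite -/(fl u) in h1 h2.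
  rewrite ler_pdivlMr// mulr_natl in h1; rewrite ltr_pdivrMr// mulr_natl mulrS in h2.
  have g0 : 0 <= tau' *+ fl u by rewrite mulrn_wge0// ltW.
  clear -h1 h2 g0 au ub.
  by split; [apply/andP; split; lra|rewrite ger0_norm; lra].
have xV j u v : (j < n)%N -> a <= u -> u <= v -> v <= b ->
    `|x j v - x j u| <= V v - V u + eta *+ 2.
  move=> jn au uv vb.
  have uab : a <= u <= b by rewrite au (le_trans uv).
  have vab : a <= v <= b by rewrite vb (le_trans au).
  have [u1 u2] := fl_close u uab; have [v1 v2] := fl_close v vab.
  have e1 := xeta j _ _ jn v1 vab v2.
  have e2 : `|x j u - x j (a + tau' *+ fl u)| <= eta by exact: xeta.
  have e3 := Gx j _ _ jn (fl_mono _ _ uv).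
  set v' := a + tau' *+ fl v in v1 v2 e1 e3 *; set u' := a + tau' *+ fl u in u1 u2 e2 e3 *.
  have -> : x j v - x j u = (x j v - x j v') + (x j v' - x j u') - (x j u - x j u') by ring.
  rewrite (le_trans (ler_normB _ _))// (le_trans (lerD (ler_normD _ _) (lexx _)))//.
  by rewrite mulr2n /V; lra.
have xcont j s t : (j < n)%N -> a <= s -> t <= b -> eps_delta s t (x j).
  move=> jn as_ tb u /andP[su ut] e e0.
  have e0' : 0 < e ^+ N0 by exact: exprn_gt0.
  have H1 : 0 < H + 1 by rewrite ltr_wpDl.
  exists (e ^+ N0 / (H + 1)); first exact: divr_gt0.
  move=> v /andP[sv vt] uv; rewrite distrC.
  have N00 : (0 < N0)%N by exact: ltnW.
  rewrite -(@ltr_pXn2r _ N0) ?nnegrE ?(ltW e0)//.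
  have uab : a <= u <= b by rewrite (le_trans as_ su) (le_trans ut).
  have vab : a <= v <= b by rewrite (le_trans as_ sv) (le_trans vt).
  apply: le_lt_trans (HH a b _ c abL hc j jn u v uab vab) _.
  rewrite distrC in uv; rewrite ltr_pdivlMr// mulrC in uv; apply: le_lt_trans uv.
  by apply: ler_wpM2r => //; rewrite lerDl.
have gridE i : a + tau *+ i = a + tau' *+ (i * M').
  by congr +%R; rewrite mulnC mulrnA -[tau' *+ M']mulr_natr /tau' divfK ?gt_eqF.
have hinc i : i \in A -> C0 * 2 ^+ (b0 * m) * tau <=
    G (i.+1 * M')%N - G (i * M')%N + n%:R * (eta *+ 2).
  move=> iA; have [hcont hroot hbig] := hA i iA.
  apply: le_trans (ltW hbig) _.
  have st : a + tau *+ i <= a + tau *+ i.+1 by rewrite lerD2l mulrS lerDr ltW.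
  have as_ : a <= a + tau *+ i by rewrite lerDl mulrn_wge0// ltW.
  have tb : a + tau *+ i.+1 <= b.
    rewrite gridE bE lerD2l -(mulr_natr tau') -(mulr_natr tau' N') ler_wpM2l ?(ltW tau'0)// ler_nat leq_mul2r.
    by rewrite ltn_ord orbT.
  have := @selection_increment x V (eta *+ 2) (iota 0 n) (@complex.Re R \o h i) _ _ st.
  rewrite size_iota /V !gridE !fl_grid -!gridE /=; apply => //.
  - by rewrite mulrn_wge0// ltW.
  - by move=> j; rewrite mem_iota => /andP[_ jn]; exact: xcont.
  - move=> j u v; rewrite mem_iota => /andP[_ jn] su uv vt.
    by apply: xV => //; [exact: le_trans su|exact: le_trans tb].
  - by move=> u v _ uv _; apply: Gmono; exact: fl_mono.
  - move=> u uin.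
    have [j jn xj] := root_sorted_Re (monic_monic_poly _) (size_monic_poly _) (hroot u uin).
    by exists j; rewrite ?mem_iota.
(* Granting every fine step the slope [2 ^+ (b0 * m)] costs [n%:R * (2 ^+ (b0 * m) * tau)] over one
   interval; the remainder is excess. *)
have block i : G (i.+1 * M')%N - G (i * M')%N <= n%:R * (2 ^+ (b0 * m) * tau) +
    (\sum_(l < i.+1 * M') \sum_(j < n) excess (2 ^+ (b0 * m) * tau') (y j l)
     - \sum_(l < i * M') \sum_(j < n) excess (2 ^+ (b0 * m) * tau') (y j l)).
  pose Ex p := \sum_(l < p) \sum_(j < n) excess (2 ^+ (b0 * m) * tau') (y j l).
  have iM : (i * M' <= i.+1 * M')%N by rewrite leq_mul2r leqnSn orbT.
  rewrite -(telescope_sumr G iM) -/(Ex _) -/(Ex (i * M')%N) -(telescope_sumr Ex iM).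
  have -> : n%:R * (2 ^+ (b0 * m) * tau) =
      \sum_(i * M' <= l < i.+1 * M') n%:R * (2 ^+ (b0 * m) * tau').
    rewrite sumr_const_nat mulSn addnK -[RHS]mulr_natr /tau'.
    by field; rewrite gt_eqF.
  rewrite -big_split/=; apply: ler_sum => l _.
  rewrite /G /Ex !big_ord_recr/= ![_ + _ - _]addrAC !subrr !add0r.
  rewrite mulr_natl -[X in _ *+ X]card_ord -sumr_const -big_split/=.
  by apply: ler_sum => j _; exact: le_excess.
pose Ex p := \sum_(l < p) \sum_(j < n) excess (2 ^+ (b0 * m) * tau') (y j l).
have Ex_mono p p' : (p <= p')%N -> Ex p <= Ex p'.
  move=> pp'; rewrite /Ex -!(big_mkord xpredT (fun l => \sum_(j < n) excess _ (y j l))).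
  rewrite (big_cat_nat (leq0n p) pp')//= lerDl sumr_ge0// => l _; apply: sumr_ge0 => j _.
  exact: excess_ge0.
have Ex_total : Ex N' <= n%:R * (C2 / 2 ^+ m).
  rewrite /Ex exchange_big/=.
  have -> : n%:R * (C2 / 2 ^+ m) = \sum_(j < n) C2 / 2 ^+ m.
    by rewrite sumr_const card_ord mulr_natl.
  apply: ler_sum => j _.
  have -> : C2 / 2 ^+ m = 2 ^+ b0 * C1 * (2 / 2 ^+ m) by rewrite /C2 !mulrA.
  apply: excess_sum => // i.
  have := HC1 a b c ab abL hc j (ltn_ord j) N' N'0 i.
  by rewrite tauE.
have Asum : #|A|%:R * (C0 * 2 ^+ (b0 * m) * tau) <=
    #|A|%:R * (n%:R * (2 ^+ (b0 * m) * tau)) + n%:R * (C2 / 2 ^+ m) +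
    #|A|%:R * (n%:R * (eta *+ 2)).
  apply: (@le_trans _ _ (\sum_(i in A) (n%:R * (2 ^+ (b0 * m) * tau) +
      (Ex (i.+1 * M')%N - Ex (i * M')%N) + n%:R * (eta *+ 2)))).
    rewrite mulr_natl -sumr_const; apply: ler_sum => i iA.
    by apply: (le_trans (hinc i iA)); rewrite lerD2r; exact: block.
  rewrite big_split/= big_split/= !sumr_const !mulr_natl lerD2r lerD2l -mulr_natl.
  apply: le_trans Ex_total.
  apply: (@le_trans _ _ (\sum_(i < N) (Ex (i.+1 * M')%N - Ex (i * M')%N))).
    rewrite big_mkcond/=; apply: ler_sum => i _; case: ifP => // _.
    by rewrite subr_ge0 Ex_mono// leq_mul2r leqnSn orbT.
  rewrite -(big_mkord xpredT (fun i => Ex (i.+1 * M')%N - Ex (i * M')%N)).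
  rewrite (telescope_sumr (fun i => Ex (i * M')%N))// mul0n /Ex big_ord0 subr0.
  exact: lexx.
have AN : #|A|%:R <= N%:R :> R by rewrite ler_nat -[X in (_ <= X)%N]card_ord max_card.
have etaE : N%:R * (n%:R * (eta *+ 2)) = 1 / 2 ^+ m.
  by rewrite /eta -mulr_natr; field; rewrite !gt_eqF.
have Aeta : #|A|%:R * (n%:R * (eta *+ 2)) <= 1 / 2 ^+ m.
  rewrite -etaE; apply: ler_wpM2r => //; apply: mulr_ge0 => //.
  by rewrite mulrn_wge0// ltW.
have Sm0 : 0 <= #|A|%:R * (2 ^+ (b0 * m) * tau).
  by apply: mulr_ge0 => //; apply: mulr_ge0; [exact: exprn_ge0|exact: ltW].
(* [C0 - n%:R] is at least [n%:R * C2 + 1], so the granted slope can be absorbed in the left side of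
   [Asum]. *)
have C01 : 0 < C0 - n%:R by rewrite /C0; have := mulr_ge0 (ltW nR0) C20; lra.
have key : #|A|%:R * (2 ^+ (b0 * m) * tau) <= 1 / 2 ^+ m.
  rewrite -(@ler_pM2l _ (C0 - n%:R))//.
  apply: (@le_trans _ _ ((n%:R * C2 + 1) * (1 / 2 ^+ m))).
    have -> : (C0 - n%:R) * (#|A|%:R * (2 ^+ (b0 * m) * tau)) =
      #|A|%:R * (C0 * 2 ^+ (b0 * m) * tau) - #|A|%:R * (n%:R * (2 ^+ (b0 * m) * tau)) by ring.
    have -> : (n%:R * C2 + 1) * (1 / 2 ^+ m) = n%:R * (C2 / 2 ^+ m) + 1 / 2 ^+ m by ring.
    by lra.
  apply: ler_wpM2r; first by rewrite divr_ge0// ltW.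
  by rewrite /C0; lra.
rewrite mulSn exprD ler_pdivlMr; last by rewrite mulr_gt0// exprn_gt0.
rewrite ler_pdivlMr// in key; apply: le_trans key.
by rewrite le_eqVlt; apply/orP; left; apply/eqP; ring.
Qed.

End RootIncrements.

(** * Weak-type bounds and weak limits *)

Section LayerCake.
Context d (T : measurableType d) (R : realType) (mu : {measure set T -> \bar R}).
Local Open Scope ereal_scope.

(** [phi \o f] is dominated by [P 0] plus the series of [P i.+1] times the indicator of [S i < f];
    the term of the last level exceeded is enough for this. *)
Lemma layer_cake (A : set T) (f : T -> R) (phi : R -> R) (S P w : nat -> R) (K : R) :
  measurable A -> measurable_fun A f -> measurable_fun A (phi \o f) ->
  (forall y, 0 <= phi y)%R -> (forall i, 0 <= P i)%R ->
  (forall x, A x -> 0 <= f x)%R -> (forall x, A x -> exists i, f x <= S i)%R ->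
  (forall y, 0 <= y -> y <= S 0%N -> phi y <= P 0%N)%R ->
  (forall i y, S i < y -> y <= S i.+1 -> phi y <= P i.+1)%R ->
  (forall i, mu (A `&` [set x | (S i < f x)%R]) <= (w i)%:E) ->
  (forall N, \sum_(i < N) P i.+1 * w i <= K)%R ->
  \int[mu]_(x in A) (phi (f x))%:E <= (P 0%N)%:E * mu A + K%:E.
Proof.
move=> mA mf mphi phi0 P0 f0 fS phiS0 phiS muw sumK.
pose E i := A `&` [set x | (S i < f x)%R].
have mE i : measurable (E i).
  have -> : E i = A `&` f @^-1` `]S i, +oo[%classic.
    by apply/seteqP; split => x /= [Ax]; rewrite in_itv/= andbT.
  exact: mf.
pose F i x : \bar R := (P i.+1)%:E * (\1_(E i) x)%:E.
have F0 i x : 0 <= F i x by rewrite /F mule_ge0// lee_fin.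
have mF i : measurable_fun A (fun x => F i x).
  apply: measurable_funTS; apply: measurable_funeM; apply/measurable_EFinP.
  exact: measurable_indic.
have bound x : A x -> (phi (f x))%:E <= (P 0%N)%:E + \sum_(i <oo) F i x.
  move=> Ax; have [i fi] := fS x Ax.
  have [k [fk kmin]] : exists k, (f x <= S k)%R /\ forall l, (l < k)%N -> (S l < f x)%R.
    have ex : exists k, (f x <= S k)%R by exists i.
    case: (ex_minnP ex) => k fk kmin; exists k; split => // l lk.
    by rewrite ltNge; apply/negP => /kmin; rewrite leqNgt lk.
  case: k fk kmin => [|k] fk kmin.
    rewrite -[leLHS]adde0; apply: leeD; first by rewrite lee_fin phiS0// f0.
    exact: nneseries_ge0.
  rewrite -[leLHS]add0e; apply: leeD; first by rewrite lee_fin.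
  apply: (@le_trans _ _ (\sum_(0 <= i < k.+1) F i x)); last exact: nneseries_lim_ge.
  rewrite big_nat_recr//= -[leLHS]add0e; apply: leeD; first exact: sume_ge0.
  rewrite /F /= indicE mem_set ?mule1 ?lee_fin; last by split => //=; exact: kmin.
  by apply: phiS => //; exact: kmin.
apply: (@le_trans _ _ (\int[mu]_(x in A) ((P 0%N)%:E + \sum_(i <oo) F i x))).
  apply: ge0_le_integral => //.
  - by move=> x _; rewrite lee_fin.
  - exact/measurable_EFinP.
  - apply: emeasurable_funD; first exact: measurable_cst.
    by apply: ge0_emeasurable_sum => // *; exact: F0.
rewrite ge0_integralD//; last 3 first.
- by move=> x _; rewrite lee_fin.
- by move=> x _; exact: nneseries_ge0.
- by apply: ge0_emeasurable_sum => // *; exact: F0.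
rewrite integral_cst// leeD2l//.
rewrite integral_nneseries//.
apply: lime_le; first by apply: is_cvg_nneseries => n _ _; exact: integral_ge0.
apply: nearW => N; rewrite big_mkord.
apply: (@le_trans _ _ (\sum_(i < N) (P i.+1 * w i)%:E)); last by rewrite sumEFin lee_fin.
apply: lee_sum => i _; rewrite /F ge0_integralZl_EFin//; last first.
  by apply: measurable_funTS; apply/measurable_EFinP; exact: measurable_indic.
rewrite integral_indic// EFinM; apply: lee_wpmul2l; first by rewrite lee_fin.
by rewrite setIC setIA setIid; exact: muw.
Qed.

End LayerCake.

Section WeakType.
Variable R : realType.

(** A weak [L^p] estimate with [p = 1 + 1 / b], tested only at levels in geometric progression:
    [2 ^ (- (b + 1) m)] is the level [2 ^ (b m)] to the power [- (1 + 1 / b)]. *)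
Definition weak_type d (T : measurableType d) (mu : {measure set T -> \bar R})
  (V : set T) (b : nat) (C0 C1 : R) (f : T -> R) : Prop :=
  forall m, (mu (V `&` [set x | (C0 * 2 ^+ (b * m) < `|f x|)%R]) <=
             (C1 / 2 ^+ (b.+1 * m))%:E)%E.

(** The ratio of the contributions of consecutive levels to the integral of the [q]-th power. *)
Definition decay_rate (b : nat) (q : R) : R := (2 ^+ b) `^ q / 2 ^+ b.+1.

Lemma decay_rate_ge0 b q : 0 <= decay_rate b q.
Proof. by rewrite divr_ge0// ?powR_ge0// exprn_ge0. Qed.

Lemma decay_rate1 b : decay_rate b 1 = 1 / 2.
Proof.
rewrite /decay_rate powRr1 ?exprn_ge0// exprS; field.
by rewrite expf_neq0.
Qed.

Lemma decay_rate_lt1 b q : (0 < b)%N -> q < 1 + 1 / b%:R -> decay_rate b q < 1.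
Proof.
move=> b0 qb; have bR : 0 < b%:R :> R by rewrite ltr0n.
rewrite /decay_rate ltr_pdivrMr ?exprn_gt0// mul1r.
rewrite -!powR_mulrn// -powRrM /powR !ifF ?pnatr_eq0// ltr_expR.
rewrite ltr_pM2r; last by rewrite ln_gt0// ltr1n.
have : b%:R * q < b%:R * (1 + 1 / b%:R) by rewrite ltr_pM2l.
by rewrite mulrDr mulr1 mul1r divff ?gt_eqF// -natr1.
Qed.

Lemma powRX (x q : R) k : 0 <= x -> (x ^+ k) `^ q = (x `^ q) ^+ k.
Proof. by move=> x0; rewrite -powR_mulrn// powRAC powR_mulrn// powR_ge0. Qed.

Lemma geometric_le (r : R) N : 0 <= r -> r < 1 -> \sum_(i < N) r ^+ i <= (1 - r)^-1.
Proof.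
move=> r0 r1; have r1' : 0 < 1 - r by rewrite subr_gt0.
suff -> : \sum_(i < N) r ^+ i = (1 - r ^+ N) / (1 - r).
  by rewrite ler_piMl ?invr_ge0 ?(ltW r1')// gerBl exprn_ge0.
elim: N => [|N IH]; first by rewrite big_ord0 expr0 subrr mul0r.
rewrite big_ord_recr/= IH exprS; field.
by rewrite gt_eqF.
Qed.

(** Splitting at the level [m] serves twice. With [m = 0] it bounds the [q]-norm; with [m] large the
    second term is small, and then the first is small with [mu A], which is uniform integrability.
    [K] is chosen before the measure space and [V]. *)
Lemma weak_type_power (b : nat) (C0 C1 q : R) : (0 < b)%N -> 0 < C0 -> 0 <= C1 ->
  0 < q -> decay_rate b q < 1 -> exists2 K : R, 0 <= K &
  forall d (T : measurableType d) (mu : {measure set T -> \bar R}) (V A : set T) (f : T -> R),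
  measurable V -> measurable A -> A `<=` V -> measurable_fun V f ->
  weak_type mu V b C0 C1 f -> forall m,
  (\int[mu]_(x in A) (`|f x| `^ q)%:E <=
   ((C0 * 2 ^+ (b * m)) `^ q)%:E * mu A + (K * decay_rate b q ^+ m)%:E)%E.
Proof.
move=> b0 C00 C10 q0 r1; set r := decay_rate b q in r1 *.
have r0 : 0 <= r by exact: decay_rate_ge0.
pose K := (C0 * 2 ^+ b) `^ q * C1 / (1 - r).
have K0 : 0 <= K by rewrite divr_ge0 ?subr_ge0 ?(ltW r1)// mulr_ge0 ?powR_ge0.
exists K => // d T mu V A f mV mA AV mf wf m.
pose S i : R := C0 * 2 ^+ (b * (m + i)).
have S0 i : 0 <= S i by rewrite mulr_ge0 ?exprn_ge0 ?(ltW C00).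
have mfA : measurable_fun A f by exact: measurable_funS mf.
have mabs : measurable_fun A (fun x => `|f x|) by exact: measurableT_comp.
have := @layer_cake d T R mu A (fun x => `|f x|) (fun y => y `^ q) S
  (fun i => S i `^ q) (fun i => C1 / 2 ^+ (b.+1 * (m + i))) (K * r ^+ m) mA mabs.
rewrite /S addn0; apply.
- by apply: measurableT_comp => //; exact: measurable_powR.
- by move=> y; exact: powR_ge0.
- by move=> i; exact: powR_ge0.
- by move=> x _.
- move=> x _; pose k := (Num.truncn (`|f x| / C0)).+1.
  exists k; rewrite /S mulrC -ler_pdivrMr//.
  apply: (@le_trans _ _ k%:R); first exact/ltW/truncnS_gt.
  rewrite -natrX ler_nat (@leq_trans (2 ^ k))//; first exact/ltnW/ltn_expl.
  by rewrite leq_exp2l// (@leq_trans (m + k))// ?leq_addl// leq_pmull.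
- move=> y y0 yS.
  by apply: ge0_ler_powR; rewrite ?nnegrE ?(ltW q0)//; have := S0 0%N; rewrite /S addn0.
- move=> i y Sy yS; apply: ge0_ler_powR; rewrite ?nnegrE ?(ltW q0)//; last exact: S0.
  by rewrite (le_trans (S0 i))// ltW.
- move=> i; apply: le_trans (wf (m + i)%N); apply: le_measure; rewrite ?inE.
  + have -> : A `&` [set x | C0 * 2 ^+ (b * (m + i)) < `|f x|] =
      A `&` (fun x => `|f x|) @^-1` `]C0 * 2 ^+ (b * (m + i)), +oo[%classic.
      by apply/seteqP; split => x /= [Ax]; rewrite in_itv/= andbT.
    exact: mabs.
  + have -> : V `&` [set x | C0 * 2 ^+ (b * (m + i)) < `|f x|] =
      V `&` (fun x => `|f x|) @^-1` `]C0 * 2 ^+ (b * (m + i)), +oo[%classic.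
      by apply/seteqP; split => x /= [Ax]; rewrite in_itv/= andbT.
    have mabsV : measurable_fun V (fun x => `|f x|) by exact: measurableT_comp.
    exact: mabsV.
  + by apply: setSI.
- move=> N.
  have term i : (C0 * 2 ^+ (b * (m + i.+1))) `^ q * (C1 / 2 ^+ (b.+1 * (m + i))) =
      (C0 * 2 ^+ b) `^ q * C1 * r ^+ m * r ^+ i.
    have E1 : (2 ^+ (b * (m + i))) `^ q = ((2 ^+ b) `^ q) ^+ (m + i).
      by rewrite exprM powRX ?exprn_ge0.
    have E2 : r ^+ m * r ^+ i = ((2 ^+ b) `^ q) ^+ (m + i) / 2 ^+ (b.+1 * (m + i)).
      by rewrite -exprD /r /decay_rate expr_div_n -exprM.
    rewrite addnS mulnS exprD (mulrA C0) powRM ?mulr_ge0 ?exprn_ge0 ?(ltW C00)//.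
    by rewrite E1 -[RHS]mulrA E2 mulrACA.
  under eq_bigr do rewrite term.
  rewrite -big_distrr/= /K [leRHS]mulrAC.
  apply: ler_wpM2l; last exact: geometric_le.
  by rewrite !mulr_ge0 ?powR_ge0 ?exprn_ge0.
Qed.

End WeakType.

(** * Weak limits of uniformly integrable sequences *)

Section UltraLimit.
Variable R : realType.

Lemma ultra_bounded_cvg (U : set_system nat) (r : nat -> R) (K : R) :
  UltraFilter U -> (forall j, `|r j| <= K) -> exists l : R, r @ U --> l.
Proof.
move=> UU rK; have cK : compact `[-K, K]%classic by exact: segment_compact.
have FK : (r @ U) `[-K, K]%classic.
  by apply: nearW => j /=; rewrite in_itv/= -ler_norml.
have [p [_ clp]] := cK _ _ FK.
exists p => A Ap; have [//|h] := in_ultra_setVsetC (r @^-1` A) UU.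
by have [y [nAy Ay]] := clp (~` A) A h Ap.
Qed.

Lemma ler_ultra_lim (U : set_system nat) (r : nat -> R) (l K : R) :
  UltraFilter U -> r @ U --> l -> (forall j, `|r j| <= K) -> `|l| <= K.
Proof.
move=> UU rl rK; have h : `|r j| @[j --> U] --> `|l| by exact: cvg_norm rl.
by apply: (@closed_cvg _ _ U _ _ (fun x => x <= K) _ _ `|l| h);
  [exact: closed_le|exact: nearW].
Qed.

End UltraLimit.

Section BoundedMultiplier.
Context d (T : measurableType d) (R : realType) (mu : {measure set T -> \bar R}).

Lemma integrable_mul_bounded (V : set T) (f phi : T -> R) (B : R) : measurable V ->
  mu.-integrable V (EFin \o f) -> measurable_fun V phi ->
  (forall x, V x -> `|phi x| <= B) ->
  mu.-integrable V (EFin \o (fun x => f x * phi x)).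
Proof.
move=> mV fi mphi phiB.
have mf : measurable_fun V f by apply/measurable_EFinP; exact: measurable_int fi.
apply: (@le_integrable _ _ _ mu V mV _ (fun x => B%:E * (f x)%:E)%E).
- by apply/measurable_EFinP; exact: measurable_funM.
- move=> x Vx /=; rewrite lee_fin !normrM mulrC; apply: ler_wpM2r => //.
  by rewrite (le_trans (phiB x Vx))// ler_norm.
- by apply: integrableZl.
Qed.

Lemma Rintegral_mul_bound (V : set T) (f phi : T -> R) (B : R) : measurable V ->
  mu.-integrable V (EFin \o f) -> measurable_fun V phi -> 0 <= B ->
  (forall x, V x -> `|phi x| <= B) ->
  `|\int[mu]_(x in V) (f x * phi x)| <= B * \int[mu]_(x in V) `|f x|.
Proof.
move=> mV fi mphi B0 phiB.
have ffi := integrable_mul_bounded mV fi mphi phiB.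
apply: (le_trans (le_normr_Rintegral mV ffi)).
have nfi : mu.-integrable V (EFin \o (fun x => `|f x|)) by exact: integrable_norm.
rewrite -(RintegralZl B mV nfi); apply: le_Rintegral => //.
- exact: (integrable_norm ffi).
- by apply: (@integrableZl _ _ _ mu V mV B (fun x => `|f x|%:E)).
- by move=> x Vx; rewrite normrM mulrC; apply: ler_wpM2r => //; exact: phiB.
Qed.

End BoundedMultiplier.

(** The staircase by which a bounded measurable function is approximated uniformly through
    indicators of its superlevel sets. *)
Lemma count_levels (R : realType) (N : nat) (y : R) : 0 <= y -> y <= N%:R ->
  y - 1 <= \sum_(k < N) ((k.+1%:R < y)%R)%:R <= y.
Proof.
elim: N y => [|N IH] y y0 yN.
  by rewrite big_ord0; apply/andP; split; lra.
rewrite big_ord_recr/=; have [yN'|yN'] := leP y N%:R.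
  have -> : (N.+1%:R < y) = false by apply/negbTE; rewrite -leNgt (le_trans yN')// ler_nat.
  by rewrite addr0; exact: IH.
have -> : (N.+1%:R < y) = false by apply/negbTE; rewrite -leNgt.
have -> : \sum_(k < N) ((k.+1%:R < y)%R)%:R = N%:R :> R.
  under eq_bigr => k _.
    rewrite (_ : (k.+1%:R < y) = true); last by rewrite (le_lt_trans _ yN')// ler_nat.
    over.
  by rewrite sumr_const card_ord.
by rewrite addr0 (ltW yN') andbT -natr1 in yN *; lra.
Qed.

Section WeakLimit.
Context d (T : measurableType d) (R : realType).
Variable mu : {sigma_finite_measure set T -> \bar R}.
Variables (V : set T) (mV : measurable V) (Vfin : (mu V < +oo)%E).
Variables (b : nat) (C0 K : R) (C00 : 0 < C0) (K0 : 0 <= K) (b0 : (0 < b)%N).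
Variable u : nat -> T -> R.
Hypothesis mu_ : forall j, measurable_fun V (u j).
(** Uniform integrability in quantitative form: a large [m] makes the second term small, then a
    small [mu A] the first one, for all [j] at once. *)
Hypothesis u_small : forall A, measurable A -> A `<=` V -> forall j m,
  (\int[mu]_(x in A) `|u j x|%:E <= (C0 * 2 ^+ (b * m))%:E * mu A + (K / 2 ^+ m)%:E)%E.
(** The ultrafilter replaces the extraction of a subsequence: it provides limits on all measurable
    sets at the same time. *)
Variables (U : set_system nat) (UU : UltraFilter U) (Uoo : \oo `<=` U).

Let fin_sub A : measurable A -> A `<=` V -> (mu A < +oo)%E.
Proof. by move=> mA AV; apply: le_lt_trans Vfin; apply: le_measure; rewrite ?inE. Qed.

Let u_int j : mu.-integrable V (EFin \o u j).
Proof.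
apply/integrableP; split; first exact/measurable_EFinP.
apply: (le_lt_trans (@u_small V mV (@subset_refl _ V) j 0%N)).
apply: lte_add_pinfty; last by rewrite ltry.
by rewrite lte_mul_pinfty// lee_fin mulr_ge0// ?exprn_ge0// ltW.
Qed.

Let r j A := \int[mu]_(x in A `&` V) u j x.

Let bnd m A : R := C0 * 2 ^+ (b * m) * fine (mu (A `&` V)) + K / 2 ^+ m.

Let r_bound j m A : measurable A -> `|r j A| <= bnd m A.
Proof.
move=> mA; have mAV : measurable (A `&` V) by exact: measurableI.
have uAV : mu.-integrable (A `&` V) (EFin \o u j) by apply: integrableS (u_int j).
apply: (le_trans (le_normr_Rintegral mAV uAV)).
rewrite -lee_fin /Rintegral fineK; last first.
  rewrite ge0_fin_numE; last exact: integral_ge0.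
  by case/integrableP : uAV => _; under eq_integral do rewrite /=.
apply: (le_trans (u_small mAV (@subIsetr _ _ _) j m)).
rewrite /bnd EFinD [in leRHS]EFinM fineK// ge0_fin_numE//.
exact: fin_sub (@subIsetr _ _ _).
Qed.

Let nur A : R := lim (r ^~ A @ U).

Let nur_cvg A : measurable A -> r ^~ A @ U --> nur A.
Proof.
move=> mA; have [l rl] := ultra_bounded_cvg UU (fun j => r_bound j 0%N mA).
by rewrite /nur (cvg_lim _ rl).
Qed.

Let nur_bound m A : measurable A -> `|nur A| <= bnd m A.
Proof.
by move=> mA; apply: ler_ultra_lim (nur_cvg mA) _ => j; exact: r_bound.
Qed.

Let nur0 : nur set0 = 0.
Proof.
have h := @nur_cvg _ measurable0.
apply: (cvg_unique (@Rhausdorff R) h); apply: (@cvg_near_cst _ _ _ _ U); apply: nearW => j.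
by rewrite /r set0I Rintegral_set0.
Qed.

Let nurU A B : measurable A -> measurable B -> A `&` B = set0 ->
  nur (A `|` B) = nur A + nur B.
Proof.
move=> mA mB AB; have h := @nur_cvg _ (measurableU _ _ mA mB).
apply: (cvg_unique (@Rhausdorff R) h).
apply: cvg_trans (cvgD (nur_cvg mA) (nur_cvg mB)).
apply: near_eq_cvg; apply: nearW => j /=; rewrite /r setIUl Rintegral_setU//; [exact: measurableI..| |].
  apply: integrableS (u_int j) => //; first by apply: measurableU; exact: measurableI.
  by rewrite -setIUl; exact: subIsetr.
by apply/disj_set2P; rewrite setIACA AB set0I.
Qed.

Definition weak_lim (A : set T) : \bar R := (nur A)%:E.

Let weak_lim0 : weak_lim set0 = 0%E. Proof. by rewrite /weak_lim nur0. Qed.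

Let weak_lim_fin A : measurable A -> weak_lim A \is a fin_num.
Proof. by []. Qed.

(** Finite additivity passes to the limit. For countable additivity, the measure of the tails of the
    union in [V] tends to 0, and [nur_bound], with [m] fixed beforehand, makes their charge
    small. *)
Let weak_lim_sigma : semi_sigma_additive weak_lim.
Proof.
move=> F mF tF mUF.
have mS n : measurable (\big[setU/set0]_(i < n) F i) by exact: bigsetU_measurable.
have Sn n : (\sum_(0 <= i < n) weak_lim (F i))%E = (nur (\big[setU/set0]_(i < n) F i))%:E.
  elim: n => [|n IH]; first by rewrite big_geq// big_ord0 nur0.
  have dis : (\big[setU/set0]_(i < n) F i) `&` F n = set0.
    rewrite -bigcup_mkord; apply/seteqP; split => // x [[i /= iN Fi] Fn].
    have /trivIsetP/(_ i n Logic.I Logic.I) := tF; rewrite (ltn_eqF iN) => /(_ isT) E0.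
    by have : (F i `&` F n) x by []; rewrite E0.
  by rewrite big_nat_recr//= IH big_ord_recr/= (nurU (mS n) (mF n) dis).
pose tl n := (\bigcup_i F i) `\` (\big[setU/set0]_(i < n) F i).
have mtl n : measurable (tl n) by exact: measurableD.
have sub n : \big[setU/set0]_(i < n) F i `<=` \bigcup_i F i.
  by rewrite -bigcup_mkord => x [i _ Fi]; exists i.
have split_ n : nur (\bigcup_i F i) = nur (\big[setU/set0]_(i < n) F i) + nur (tl n).
  rewrite -(nurU (mS n) (mtl n)); last by rewrite /tl setDE setICA setICr setI0.
  by rewrite /tl setDUK.
have tl_cvg : mu (tl n `&` V) @[n --> \oo] --> 0%E.
  have -> : 0%E = mu (\bigcap_n (tl n `&` V)).
    rewrite [X in mu X](_ : _ = set0) ?measure0//.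
    apply/seteqP; split => // x H.
    have [[[i _ Fix] _] _] := H 0%N Logic.I.
    have [[_ nF] _] := H i.+1 Logic.I; apply: nF.
    by rewrite -bigcup_mkord; exists i => //=.
  apply: (@nonincreasing_cvg_mu _ _ _ mu (fun n => tl n `&` V)).
  - exact: fin_sub (measurableI _ _ (mtl _) mV) (@subIsetr _ _ _).
  - by move=> n; exact: measurableI.
  - by apply: bigcapT_measurable => n; exact: measurableI.
  - move=> n m nm; apply/subsetPset => x [[Fx nF] Vx]; split => //; split => // h.
    apply: nF; move: h; rewrite -!bigcup_mkord => -[i /= iN Fi].
    by exists i => //=; exact: leq_trans nm.
have tlr_cvg : fine (mu (tl n `&` V)) @[n --> \oo] --> 0.
  exact: (fine_cvg tl_cvg).
rewrite (_ : (fun n => _) = (fun n => (nur (\big[setU/set0]_(i < n) F i))%:E)); last first.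
  by apply/funext => n; exact: Sn.
apply: cvg_EFin; first exact: nearW.
rewrite /weak_lim.
apply/cvgrPdist_lt => e e0.
have [m Hm] : exists m : nat, K / 2 ^+ m < e / 2.
  exists (Num.truncn (K / (e / 2))).+1.
  rewrite ltr_pdivrMr ?exprn_gt0// -ltr_pdivrMl ?divr_gt0// mulrC.
  apply: (@lt_trans _ _ (Num.truncn (K / (e / 2))).+1%:R); first exact: truncnS_gt.
  by rewrite -natrX ltr_nat ltn_expl.
have c0 : 0 < C0 * 2 ^+ (b * m) by rewrite mulr_gt0// exprn_gt0.
have e2 : 0 < e / 2 / (C0 * 2 ^+ (b * m)) by rewrite !divr_gt0.
have /cvgrPdist_lt/(_ _ e2) := tlr_cvg.
apply: filterS => n; rewrite sub0r normrN ger0_norm ?fine_ge0// => h.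
rewrite /= (split_ n) addrAC subrr add0r; apply: le_lt_trans (nur_bound m (mtl n)) _.
rewrite /bnd [ltRHS](splitr e); apply: ltrD => //.
by rewrite mulrC -ltr_pdivlMr.
Qed.

HB.instance Definition _ := isCharge.Build _ _ _ weak_lim weak_lim0 weak_lim_fin weak_lim_sigma.

(** On a null set the bound reduces to [K / 2 ^+ m], for every [m]. *)
Let weak_lim_dom : weak_lim `<< mu.
Proof.
apply/null_content_dominatesP => A mA muA0.
have AV0 : mu (A `&` V) = 0%E.
  apply/eqP; rewrite eq_le measure_ge0 andbT -muA0.
  by apply: le_measure; rewrite ?inE//; exact: measurableI.
rewrite /weak_lim; congr EFin; apply/eqP; rewrite -normr_le0.
apply/ler_addgt0Pr => e e0; rewrite add0r.
apply: (le_trans (nur_bound (Num.truncn (K / e)).+1 mA)).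
rewrite /bnd AV0/= mulr0 add0r ler_pdivrMr ?exprn_gt0// -ler_pdivrMl// mulrC.
apply: (@le_trans _ _ (Num.truncn (K / e)).+1%:R); first exact/ltW/truncnS_gt.
by rewrite -natrX ler_nat ltnW// ltn_expl.
Qed.

Let g x : R := fine (Radon_Nikodym weak_lim mu x).

Let gE : EFin \o g = Radon_Nikodym weak_lim mu.
Proof.
by apply/funext => x /=; rewrite /g fineK//; exact: Radon_Nikodym_fin_num.
Qed.

Let g_int : mu.-integrable setT (EFin \o g).
Proof. by rewrite gE; exact: Radon_Nikodym_integrable. Qed.

Let g_intV : mu.-integrable V (EFin \o g).
Proof. exact: integrableS g_int. Qed.

Let g_nur A : measurable A -> \int[mu]_(x in A) g x = nur A.
Proof.
move=> mA; rewrite /Rintegral.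
by have := Radon_Nikodym_integral weak_lim_dom mA; rewrite -gE => <-.
Qed.

Let mg : measurable_fun setT g.
Proof. by apply/measurable_EFinP; exact: measurable_int g_int. Qed.

(** On a set [E] where [g] or [- g] is at least [la], the charge gives [la * mu E <= C0 * 2 ^+ (b *
    m) * mu E + K / 2 ^+ m]. As [la] is twice [C0 * 2 ^+ (b * m)], the first term is absorbed; the
    two signs of [g] double the constant. *)
Let g_weak_type : weak_type mu V b (2 * C0) (2 * (K / C0)) g.
Proof.
move=> m; pose la := 2 * C0 * 2 ^+ (b * m); pose S := K / C0 / 2 ^+ (b.+1 * m).
have p0 : 0 < (2 : R) ^+ (b * m) by exact: exprn_gt0.
have la0 : 0 < la by rewrite /la !mulr_gt0.
have half (s : R) E : E `<=` V -> measurable E -> `|s| = 1 ->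
    (forall x, E x -> la <= s * g x) -> (mu E <= S%:E)%E.
  move=> EV mE s1 Eg; have finE := fin_sub mE EV.
  have fE : mu E \is a fin_num by rewrite ge0_fin_numE.
  rewrite -(fineK fE) lee_fin; set e := fine (mu E).
  have e0 : 0 <= e by exact: fine_ge0.
  have EVE : E `&` V = E by apply/setIidl.
  have gE' : mu.-integrable E (EFin \o g) by exact: integrableS g_int.
  have h1 : la * e <= s * nur E.
    rewrite -g_nur// -(RintegralZl s mE gE') /e -(Rintegral_cst mu mE).
    apply: le_Rintegral => //.
    - by apply: measurable_bounded_integrable => //; exact: bounded_cst.
    - exact: (integrableZl mE s gE').
  have h2 : s * nur E <= C0 * 2 ^+ (b * m) * e + K / 2 ^+ m.
    rewrite (le_trans (ler_norm _))// normrM s1 mul1r.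
    by have := nur_bound m mE; rewrite /bnd EVE.
  have h3 : C0 * 2 ^+ (b * m) * e <= K / 2 ^+ m.
    have : la * e = 2 * (C0 * 2 ^+ (b * m) * e) by rewrite /la; ring.
    by lra.
  have -> : S = K / 2 ^+ m / (C0 * 2 ^+ (b * m)).
    by rewrite /S mulSn exprD; field; rewrite !expf_neq0//= gt_eqF.
  by rewrite ler_pdivlMr ?mulr_gt0// mulrC.
have mS c : measurable (V `&` [set x | c < g x]).
  have -> : V `&` [set x | c < g x] = V `&` g @^-1` `]c, +oo[%classic.
    by apply/seteqP; split => x /= [Ax]; rewrite in_itv/= andbT.
  by apply: measurable_funTS.
have mS' c : measurable (V `&` [set x | g x < c]).
  have -> : V `&` [set x | g x < c] = V `&` g @^-1` `]-oo, c[%classic.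
    by apply/seteqP; split => x /= [Ax]; rewrite in_itv/=.
  by apply: measurable_funTS.
have -> : V `&` [set x | la < `|g x|] =
    (V `&` [set x | la < g x]) `|` (V `&` [set x | g x < - la]).
  rewrite -setIUr; congr (_ `&` _); apply/seteqP; split => x /=; rewrite ltr_normr ltrNr.
    by move=> /orP.
  by move=> [->//|->]; rewrite orbT.
apply: (le_trans (measureU2 mu (mS _) (mS' _))).
have -> : 2 * (K / C0) / 2 ^+ (b.+1 * m) = S + S by rewrite /S; ring.
rewrite EFinD; apply: leeD.
- apply: (half 1 _ (@subIsetl _ _ _) (mS _) (normr1 _)) => x [_ /= h].
  by rewrite mul1r ltW.
- apply: (half (-1) _ (@subIsetl _ _ _) (mS' _) (normrN1 _)) => x [_ /= h].
  by rewrite mulN1r lerNr ltW.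
Qed.

Let pairing (phi : T -> R) : Prop :=
  \int[mu]_(x in V) (u j x * phi x) @[j --> U] --> \int[mu]_(x in V) (g x * phi x).

Let bounded_meas (phi : T -> R) : Prop :=
  measurable_fun V phi /\ exists B, forall x, V x -> `|phi x| <= B.

Let pairing_lin (a : R) (phi psi : T -> R) : bounded_meas phi -> bounded_meas psi ->
  pairing phi -> pairing psi -> pairing (fun x => a * phi x + psi x).
Proof.
move=> [mphi [B Bphi]] [mpsi [B' Bpsi]] hphi hpsi.
have lin (f : T -> R) : mu.-integrable V (EFin \o f) ->
    \int[mu]_(x in V) (f x * (a * phi x + psi x)) =
    a * \int[mu]_(x in V) (f x * phi x) + \int[mu]_(x in V) (f x * psi x).
  move=> fi; have i1 := integrable_mul_bounded mV fi mphi Bphi.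
  have i2 := integrable_mul_bounded mV fi mpsi Bpsi.
  rewrite -(RintegralZl a mV i1) -RintegralD//; last exact: (integrableZl mV a i1).
  by apply: eq_Rintegral => x _; ring.
rewrite /pairing lin//.
have h : a * \int[mu]_(x in V) (u j x * phi x) + \int[mu]_(x in V) (u j x * psi x) @[j --> U]
    --> a * \int[mu]_(x in V) (g x * phi x) + \int[mu]_(x in V) (g x * psi x).
  by apply: cvgD => //; apply: cvgM => //; exact: cvg_cst.
by apply: cvg_trans h; apply: near_eq_cvg; apply: nearW => j; rewrite lin.
Qed.

Let pairing_indic A : measurable A -> pairing (\1_A).
Proof.
move=> mA.
have E (f : T -> R) : \int[mu]_(x in V) (f x * \1_A x) = \int[mu]_(x in A `&` V) f x.
  rewrite setIC Rintegral_mkcondr; apply: eq_Rintegral => x _.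
  by rewrite patchE indicE; case: ifP => xA; rewrite ?mulr1 ?mulr0.
rewrite /pairing E g_nur; last exact: measurableI.
have mAV := measurableI _ _ mA mV.
apply: cvg_trans (nur_cvg mAV); apply: near_eq_cvg; apply: nearW => j.
by rewrite E /r -setIA setIid.
Qed.

Let pairing_lim (phi : T -> R) : bounded_meas phi ->
  (forall e : R, 0 < e -> exists phi', [/\ bounded_meas phi', pairing phi' &
    forall x, V x -> `|phi x - phi' x| <= e]) -> pairing phi.
Proof.
move=> [mphi [B Bphi]] H.
pose G := bnd 0%N V + \int[mu]_(x in V) `|g x|.
have bnd0 : 0 <= bnd 0%N V by rewrite (le_trans _ (r_bound 0%N 0%N mV)).
have intg0 : 0 <= \int[mu]_(x in V) `|g x| by exact: Rintegral_ge0.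
have ubnd j : \int[mu]_(x in V) `|u j x| <= bnd 0%N V.
  have uV := integrable_norm (u_int j).
  rewrite -lee_fin /Rintegral fineK; last first.
    rewrite ge0_fin_numE; last exact: integral_ge0.
    by case/integrableP : (u_int j).
  apply: (le_trans (u_small mV (@subset_refl _ V) j 0%N)).
  by rewrite /bnd setIid EFinD [in leRHS]EFinM fineK// ge0_fin_numE.
have G0 : 0 <= G by exact: addr_ge0.
apply/cvgrPdist_le => e e0; pose e' := e / 2 / (G + 1).
have G1 : 0 < G + 1 by rewrite ltr_wpDl.
have e'0 : 0 < e' by rewrite !divr_gt0.
have [phi' [[mphi' [B' Bphi']] pphi' phie]] := H e' e'0.
have e20 : 0 < e / 2 by rewrite divr_gt0.
have mdiff : measurable_fun V (fun x => phi x - phi' x) by exact: measurable_funB.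
have diff (f : T -> R) : mu.-integrable V (EFin \o f) ->
    `|\int[mu]_(x in V) (f x * phi x) - \int[mu]_(x in V) (f x * phi' x)| <=
    e' * \int[mu]_(x in V) `|f x|.
  move=> fi; have i1 := integrable_mul_bounded mV fi mphi Bphi.
  have i2 := integrable_mul_bounded mV fi mphi' Bphi'.
  rewrite -RintegralB//.
  rewrite (_ : \int[mu]_(x in V) (f x * phi x - f x * phi' x) =
    \int[mu]_(x in V) (f x * (phi x - phi' x))); last first.
    by apply: eq_Rintegral => x _; rewrite mulrBr.
  by apply: Rintegral_mul_bound => //; exact: ltW.
have /cvgrPdist_le/(_ _ e20) := pphi'.
apply: filterS => j h.
have h1 := diff _ g_intV; have h2 := diff _ (u_int j).
set a := \int[mu]_(x in V) (g x * phi x) in h1 *.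
set a' := \int[mu]_(x in V) (g x * phi' x) in h h1 *.
set c := \int[mu]_(x in V) (u j x * phi x) in h2 *.
set c' := \int[mu]_(x in V) (u j x * phi' x) in h h2 *.
have -> : a - c = (a - a') + (a' - c') - (c - c') by ring.
rewrite (le_trans (ler_normB _ _))// (le_trans (lerD (ler_normD _ _) (lexx _)))//.
have h3 : e' * \int[mu]_(x in V) `|g x| + e' * \int[mu]_(x in V) `|u j x| <= e / 2.
  rewrite -mulrDr (@le_trans _ _ (e' * (G + 1)))//; last first.
    by rewrite /e' divfK// gt_eqF.
  apply: ler_wpM2l; first exact: ltW.
  by rewrite /G; have := ubnd j; lra.
by lra.
Qed.

(** The staircase [psi N] is a combination of indicators, for which the limit is known, and lies
    within [1 / N%:R] of [phi]. *)
Let pairing_unit (phi : T -> R) : measurable_fun V phi ->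
  (forall x, V x -> 0 <= phi x <= 1) -> pairing phi.
Proof.
move=> mphi phi01; apply: pairing_lim.
  split => //; exists 1 => x /phi01/andP[h1 h2]; rewrite ger0_norm//.
move=> e e0; pose N := (Num.truncn (1 / e)).+1.
have NR : 0 < N%:R :> R by rewrite ltr0n.
have Ne : 1 / N%:R <= e.
  rewrite ler_pdivrMr// mulrC -ler_pdivrMr//.
  exact/ltW/truncnS_gt.
pose A k := V `&` [set x | k.+1%:R / N%:R < phi x].
have mA k : measurable (A k).
  have -> : A k = V `&` phi @^-1` `]k.+1%:R / N%:R, +oo[%classic.
    by apply/seteqP; split => x /= [Ax]; rewrite in_itv/= andbT.
  exact: mphi.
pose psi n x : R := \sum_(k < n) N%:R^-1 * \1_(A k) x.
have bpsi n : bounded_meas (psi n) /\ pairing (psi n).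
  elim: n => [|n [[mp [B HB]] pp]].
    have p0 : psi 0%N = cst 0 by apply/funext => x; rewrite /psi big_ord0.
    rewrite p0; split; first by split => //; exists 0 => x _; rewrite normr0.
    have Z (f : T -> R) : \int[mu]_(x in V) (f x * (cst 0 : T -> R) x) = 0.
      rewrite -[RHS](mul0r (fine (mu V))) -(Rintegral_cst mu mV).
      by apply: eq_Rintegral => x _ /=; rewrite mulr0.
    rewrite /pairing Z; apply: (@cvg_near_cst _ _ _ _ U); apply: nearW => j.
    exact: Z.
  have pS : psi n.+1 = (fun x => N%:R^-1 * \1_(A n) x + psi n x).
    by apply/funext => x; rewrite /psi big_ord_recr/= addrC.
  have bA : bounded_meas (\1_(A n)).
    split; first exact: measurable_funTS.
    by exists 1 => x _; rewrite indicE; case: (_ \in _); rewrite ?normr1 ?normr0.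
  rewrite pS; split; last first.
    by apply: (pairing_lin bA _ (pairing_indic (mA n)) pp); split => //; exists B.
  split.
    apply: measurable_funD => //; apply: measurable_funM; first exact: measurable_cst.
    by have [] := bA.
  exists (N%:R^-1 + B) => x Vx; rewrite (le_trans (ler_normD _ _))//; apply: lerD; last exact: HB.
  rewrite normrM ger0_norm ?invr_ge0// ler_piMr ?invr_ge0//.
  by rewrite indicE; case: (_ \in _); rewrite ?normr1 ?normr0.
exists (psi N); have [h1 h2] := bpsi N; split => // x Vx.
have /andP[p0 p1] := phi01 x Vx.
have := @count_levels R N (N%:R * phi x); rewrite mulr_ge0// ler_piMr// => /(_ isT isT).
have -> : \sum_(k < N) (k.+1%:R < N%:R * phi x)%R%:R = N%:R * psi N x.
  rewrite /psi big_distrr/=; apply: eq_bigr => k _.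
  rewrite mulrA divff ?gt_eqF// mul1r indicE; congr ((nat_of_bool _)%:R).
  rewrite mulrC -ltr_pdivrMr//; apply/idP/idP => [h|].
    by rewrite mem_set.
  by rewrite inE => -[].
move=> /andP[a1 a2]; apply: le_trans Ne.
rewrite ler_pdivlMr// -[X in `|_| * X]gtr0_norm// -normrM ler_norml.
by rewrite mulrBl; apply/andP; split; lra.
Qed.

(** [g] represents the limits along [U]. For those [phi] whose pairings converge along [\oo], [Uoo]
    identifies the limit along [U] with [l]. *)
Lemma weak_limit_density : exists g : T -> R,
  [/\ mu.-integrable setT (EFin \o g), weak_type mu V b (2 * C0) (2 * (K / C0)) g &
   forall (phi : T -> R) (B : R), measurable_fun V phi ->
    (forall x, V x -> `|phi x| <= B) -> forall l : R,
    \int[mu]_(x in V) (u j x * phi x) @[j --> \oo] --> l ->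
    \int[mu]_(x in V) (g x * phi x) = l].
Proof.
exists g; split => // phi B mphi phiB l ul.
have {}ul : \int[mu]_(x in V) (u j x * phi x) @[j --> U] --> l.
  by apply: cvg_trans ul => A; exact: Uoo.
suff : pairing phi by move=> h; exact: (cvg_unique (@Rhausdorff R) h ul).
pose B' := `|B| + 1; have B'0 : 0 < B' by rewrite ltr_wpDl.
(* Affine rescaling of [phi] to values between 0 and 1. *)
pose psi x := (phi x + B') / (2 * B').
have mpsi : measurable_fun V psi.
  by apply: measurable_funM => //; exact: measurable_funD.
have psi01 x : V x -> 0 <= psi x <= 1.
  move=> Vx; have := phiB x Vx; have := ler_norm B; rewrite ler_norml => h /andP[h1 h2].
  rewrite /psi divr_ge0 ?mulr_ge0 ?(ltW B'0)//=; last by rewrite /B'; lra.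
  by rewrite ler_pdivrMr ?mulr_gt0// /B'; lra.
have -> : phi = (fun x => 2 * B' * psi x + (- B' * cst 1 x + cst 0 x)).
  by apply/funext => x; rewrite /psi /=; field; rewrite gt_eqF.
have bc (c : R) : bounded_meas (cst c) by split => //; exists `|c|.
have p1 : pairing (cst 1) by apply: pairing_unit => // x _ /=; rewrite lexx ler01.
have p0 : pairing (cst 0) by apply: pairing_unit => // x _ /=; rewrite lexx ler01.
apply: pairing_lin => //; last 2 first.
- exact: pairing_unit.
- exact: pairing_lin.
- split => //; exists 1 => x Vx; have /andP[h1 h2] := psi01 x Vx.
  by rewrite ger0_norm.
- split; first by apply: measurable_funD => //; exact: measurable_funM.
  by exists `|- B' * 1 + 0| => x _.
Qed.

End WeakLimit.

(** * Difference quotients along a measure-preserving flow *)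

(** The count of large increments needs a segment of the orbit with both ends in [V]. The orbit is
    therefore cut down to the window between its first and last visits. *)
Lemma count_window (be : nat -> bool) N :
  (\sum_(i < N) be i)%N = 0%N \/
  exists i0 i1, [/\ (i0 <= i1)%N, (i1 < N)%N, be i0, be i1 &
    (\sum_(i < N) be i = \sum_(i < i1.+1 - i0) be (i + i0))%N].
Proof.
have [h|h] := boolP [exists i : 'I_N, be i]; last first.
  left; apply: big1 => i _; apply/eqP; rewrite eqb0.
  by apply: contra h => bi; apply/existsP; exists i.
right; move/existsP : h => [i bi].
have ex : exists k, (k < N)%N && be k by exists i; rewrite ltn_ord.
have bd k : (k < N)%N && be k -> (k <= N)%N by move=> /andP[/ltnW].
case: (ex_minnP ex) => i0 /andP[i0N b0] i0min.
case: (ex_maxnP ex bd) => i1 /andP[i1N b1] i1max.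
have i01 : (i0 <= i1)%N by apply: i0min; rewrite i1N.
exists i0, i1; split => //.
rewrite -(big_mkord xpredT (fun i => be i : nat)) (big_cat_nat (leq0n i0) (ltnW i0N))/=.
rewrite (big_cat_nat (leqW i01) i1N)/=.
have Z1 : (\sum_(0 <= k < i0) be k = 0)%N.
  rewrite big_nat; apply: big1 => k /andP[_ k0]; apply/eqP; rewrite eqb0.
  apply/negP => bk; have := i0min k; rewrite bk (ltn_trans k0 i0N) leqNgt k0.
  by move=> /(_ isT).
have Z2 : (\sum_(i1.+1 <= k < N) be k = 0)%N.
  rewrite big_nat; apply: big1 => k /andP[k1 kN]; apply/eqP; rewrite eqb0.
  apply/negP => bk; have := i1max k; rewrite bk kN leqNgt k1.
  by move=> /(_ isT).
by rewrite Z1 Z2 add0n addn0 -{1}(add0n i0) big_addn big_mkord.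
Qed.

Section FlowRoots.
Variable R : realType.
Local Notation C := R[i].
Variable n : nat.
Hypothesis n_gt0 : (0 < n)%N.
Local Notation N0 := (2 * n`!)%N.
Local Notation b0 := (3 * N0.-1)%N.

Context d (X : measurableType d) (mu : {sigma_finite_measure set X -> \bar R}).
(** A measure-preserving flow, to cover translations of the line and of row vectors at once. [V']
    contains the points that reach [V] within time [r]; from [Vj j] the flow stays in [V] for the
    time [r / j.+1%:R], the step of the [j]-th difference quotient. *)
Variables (T : R -> X -> X) (V V' : set X) (Vj : nat -> set X) (r : R).
Hypotheses (r0 : 0 < r)
  (T0 : forall x, T 0 x = x) (TD : forall s t x, T (s + t) x = T s (T t x))
  (mT : forall s, measurable_fun setT (T s))
  (Tmu : forall s A, measurable A -> mu (T s @^-1` A) = mu A)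
  (mV : measurable V) (mV' : measurable V') (V'fin : (mu V' < +oo)%E)
  (VV' : forall x s, 0 <= s <= r -> V (T s x) -> V' x)
  (mVj : forall j, measurable (Vj j))
  (VjV : forall j x s, Vj j x -> 0 <= s <= r / j.+1%:R -> V (T s x)).

Let tau j := r / j.+1%:R.

Let tau0 j : 0 < tau j. Proof. by rewrite divr_gt0. Qed.

Let VV'0 : V `<=` V'.
Proof. by move=> x Vx; apply: (@VV' x 0); rewrite ?lexx ?(ltW r0)// T0. Qed.

Let Vfin : (mu V < +oo)%E.
Proof. by apply: le_lt_trans V'fin; apply: le_measure; rewrite ?inE. Qed.

Variable f : X -> R.
Hypothesis mf : measurable_fun V f.

(** Set to 0 off [Vj j], where the translate may lie outside [V] and nothing is known about [f]. *)
Definition flow_quotient j x : R :=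
  if x \in Vj j then (f (T (tau j) x) - f x) / tau j else 0.

Let VjV0 j : Vj j `<=` V.
Proof. by move=> x Vjx; rewrite -(T0 x); apply: (VjV Vjx); apply/andP; split => //; exact: ltW (tau0 j). Qed.

Lemma measurable_flow_quotient j : measurable_fun V (flow_quotient j).
Proof.
have -> : flow_quotient j = (fun x => (f (T (tau j) x) - f x) / tau j) \_ (Vj j).
  by apply/funext => x; rewrite /flow_quotient patchE.
apply: measurable_funTS; apply/(measurable_restrictT _ (mVj j)).
apply: measurable_funM; last exact: measurable_cst.
apply: measurable_funB; last exact: measurable_funS (mf).
apply: (@measurable_comp _ _ _ _ _ _ V) => //; last exact: measurable_funTS.
by move=> _ [x Vjx <-]; apply: (VjV Vjx); apply/andP; split; [exact: ltW|exact: lexx].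
Qed.

(* Averaging over translates: [T i*tau x] lies in the exceptional set for few [i < j.+1]. *)
Lemma flow_count (B : set X) (kap : R) j : measurable B -> B `<=` V -> 0 <= kap ->
  (forall x, (\sum_(i < j.+1) (T (tau j *+ i) x \in B))%:R * tau j <= kap) ->
  (mu B <= (fine (mu V') * kap / r)%:E)%E.
Proof.
move=> mB BV kap0 H; pose N := j.+1.
have NR : N%:R * tau j = r by rewrite /tau mulrC divfK.
have finV' : mu V' \is a fin_num by rewrite ge0_fin_numE.
have Bfin : mu B \is a fin_num.
  rewrite ge0_fin_numE//; apply: le_lt_trans Vfin; apply: le_measure; rewrite ?inE//.
have mTB i : measurable (T (tau j *+ i) @^-1` B).
  by rewrite -[X in measurable X]setTI; exact: mT.
have TBV' i : (i < N)%N -> T (tau j *+ i) @^-1` B `<=` V'.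
  move=> iN x /= Bx; apply: (@VV' x (tau j *+ i)); last exact: BV.
  rewrite mulrn_wge0 ?(ltW (tau0 j))//= -NR -mulr_natl ler_wpM2r ?(ltW (tau0 j))//.
  by rewrite ler_nat ltnW.
have E : (\sum_(i < N) mu (T (tau j *+ i) @^-1` B) =
    \int[mu]_(x in V') (\sum_(i < N) (\1_(T (tau j *+ i) @^-1` B) x)%:E))%E.
  rewrite ge0_integral_sum//; last first.
  - by move=> i; apply: measurable_funTS; apply/measurable_EFinP; exact: measurable_indic.
  - apply: eq_bigr => i _; rewrite integral_indic//; congr (mu _).
    by apply/esym/setIidl; exact: TBV'.
have L : (\sum_(i < N) mu (T (tau j *+ i) @^-1` B) = N%:R%:E * mu B)%E.
  under eq_bigr do rewrite Tmu//.
  by rewrite -(fineK Bfin) sumEFin sumr_const card_ord -EFinM mulr_natl.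
have U : (\int[mu]_(x in V') (\sum_(i < N) (\1_(T (tau j *+ i) @^-1` B) x)%:E) <=
    (kap / tau j)%:E * mu V')%E.
  rewrite -integral_cst//; apply: ge0_le_integral => //.
  - by move=> x _; rewrite sume_ge0// => i _; rewrite lee_fin.
  - apply: emeasurable_fun_sum => i; apply: measurable_funTS.
    by apply/measurable_EFinP; exact: measurable_indic.
  - move=> x _; rewrite sumEFin lee_fin ler_pdivlMr//.
    apply: le_trans (H x); rewrite natr_sum le_eqVlt; apply/orP; left; apply/eqP.
    congr (_ * _); apply: eq_bigr => i _; rewrite indicE; congr ((nat_of_bool _)%:R).
move: U; rewrite -E L -(fineK Bfin) -(fineK finV') -!EFinM !lee_fin => U.
have {}U := ler_wpM2r (ltW (tau0 j)) U.
rewrite ler_pdivlMr// -NR mulrCA mulrA; apply: (le_trans U).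
by rewrite mulrAC divfK ?gt_eqF// mulrC.
Qed.

Variables (a : 'I_n -> X -> C) (l : X -> C) (M C0 : R).
Hypothesis fl : f = @complex.Re R \o l.
Hypotheses (ta : forall x s t j, s < t -> t - s <= r -> V (T s x) -> V (T t x) ->
    taylor_like s t (4 * n`!) M (fun u => a j (T u x)))
  (rl : forall x, V x -> root (monic_poly (a ^~ x)) (l x))
  (cl : forall x s t, (forall u, s <= u <= t -> V (T u x)) ->
    eps_delta s t (fun u => f (T u x)))
  (C00 : 0 < C0)
  (HC0 : forall a0 b1 (c : 'I_n -> R -> C), a0 < b1 -> b1 - a0 <= r ->
  (forall j, taylor_like a0 b1 (4 * n`!) M (c j)) ->
  forall N, (0 < N)%N -> let tau := (b1 - a0) / N%:R in
  forall (h : nat -> R -> C) (A : {set 'I_N}) m,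
  (forall i, i \in A ->
     let s := a0 + tau *+ i in let t := a0 + tau *+ i.+1 in
     [/\ eps_delta s t (@complex.Re R \o h i),
         forall u, s <= u <= t -> root (monic_poly (c ^~ u)) (h i u) &
         C0 * 2 ^+ (b0 * m) * tau < `|complex.Re (h i t) - complex.Re (h i s)|]) ->
  #|A|%:R * tau <= 1 / 2 ^+ (b0.+1 * m)).

(** Along an orbit, the visits to the exceptional set are steps on which the root has a large
    increment. Between the first and the last visit [HC0] bounds their number, and [flow_count]
    turns this into a measure. *)
Lemma flow_quotient_weak_type j :
  weak_type mu V b0 C0 (fine (mu V') / r) (flow_quotient j).
Proof.
move=> m; set B := V `&` _.
have mu_ : measurable_fun V (fun x => `|flow_quotient j x|).
  by apply: measurableT_comp => //; exact: measurable_flow_quotient.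
have mB : measurable B.
  have -> : B = V `&` (fun x => `|flow_quotient j x|) @^-1` `]C0 * 2 ^+ (b0 * m), +oo[%classic.
    by apply/seteqP; split => x /= [Ax]; rewrite in_itv/= andbT.
  exact: mu_.
have la0 : 0 < C0 * 2 ^+ (b0 * m) by rewrite mulr_gt0// exprn_gt0.
have BVj x : B x -> Vj j x /\ C0 * 2 ^+ (b0 * m) * tau j < `|f (T (tau j) x) - f x|.
  move=> [Vx /=]; rewrite /flow_quotient; case: ifPn => [|_].
    rewrite inE => Vjx; rewrite normrM normfV (gtr0_norm (tau0 j)) => h.
    by split => //; rewrite -ltr_pdivlMr.
  by rewrite normr0 ltNge (ltW la0).
have -> : fine (mu V') / r / 2 ^+ (b0.+1 * m) = fine (mu V') * (1 / 2 ^+ (b0.+1 * m)) / r.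
  by rewrite mul1r mulrAC.
apply: (@flow_count B _ j mB); first by move=> x [].
  by rewrite divr_ge0// exprn_ge0.
move=> x; have [->|[i0 [i1 [i01 i1N b0' b1' ->]]]] :=
  count_window (fun i => T (tau j *+ i) x \in B) j.+1.
  by rewrite mul0r divr_ge0// exprn_ge0.
have /BVj[Vj0 _] : B (T (tau j *+ i0) x) by move: b0'; rewrite inE.
have /BVj[Vj1 _] : B (T (tau j *+ i1) x) by move: b1'; rewrite inE.
pose N := (i1.+1 - i0)%N.
have N_gt0 : (0 < N)%N by rewrite subn_gt0 ltnS.
pose s := tau j *+ i0; pose t := tau j *+ i1.+1.
have tsE : t - s = tau j *+ N by rewrite /t /s -mulrnBr// leqW.
have st : s < t by rewrite -subr_gt0 tsE -mulr_natr mulr_gt0// ltr0n.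
have tauE : (t - s) / N%:R = tau j.
  by rewrite tsE -mulr_natr mulfK// pnatr_eq0 -lt0n.
have tsr : t - s <= r.
  have rE : r = tau j * j.+1%:R by rewrite /tau divfK// pnatr_eq0.
  rewrite tsE [leRHS]rE -mulr_natr.
  by rewrite ler_wpM2l ?(ltW (tau0 j))// ler_nat (leq_trans (leq_subr _ _)).
have Vs : V (T s x) by exact: VjV0 Vj0.
have tE : t = tau j + tau j *+ i1 by rewrite /t mulrS.
have Vt : V (T t x) by rewrite tE TD; apply: (VjV Vj1); apply/andP; split; [exact: ltW|exact: lexx].
have hc k := ta k st tsr Vs Vt.
pose A : {set 'I_N} := [set i : 'I_N | T (tau j *+ (i + i0)%N) x \in B]%SET.
have := HC0 st tsr hc N_gt0 (h := fun _ u => l (T u x)) (A := A) (m := m).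
rewrite tauE => HA.
have -> : (\sum_(i < i1.+1 - i0) (T (tau j *+ (i + i0)) x \in B))%N = #|A|.
  rewrite -sum1dep_card [RHS]big_mkcond/=; apply: eq_bigr => i _.
  by case: ifP.
apply: HA => i; rewrite inE => iB.
have gE k : s + tau j *+ k = tau j *+ (k + i0) by rewrite /s -mulrnDr addnC.
rewrite !gE addSn.
have Bi : B (T (tau j *+ (i + i0)) x) by move: iB; rewrite inE.
have [Vji big_] := BVj _ Bi.
have Vu u : tau j *+ (i + i0) <= u <= tau j *+ (i + i0).+1 -> V (T u x).
  move=> /andP[u1 u2]; rewrite -(subrK (tau j *+ (i + i0)) u) TD.
  apply: (VjV Vji); rewrite subr_ge0 u1/= lerBlDr.
  by move: u2; rewrite mulrS.
split.
- rewrite (_ : _ \o _ = (fun u => f (T u x))); last by rewrite fl.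
  exact: cl.
- by move=> u /Vu; exact: rl.
- have -> : complex.Re (l (T (tau j *+ (i + i0).+1) x)) = f (T (tau j) (T (tau j *+ (i + i0)) x)).
    by rewrite fl /= -TD mulrS.
  by rewrite (_ : complex.Re (l (T (tau j *+ (i + i0)) x)) = f (T (tau j *+ (i + i0)) x))// fl.
Qed.

End FlowRoots.

Section FlowTest.
Variable R : realType.
Context d (X : measurableType d) (mu : {sigma_finite_measure set X -> \bar R}).
Variables (T : R -> X -> X) (V : set X) (Vj : nat -> set X) (r : R).
Hypotheses (r0 : 0 < r)
  (T0 : forall x, T 0 x = x) (TD : forall s t x, T (s + t) x = T s (T t x))
  (mT : forall s, measurable_fun setT (T s))
  (Tmu : forall s A, measurable A -> mu (T s @^-1` A) = mu A)
  (mV : measurable V) (Vfin : (mu V < +oo)%E)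
  (VjV : forall j x s, Vj j x -> 0 <= s <= r / j.+1%:R -> V (T s x)).

Let tau j := r / j.+1%:R.

Let tau0 j : 0 < tau j. Proof. by rewrite divr_gt0. Qed.

(** What the limit of the discrete integration by parts asks of a test function: support in [Vj j]
    for late [j], a Lipschitz bound along the flow for dominated convergence, and backward quotients
    converging pointwise; [psi] is the derivative of [phi] along the flow. *)
Definition flow_test (phi psi : X -> R) : Prop :=
  [/\ measurable_fun setT phi, exists B, forall x, `|phi x| <= B,
    exists j0, forall j, (j0 <= j)%N -> forall x, ~ Vj j x -> phi x = 0,
    exists B, forall s x, `|phi (T s x) - phi x| <= B * `|s| &
    forall x, (phi (T (- tau j) x) - phi x) / tau j @[j --> \oo] --> - psi x].

Lemma integral_flow_invariant (h : X -> R) s : measurable_fun setT h ->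
  mu.-integrable setT (EFin \o (h \o T s)) ->
  \int[mu]_x h (T s x) = \int[mu]_x h x.
Proof.
move=> mh ih; rewrite /Rintegral; congr fine.
have := @integral_pushforward _ _ X X R (T s) (mT s) mu setT (EFin \o h).
rewrite preimage_setT => <- //; last exact/measurable_EFinP.
by apply: (@eq_measure_integral _ _ _ _ mu) => A mA _; rewrite -[RHS](Tmu s mA).
Qed.

Lemma flow_test_derivative phi psi : flow_test phi psi ->
  measurable_fun setT psi /\ exists B, forall x, `|psi x| <= B.
Proof.
move=> [mphi [B phiB] [j0 phi0] [B' lip] dphi].
pose q j x := (phi (T (- tau j) x) - phi x) / tau j.
have mq j : measurable_fun setT (q j).
  apply: measurable_funM; last exact: measurable_cst.
  by apply: measurable_funB => //; exact: measurableT_comp.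
have qB j x : `|q j x| <= `|B'|.
  rewrite /q normrM normfV (gtr0_norm (tau0 j)) ler_pdivrMr//.
  apply: le_trans (lip _ _) _; rewrite normrN (gtr0_norm (tau0 j)).
  by rewrite ler_wpM2r ?ler_norm// ltW// tau0.
split.
  apply: (@measurable_fun_cvg _ _ _ _ (fun j x => - q j x)) => [j|x _].
    exact: measurableT_comp (mq j).
  by rewrite -[psi x]opprK; apply: cvgN; exact: dphi.
exists `|B'| => x; rewrite -normrN.
have h : `|q j x| @[j --> \oo] --> `|- psi x| by apply: cvg_norm; exact: dphi.
rewrite -(cvg_lim _ h)//; apply: limr_le; first by apply/cvg_ex; exists `|- psi x|.
exact: nearW.
Qed.

Variables (f : X -> R) (Bf : R).
Hypotheses (mf : measurable_fun V f) (fB : forall x, V x -> `|f x| <= Bf).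

Let fV := f \_ V.

Let mfV : measurable_fun setT fV.
Proof. exact/(measurable_restrictT _ mV). Qed.

Let fVB x : `|fV x| <= `|Bf|.
Proof.
rewrite /fV patchE; case: ifPn => [|_]; last by rewrite normr0.
by rewrite inE => /fB h; apply: le_trans h _; exact: ler_norm.
Qed.

Let bounded_integrable (h : X -> R) (B : R) : measurable_fun setT h ->
  (forall x, `|h x| <= B) -> (forall x, ~ V x -> h x = 0) ->
  mu.-integrable setT (EFin \o h).
Proof.
move=> mh hB hV.
have -> : EFin \o h = (EFin \o h) \_ V.
  apply/funext => x; rewrite patchE; case: ifPn => // /negP.
  by rewrite inE => Vx /=; rewrite hV.
apply/(integrable_mkcond _ mV).
apply: (@le_integrable _ _ _ mu _ mV _ (cst B%:E)).
- by apply/measurable_EFinP; exact: measurable_funTS.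
- by move=> x _ /=; rewrite lee_fin (le_trans (hB x))// ler_norm.
apply/integrableP; split; first exact: measurable_cst.
by under eq_integral do rewrite /=; rewrite integral_cst// lte_mul_pinfty.
Qed.

Let ifV : mu.-integrable setT (EFin \o fV).
Proof.
apply: (bounded_integrable mfV fVB) => x Vx; rewrite /fV patchE memNset//.
Qed.

Let Rintegral_V (h : X -> R) : (forall x, ~ V x -> h x = 0) ->
  \int[mu]_(x in V) h x = \int[mu]_x h x.
Proof.
move=> hV; rewrite /Rintegral integral_mkcond; congr fine; apply: eq_integral => x _.
by rewrite patchE; case: ifPn => // /negP; rewrite inE => /hV ->.
Qed.

(** Summation by parts: invariance of the measure moves the translation from [f] to [phi]. As [phi]
    vanishes off [Vj j], [f] can be extended by zero outside [V] and the cutoff in the quotient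
    disappears. *)
Lemma flow_quotient_pairing (phi : X -> R) (B : R) j : measurable_fun setT phi ->
  (forall x, `|phi x| <= B) -> (forall x, ~ Vj j x -> phi x = 0) ->
  \int[mu]_(x in V) (flow_quotient T Vj r f j x * phi x) =
  \int[mu]_x (fV x * ((phi (T (- tau j) x) - phi x) / tau j)).
Proof.
move=> mphi phiB phi0.
have VjV0 x : Vj j x -> V x.
  by move=> Vjx; rewrite -(T0 x); apply: (VjV Vjx); rewrite lexx/= ltW// tau0.
have phiV x : ~ V x -> phi x = 0 by move=> Vx; apply: phi0 => /VjV0.
have iphi := bounded_integrable mphi phiB phiV.
have mfT : measurable_fun setT (fV \o T (tau j)) by exact: measurableT_comp.
have i1 : mu.-integrable setT (EFin \o (fun x => fV (T (tau j) x) * phi x)).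
  have := integrable_mul_bounded measurableT iphi mfT (fun x _ => fVB _).
  by congr (_.-integrable _ _); apply/funext => x /=; rewrite mulrC.
have i2 : mu.-integrable setT (EFin \o (fun x => fV x * phi x)).
  exact: (integrable_mul_bounded measurableT ifV mphi (fun x _ => phiB x)).
have mphiT : measurable_fun setT (phi \o T (- tau j)) by exact: measurableT_comp.
have i3 : mu.-integrable setT (EFin \o (fun x => fV x * phi (T (- tau j) x))).
  exact: (integrable_mul_bounded measurableT ifV mphiT (fun x _ => phiB _)).
have TK x : T (- tau j) (T (tau j) x) = x by rewrite -TD addNr T0.
rewrite Rintegral_V; last by move=> x Vx; rewrite phiV ?mulr0.
rewrite (_ : (fun x => _) = fun x => (tau j)^-1 * (fV (T (tau j) x) * phi x - fV x * phi x)); last first.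
  apply/funext => x; rewrite /flow_quotient /fV !patchE.
  case: (boolP (x \in Vj j)) => [|/negP]; rewrite inE => Vx; last by rewrite phi0// !mulr0 subr0 mulr0.
  have Vt : V (T (tau j) x).
    by apply: (VjV Vx); apply/andP; split; [exact: ltW|exact: lexx].
  rewrite !mem_set//; last exact: VjV0.
  rewrite /tau; ring.
rewrite RintegralZl//; last first.
  by have := integrableB measurableT i1 i2; congr (_.-integrable _ _).
rewrite RintegralB//.
have E : (fun x => fV (T (tau j) x) * phi (T (- tau j) (T (tau j) x))) =
    (fun x => fV (T (tau j) x) * phi x) by apply/funext => x; rewrite TK.
have := @integral_flow_invariant (fun x => fV x * phi (T (- tau j) x)) (tau j).
rewrite E => ->; last 2 first.
- exact: measurable_funM.
- by rewrite (_ : _ \o _ = (fun x => fV (T (tau j) x) * phi x)).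
rewrite -RintegralB// -RintegralZl//; last first.
  by have := integrableB measurableT i3 i2; congr (_.-integrable _ _).
by congr (fine _); apply: eq_integral => x _; congr EFin; rewrite /tau; ring.
Qed.

(** The Lipschitz bound along the flow dominates the quotients of [phi], so dominated convergence
    applies to the summation by parts. *)
Lemma flow_quotient_pairing_cvg (phi psi : X -> R) : flow_test phi psi ->
  \int[mu]_(x in V) (flow_quotient T Vj r f j x * phi x) @[j --> \oo] -->
  - \int[mu]_(x in V) (f x * psi x).
Proof.
move=> tp; have [mpsi0 [B1 psiB0]] := flow_test_derivative tp.
move: tp => [mphi [B phiB] [j0 phi0] [B' lip] dphi].
pose q j x := (phi (T (- tau j) x) - phi x) / tau j.
have mq j : measurable_fun setT (q j).
  apply: measurable_funM; last exact: measurable_cst.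
  by apply: measurable_funB => //; exact: measurableT_comp.
have qB j x : `|q j x| <= `|B'|.
  rewrite /q normrM normfV (gtr0_norm (tau0 j)) ler_pdivrMr//.
  apply: le_trans (lip _ _) _; rewrite normrN (gtr0_norm (tau0 j)).
  by rewrite ler_wpM2r ?ler_norm// ltW// tau0.
have mpsi : measurable_fun setT (fun x => - psi x) by exact: measurableT_comp.
pose F j x := (fV x * q j x)%:E.
have [|||||_ _ H] := @dominated_convergence _ _ _ mu setT measurableT F
  (fun x => (fV x * - psi x)%:E) (fun x => (`|B'| * `|fV x|)%:E).
- by move=> k; apply/measurable_EFinP; exact: measurable_funM.
- by apply/measurable_EFinP; exact: measurable_funM.
- apply: aeW => x _; apply: cvg_EFin; first exact: nearW.
  by apply: cvgM; [exact: cvg_cst|exact: dphi].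
- by have := integrableZl measurableT `|B'| (integrable_norm ifV); congr (_.-integrable _ _).
- apply: aeW => x k _; rewrite /F lee_fin normrM mulrC.
  by rewrite ler_wpM2r.
have psiB x : `|- psi x| <= B1 by rewrite normrN.
have ipsi : mu.-integrable setT (EFin \o (fun x => fV x * - psi x)).
  exact: (integrable_mul_bounded measurableT ifV mpsi (fun x _ => psiB x)).
have -> : - (\int[mu]_(x in V) (f x * psi x)) = \int[mu]_x (fV x * - psi x).
  apply/eqP; rewrite eqr_oppLR -mulN1r -RintegralZl//; apply/eqP.
  rewrite -[RHS]Rintegral_V; last first.
    by move=> x Vx; rewrite /fV patchE memNset// mul0r mulr0.
  by apply: eq_Rintegral => x xV; rewrite /fV patchE xV; ring.
have ifin : (\int[mu]_x (fV x * - psi x)%:E)%E \is a fin_num by exact: integrable_fin_num.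
move: H; rewrite -(fineK ifin) => /fine_cvg H.
apply: cvg_trans H; apply: near_eq_cvg; exists j0 => // j /= j0j.
by rewrite (flow_quotient_pairing mphi phiB (phi0 j j0j)).
Qed.
End FlowTest.

Lemma nc_i (R : realType) : nc (- 'i%C : R[i]) = 1.
Proof. by rewrite ncN /= expr0n/= add0r expr1n sqrtr1. Qed.

Lemma taylor_like_unit (R : realType) (a b : R) k M (w : R[i]) (c : R -> R[i]) : nc w = 1 ->
  taylor_like a b k M c -> taylor_like a b k M (fun t => w * c t).
Proof.
move=> w1 [cM cL cT]; split.
- by move=> t /cM; rewrite ncM w1 mul1r.
- by move=> s t /cL h /h; rewrite -mulrBr ncM w1 mul1r.
move=> t0 /cT[S sS hS]; exists (w *: S); first exact: leq_trans (size_scale_leq _ _) sS.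
by move=> t /hS; rewrite hornerZ -mulrBr ncM w1 mul1r.
Qed.

(** The coefficient [a j] is homogeneous of degree [j.+1] in the roots. *)
Lemma root_monic_poly_scale (R : realType) n (a : 'I_n -> R[i]) (w z : R[i]) :
  root (monic_poly a) z -> root (monic_poly (fun j : 'I_n => w ^+ j.+1 * a j)) (w * z).
Proof.
rewrite /root /monic_poly !hornerE !horner_sum => /eqP az; apply/eqP.
transitivity (w ^+ n * 0); last exact: mulr0.
rewrite -[in RHS]az exprMn mulrDr mulr_sumr; congr (_ + _).
apply: eq_bigr => j _; rewrite !hornerE exprMn.
have -> : w ^+ n = w ^+ j.+1 * w ^+ (n - j.+1) by rewrite -exprD subnKC// ltn_ord.
by rewrite mulrACA mulrA.
Qed.

Section FlowRootDerivative.
Variable R : realType.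
Local Notation C := R[i].
Variable n : nat.
Hypothesis n_gt0 : (0 < n)%N.
Local Notation N0 := (2 * n`!)%N.
Local Notation b0 := (3 * N0.-1)%N.

Lemma root_exponent_gt0 : (0 < b0)%N.
Proof.
have N01 : (1 < N0)%N by exact: leq_pmulr (fact_gt0 n).
by rewrite muln_gt0/=; move: N01; case: (N0) => // -[].
Qed.

Context d (X : measurableType d) (mu : {sigma_finite_measure set X -> \bar R}).
Variables (T : R -> X -> X) (V V' : set X) (Vj : nat -> set X) (r : R).
Hypotheses (r0 : 0 < r)
  (T0 : forall x, T 0 x = x) (TD : forall s t x, T (s + t) x = T s (T t x))
  (mT : forall s, measurable_fun setT (T s))
  (Tmu : forall s A, measurable A -> mu (T s @^-1` A) = mu A)
  (mV : measurable V) (mV' : measurable V') (V'fin : (mu V' < +oo)%E)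
  (VV' : forall x s, 0 <= s <= r -> V (T s x) -> V' x)
  (mVj : forall j, measurable (Vj j))
  (VjV : forall j x s, Vj j x -> 0 <= s <= r / j.+1%:R -> V (T s x)).

Definition flow_continuous (f : X -> R) := forall x s t,
  (forall u, s <= u <= t -> V (T u x)) -> eps_delta s t (fun u => f (T u x)).

Definition flow_derivative (f g : X -> R) := forall phi psi,
  flow_test T Vj r phi psi ->
  \int[mu]_(x in V) (f x * psi x) = - \int[mu]_(x in V) (g x * phi x).

Let flow_Re_derivative (M : R) : exists C0 C1 : R, [/\ 0 < C0, 0 <= C1 &
  forall (a : 'I_n -> X -> C) (l : X -> C),
  (forall x s t j, s < t -> t - s <= r -> V (T s x) -> V (T t x) ->
     taylor_like s t (4 * n`!) M (fun u => a j (T u x))) ->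
  (forall x, V x -> root (monic_poly (a ^~ x)) (l x)) ->
  (exists B, forall x, V x -> nc (l x) <= B) ->
  measurable_fun V (@complex.Re R \o l) -> flow_continuous (@complex.Re R \o l) ->
  exists g : X -> R, [/\ mu.-integrable setT (EFin \o g), weak_type mu V b0 C0 C1 g &
    flow_derivative (@complex.Re R \o l) g]].
Proof.
have Vfin : (mu V < +oo)%E.
  apply: le_lt_trans V'fin; apply: le_measure; rewrite ?inE// => x Vx.
  by apply: (@VV' x 0); rewrite ?lexx ?(ltW r0)// T0.
have [C0 C00 HC0] := @root_increments_count R n n_gt0 `|M| r (normr_ge0 _) (ltW r0).
pose C1 := fine (mu V') / r.
have C10 : 0 <= C1 by rewrite divr_ge0 ?fine_ge0// ltW.
have d1 : decay_rate b0 (1 : R) < 1 by rewrite decay_rate1; lra.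
(* For [q = 1] the decay rate is [1 / 2], which gives the remainder the form [K / 2 ^+ m] expected
   by the weak limit. *)
have [K K0 HK] := weak_type_power root_exponent_gt0 C00 C10 ltr01 d1.
exists (2 * C0), (2 * (K / C0)); split; first by rewrite mulr_gt0.
  by rewrite mulr_ge0// divr_ge0// ltW.
move=> a l ta rl [B lB] ml cl.
have ta' x s t j : s < t -> t - s <= r -> V (T s x) -> V (T t x) ->
    taylor_like s t (4 * n`!) `|M| (fun u => a j (T u x)).
  move=> st tr Vs Vt; have [h1 h2 h3] := ta x s t j st tr Vs Vt.
  split.
  - by move=> u /h1 h; apply: le_trans h (ler_norm _).
  - by move=> u v /h2 h /h{}h; apply: le_trans h _; rewrite ler_wpM2r// ler_norm.
  - move=> u /h3[S sS hS]; exists S => // v /hS{}h; apply: le_trans h _.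
    by rewrite ler_wpM2r ?exprn_ge0// ler_norm.
have wt := flow_quotient_weak_type r0 T0 TD mT Tmu mV mV' V'fin VV' mVj VjV ml
  (erefl _) ta' rl cl C00 HC0.
have mu_ := measurable_flow_quotient r0 T0 mT mV mVj VjV ml.
have us A : measurable A -> A `<=` V -> forall j m,
    (\int[mu]_(x in A) (`|flow_quotient T Vj r (@complex.Re R \o l) j x|)%:E <=
    (C0 * 2 ^+ (b0 * m))%:E * mu A + (K / 2 ^+ m)%:E)%E.
  move=> mA AV j m.
  have := HK _ _ mu V A _ mV mA AV (mu_ j) (wt j) m.
  rewrite powRr1; last by rewrite mulr_ge0 ?exprn_ge0// ltW.
  rewrite decay_rate1 expr_div_n expr1n mul1r.
  by under eq_integral do rewrite powRr1//.
have [U [UU Uoo]] := @ultraFilterLemma nat \oo _.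
have [g [ig wg pg]] := weak_limit_density mV Vfin C00 mu_ us UU Uoo.
exists g; split => // phi psi tp.
have [mphi [B1 phiB] _ _ _] := tp.
have fB x : V x -> `|(@complex.Re R \o l) x| <= B.
  by move=> /lB; apply: le_trans; exact: ler_ncRe.
have H := flow_quotient_pairing_cvg r0 T0 TD mT Tmu mV Vfin VjV ml fB tp.
have := pg phi B1 (measurable_funTS mphi) (fun x _ => phiB x) _ H.
by move=> ->; rewrite opprK.
Qed.

(** [C0] and [C1] are fixed before the coefficients and the root: this order of quantifiers carries
    the uniformity over families. *)
Lemma flow_root_derivative (M : R) : exists C0 C1 : R, [/\ 0 < C0, 0 <= C1 &
  forall (a : 'I_n -> X -> C) (l : X -> C),
  (forall x s t j, s < t -> t - s <= r -> V (T s x) -> V (T t x) ->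
     taylor_like s t (4 * n`!) M (fun u => a j (T u x))) ->
  (forall x, V x -> root (monic_poly (a ^~ x)) (l x)) ->
  (exists B, forall x, V x -> nc (l x) <= B) ->
  cpart_all (measurable_fun V) l -> cpart_all flow_continuous l ->
  exists g : X -> C, [/\ cintegrable mu setT g, cpart_all (weak_type mu V b0 C0 C1) g,
    flow_derivative (@complex.Re R \o l) (@complex.Re R \o g) &
    flow_derivative (@complex.Im R \o l) (@complex.Im R \o g)]].
Proof.
have [C0 [C1 [C00 C10 H]]] := flow_Re_derivative M.
exists C0, C1; split=> // a l ta rl [B lB] [mRe mIm] [cRe cIm].
have [g1 [ig1 wg1 dg1]] := H a l ta rl (ex_intro _ B lB) mRe cRe.
have IE : @complex.Im R \o l = @complex.Re R \o (fun x => - 'i%C * l x).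
  by apply/funext => x /=; case: (l x) => u v /=; ring.
rewrite IE in mIm cIm *.
have [|||g2 [ig2 wg2 dg2]] := H (fun j x => (- 'i%C) ^+ j.+1 * a j x) (fun x => - 'i%C * l x) _ _ _ mIm cIm.
- move=> x s t j st tr Vs Vt; apply: taylor_like_unit; last exact: ta.
  by rewrite ncX nc_i expr1n.
- by move=> x /rl; exact: root_monic_poly_scale.
- by exists B => x /lB; rewrite ncM nc_i mul1r.
by exists (fun x => (g1 x +i* g2 x)%C); split.
Qed.

End FlowRootDerivative.

(** * Taylor polynomials from bounds on derivatives *)

Section TaylorLike.
Variable R : realType.
Local Notation C := R[i].

Lemma mvt_between (f df : R -> R) (a b s t : R) :
  (forall x, a < x < b -> is_derive x 1 f (df x)) ->
  {within `[a, b]%classic, continuous f} -> a <= s <= b -> a <= t <= b ->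
  exists x, [/\ a <= x <= b, `|x - s| <= `|t - s| & f t - f s = df x * (t - s)].
Proof.
move=> fdf cf.
have H u v : a <= u -> v <= b -> u <= v ->
    exists x, [/\ u <= x <= v & f v - f u = df x * (v - u)].
  move=> au vb uv; have [||x xuv ->] := @MVT_segment R f df u v uv.
  - by move=> x; rewrite in_itv/= => /andP[ux xv]; apply: fdf; rewrite (le_lt_trans au ux) (lt_le_trans xv vb).
  - by apply: continuous_subspaceW cf; apply: subset_itv; rewrite bnd_simp.
  - by exists x; split=> //; move: xuv; rewrite in_itv.
move=> /andP[as_ sb] /andP[at_ tb]; have [st|/ltW ts] := leP s t.
  have [x [/andP[sx xt] ->]] := H s t as_ tb st; exists x; split => //.
    by rewrite (le_trans as_ sx) (le_trans xt tb).
  by rewrite !ger0_norm ?subr_ge0// lerD2r.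
have [x [/andP[tx xs] E]] := H t s at_ sb ts; exists x; split.
- by rewrite (le_trans at_ tx) (le_trans xs sb).
- by rewrite !ler0_norm ?subr_le0// lerN2 lerD2r.
by rewrite -(opprB (f s)) E -mulrN opprB.
Qed.

Lemma antiderivative_poly (S : {poly R}) : exists2 P : {poly R},
  (size P <= (size S).+1)%N & P^`() = S.
Proof.
exists (\poly_(i < (size S).+1) (S`_i.-1 / i%:R)); first exact: size_poly.
apply/polyP => i; rewrite coef_deriv coef_poly ltnS /=.
case: ltnP => [_|h]; last by rewrite mul0rn nth_default.
by rewrite -[LHS]mulr_natr divfK// pnatr_eq0.
Qed.

Lemma is_derive_horner (P : {poly R}) (x : R) : is_derive x 1 (horner P) (P^`()).[x].
Proof.
by apply: DeriveDef; [exact: derivable_horner|rewrite -derive1E -derivE].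
Qed.

(** Induction on the order: the polynomial approximating [d 1] is integrated, its constant is fixed
    at [t0], and the mean value theorem gains one factor [t - t0]. *)
Lemma real_taylor (a b M : R) k (d : nat -> R -> R) t0 :
  (forall l, (l < k)%N -> forall x, a < x < b -> is_derive x 1 (d l) (d l.+1 x)) ->
  (forall l, (l < k)%N -> {within `[a, b]%classic, continuous (d l)}) ->
  (forall x, a <= x <= b -> `|d k x| <= M) -> a <= t0 <= b ->
  exists2 T : {poly R}, (size T <= k)%N &
    forall t, a <= t <= b -> `|d 0 t - T.[t]| <= M * `|t - t0| ^+ k.
Proof.
elim: k d => [|k IH] d dd cd dM at0b.
  by exists 0; rewrite ?size_poly0// => t /dM; rewrite horner0 subr0 expr0 mulr1.
have [||S sS HS] := IH (fun l => d l.+1) _ _ dM at0b.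
- by move=> l lk; exact: dd.
- by move=> l lk; exact: cd.
have [P sP PS] := antiderivative_poly S.
exists (P + (d 0%N t0 - P.[t0])%:P).
  rewrite (leq_trans (size_polyD _ _))// geq_max (leq_trans sP)//=.
  by rewrite (leq_trans (size_polyC_leq1 _)).
move=> t atb; pose h x := d 0%N x - P.[x].
have [||x [axb xt E]] := @mvt_between h (fun x => d 1%N x - S.[x]) a b t0 t _ _ at0b atb.
- move=> x axb; rewrite -PS.
  have h1 := dd _ (ltn0Sn k) x axb; have h2 := is_derive_horner P x.
  exact: is_deriveB.
- move=> x; apply: continuousB; first exact: (cd 0%N).
  by apply: continuous_subspaceT => y; apply: differentiable_continuous; apply/derivable1_diffP; exact: derivable_horner.
have -> : d 0%N t - (P + (d 0%N t0 - P.[t0])%:P).[t] = h t - h t0.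
  by rewrite hornerD hornerC /h; ring.
rewrite E normrM exprSr mulrA; apply: ler_wpM2r => //.
apply: le_trans (HS x axb) _; apply: ler_wpM2l.
  by apply: le_trans (dM x axb); exact: normr_ge0.
by apply: lerXn2r; rewrite ?nnegrE.
Qed.

(** The factor 2 comes from treating real and imaginary parts separately, as the mean value theorem
    demands. *)
Lemma taylor_like_derivatives (a b M : R) k (d : nat -> R -> C) : (0 < k)%N ->
  (forall l, (l < k)%N -> forall x, a < x < b ->
    is_derive x 1 (@complex.Re R \o d l) (complex.Re (d l.+1 x)) /\
    is_derive x 1 (@complex.Im R \o d l) (complex.Im (d l.+1 x))) ->
  (forall l, (l < k)%N -> cpart_all (fun h => {within `[a, b]%classic, continuous h}) (d l)) ->
  (forall l, (l <= k)%N -> forall x, a <= x <= b -> nc (d l x) <= M) ->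
  taylor_like a b k (2 * M) (d 0%N).
Proof.
move=> k0 dd cd dM.
have M2 (z : C) (B : R) : `|complex.Re z| <= B -> `|complex.Im z| <= B -> nc z <= 2 * B.
  by move=> h1 h2; apply: le_trans (nc_leReIm z) _; lra.
split.
- move=> t atb; have h := dM 0%N (leq0n k) t atb.
  by have h0 := le_trans (nc_ge0 _) h; apply: le_trans h _; lra.
- move=> s t asb atb; rewrite -mulrA; apply: M2.
  + have [x [axb _ E]] := mvt_between (fun x hx => proj1 (dd _ k0 x hx)) (proj1 (cd _ k0)) asb atb.
    rewrite raddfB/=; move: E => /= ->; rewrite normrM ler_wpM2r//.
    by apply: le_trans (ler_ncRe _) _; exact: dM.
  + have [x [axb _ E]] := mvt_between (fun x hx => proj2 (dd _ k0 x hx)) (proj2 (cd _ k0)) asb atb.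
    rewrite raddfB/=; move: E => /= ->; rewrite normrM ler_wpM2r//.
    by apply: le_trans (ler_ncIm _) _; exact: dM.
move=> t0 at0b.
have [T1 sT1 H1] := @real_taylor a b M k (fun l => @complex.Re R \o d l) t0
  (fun l lk x hx => proj1 (dd l lk x hx)) (fun l lk => proj1 (cd l lk))
  (fun x hx => le_trans (ler_ncRe _) (dM k (leqnn k) x hx)) at0b.
have [T2 sT2 H2] := @real_taylor a b M k (fun l => @complex.Im R \o d l) t0
  (fun l lk x hx => proj2 (dd l lk x hx)) (fun l lk => proj2 (cd l lk))
  (fun x hx => le_trans (ler_ncIm _) (dM k (leqnn k) x hx)) at0b.
exists (map_poly (real_complex R) T1 + 'i%C *: map_poly (real_complex R) T2).
  rewrite (leq_trans (size_polyD _ _))// geq_max (leq_trans (size_poly _ _))//=.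
  by rewrite (leq_trans (size_scale_leq _ _))// (leq_trans (size_poly _ _)).
move=> t atb; rewrite -mulrA hornerD hornerZ !horner_map/=.
apply: M2.
- by have := H1 t atb; congr (`|_| <= _); rewrite /=; case: (d 0%N t) => u v /=; ring.
- by have := H2 t atb; congr (`|_| <= _); rewrite /=; case: (d 0%N t) => u v /=; ring.
Qed.

End TaylorLike.

(** * Complex Sobolev bounds from real weak-type bounds *)

Section WeakPartial.
Variable R : realType.
Local Notation C := R[i].
Context d (X : measurableType d) (mu : {sigma_finite_measure set X -> \bar R}).
Variables (V : set X) (mV : measurable V) (Vfin : (mu V < +oo)%E).

Lemma powR_nc_le (z : C) (q : R) : 0 <= q ->
  nc z `^ q <= 2 `^ q * (`|complex.Re z| `^ q + `|complex.Im z| `^ q).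
Proof.
move=> q0; set x := `|_|; set y := `|complex.Im z|.
have h : nc z <= 2 * Num.max x y.
  by apply: le_trans (nc_leReIm z) _; rewrite mulr_natl mulr2n lerD// le_max lexx ?orbT.
apply: (le_trans (ge0_ler_powR q0 _ _ h)); rewrite ?nnegrE ?nc_ge0//.
  by rewrite mulr_ge0// le_max normr_ge0.
rewrite powRM//; last by rewrite le_max normr_ge0.
apply: ler_wpM2l; first exact: powR_ge0.
by have [_|_] := leP x y; rewrite ?lerDl ?lerDr powR_ge0.
Qed.

Lemma measurable_nc (g : X -> C) : cpart_all (measurable_fun V) g ->
  measurable_fun V (fun x => nc (g x)).
Proof.
move=> [m1 m2].
have -> : (fun x => nc (g x)) = (fun x => (complex.Re (g x) ^+ 2 + complex.Im (g x) ^+ 2) `^ 2^-1).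
  by apply/funext => x; rewrite powR12_sqrt ?addr_ge0 ?sqr_ge0//; case: (g x).
apply: measurableT_comp (measurable_powR _) _.
by apply: measurable_funD; exact: measurable_funX.
Qed.

Lemma Lq_norm_weak_type (b : nat) (C0 C1 q : R) : (0 < b)%N -> 0 < C0 -> 0 <= C1 ->
  0 < q -> decay_rate b q < 1 -> exists2 K : R, 0 <= K &
  forall g : X -> C, cpart_all (measurable_fun V) g ->
  cpart_all (weak_type mu V b C0 C1) g -> (Lq_norm mu V q g <= K%:E)%E.
Proof.
move=> b0 C00 C10 q0 rb; have [K K0 HK] := weak_type_power b0 C00 C10 q0 rb.
pose K1 := C0 `^ q * fine (mu V) + K.
have K10 : 0 <= K1 by rewrite addr_ge0// mulr_ge0 ?powR_ge0 ?fine_ge0.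
pose K2 := 2 `^ q * (K1 + K1).
have K20 : 0 <= K2 by apply: mulr_ge0; [exact: powR_ge0|exact: addr_ge0].
exists (K2 `^ q^-1).
  by rewrite powR_ge0.
move=> g [m1 m2] [w1 w2].
have H (h : X -> R) : measurable_fun V h -> weak_type mu V b C0 C1 h ->
    (\int[mu]_(x in V) (`|h x| `^ q)%:E <= K1%:E)%E.
  move=> mh wh; have := HK _ _ mu V V h mV mV (@subset_refl _ V) mh wh 0%N.
  rewrite muln0 expr0 mulr1 expr0 mulr1 => /le_trans; apply.
  by rewrite /K1 EFinD EFinM fineK// ge0_fin_numE.
have mp (h : X -> R) : measurable_fun V h -> measurable_fun V (fun x => (`|h x| `^ q)%:E).
  move=> mh; apply/measurable_EFinP; apply: measurableT_comp (measurable_powR _) _.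
  exact: measurableT_comp.
rewrite /Lq_norm unlock /Lnorm.
have E : (\int[mu]_x (`|((fun x => (cmodulus (g x))%:E) \_ V) x| `^ q) <= K2%:E)%E.
  have -> : (fun x => (`|((fun x => (cmodulus (g x))%:E) \_ V) x| `^ q)%E) =
      (fun x => (nc (g x) `^ q)%:E) \_ V.
    apply/funext => x; rewrite !patchE; case: ifPn => _.
      by rewrite /= ger0_norm// nc_ge0.
    by rewrite /= normr0 powR0// gt_eqF.
  rewrite -integral_mkcond.
  apply: (@le_trans _ _ (\int[mu]_(x in V) ((2 `^ q)%:E *
      ((`|complex.Re (g x)| `^ q)%:E + (`|complex.Im (g x)| `^ q)%:E)))%E).
    apply: ge0_le_integral => //.
    - by move=> x _; rewrite lee_fin powR_ge0.
    - apply/measurable_EFinP; apply: measurableT_comp (measurable_powR _) _; exact: measurable_nc.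
    - by apply: emeasurable_funM => //; apply: emeasurable_funD; exact: mp.
    - by move=> x _; rewrite -EFinD -EFinM lee_fin powR_nc_le// ltW.
  rewrite ge0_integralZl//; last 2 first.
  - by apply: emeasurable_funD; exact: mp.
  - by move=> x _; rewrite -EFinD lee_fin addr_ge0// powR_ge0.
  rewrite ge0_integralD//; first last.
  - exact: mp.
  - exact: mp.
  rewrite /K2 EFinM EFinD; apply: lee_pmul => //.
  - by apply: adde_ge0; apply: integral_ge0 => x _; rewrite lee_fin powR_ge0.
  - by rewrite leeD// H.
have := @gt0_ler_poweR R q^-1 _ _ K2%:E _ _ E.
rewrite poweR_EFin; apply.
- by rewrite invr_ge0 ltW.
- rewrite in_itv/= leey andbT; apply: integral_ge0 => x _; exact: poweR_ge0.
- by rewrite in_itv/= leey andbT lee_fin.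
Qed.

(** [C1 = 0] because no tested level is exceeded. The norm of a root can thus be bounded by the same
    lemma as that of its derivative. *)
Lemma bounded_weak_type (b : nat) (f : X -> R) (B : R) : (forall x, V x -> `|f x| <= B) ->
  weak_type mu V b (`|B| + 1) 0 f.
Proof.
move=> fB m; rewrite mul0r (_ : V `&` _ = set0) ?measure0//.
apply/seteqP; split => // x [Vx /=]; rewrite ltNge => /negP; apply.
apply: le_trans (fB x Vx) _; apply: le_trans (ler_norm B) _.
apply: (@le_trans _ _ (`|B| + 1)); first by rewrite lerDl.
by rewrite ler_peMr ?addr_ge0// exprn_ege1// ler1n.
Qed.

Lemma bounded_integrable_on (f : X -> R) (B : R) : measurable_fun V f ->
  (forall x, V x -> `|f x| <= B) -> mu.-integrable V (EFin \o f).
Proof.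
move=> mf fB; apply: (@le_integrable _ _ _ mu _ mV _ (cst B%:E)).
- exact/measurable_EFinP.
- by move=> x Vx /=; rewrite lee_fin (le_trans (fB x Vx))// ler_norm.
apply/integrableP; split; first exact: measurable_cst.
by under eq_integral do rewrite /=; rewrite integral_cst// lte_mul_pinfty.
Qed.

Variables (T : R -> X -> X) (Vj : nat -> set X) (r : R).
Hypotheses (r0 : 0 < r) (mT : forall s, measurable_fun setT (T s)).

(** The two parts of a complex product involve four real products, so each part of [l] is tested
    against each part of [phi]. *)
Lemma cintegral_by_parts (l g phi psi : X -> C) (B : R) :
  cpart_all (measurable_fun V) l -> (forall x, V x -> nc (l x) <= B) ->
  cintegrable mu setT g ->
  flow_derivative mu T V Vj r (@complex.Re R \o l) (@complex.Re R \o g) ->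
  flow_derivative mu T V Vj r (@complex.Im R \o l) (@complex.Im R \o g) ->
  flow_test T Vj r (@complex.Re R \o phi) (@complex.Re R \o psi) ->
  flow_test T Vj r (@complex.Im R \o phi) (@complex.Im R \o psi) ->
  cintegral mu V (fun x => l x * psi x) = - cintegral mu V (fun x => g x * phi x).
Proof.
move=> [ml1 ml2] lB [ig1 ig2] D1 D2 t1 t2.
have [mp1 [A1 pA1]] := flow_test_derivative r0 mT t1.
have [mp2 [A2 pA2]] := flow_test_derivative r0 mT t2.
have [mq1 [B1 qB1] _ _ _] := t1; have [mq2 [B2 qB2] _ _ _] := t2.
have E1 := D1 _ _ t1; have E2 := D1 _ _ t2; have E3 := D2 _ _ t1; have E4 := D2 _ _ t2.
have il1 : mu.-integrable V (EFin \o (@complex.Re R \o l)).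
  by apply: (bounded_integrable_on ml1) => x /lB; apply: le_trans; exact: ler_ncRe.
have il2 : mu.-integrable V (EFin \o (@complex.Im R \o l)).
  by apply: (bounded_integrable_on ml2) => x /lB; apply: le_trans; exact: ler_ncIm.
have {}ig1 : mu.-integrable V (EFin \o (@complex.Re R \o g)).
  by apply: integrableS ig1.
have {}ig2 : mu.-integrable V (EFin \o (@complex.Im R \o g)).
  by apply: integrableS ig2.
have I := fun f (h : X -> R) B (i : mu.-integrable V (EFin \o f)) (m : measurable_fun setT h)
  (hB : forall x, `|h x| <= B) => integrable_mul_bounded mV i (measurable_funTS m) (fun x _ => hB x).
rewrite /cintegral.
have Re_ (f h : X -> C) : mu.-integrable V (EFin \o (fun x => complex.Re (f x) * complex.Re (h x))) ->
    mu.-integrable V (EFin \o (fun x => complex.Im (f x) * complex.Im (h x))) ->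
    \int[mu]_(x in V) complex.Re (f x * h x) =
    \int[mu]_(x in V) (complex.Re (f x) * complex.Re (h x)) -
    \int[mu]_(x in V) (complex.Im (f x) * complex.Im (h x)).
  move=> i1 i2; rewrite -RintegralB//; apply: eq_Rintegral => x _.
  by case: (f x) (h x) => ? ? [].
have Im_ (f h : X -> C) : mu.-integrable V (EFin \o (fun x => complex.Re (f x) * complex.Im (h x))) ->
    mu.-integrable V (EFin \o (fun x => complex.Im (f x) * complex.Re (h x))) ->
    \int[mu]_(x in V) complex.Im (f x * h x) =
    \int[mu]_(x in V) (complex.Re (f x) * complex.Im (h x)) +
    \int[mu]_(x in V) (complex.Im (f x) * complex.Re (h x)).
  move=> i1 i2; rewrite -RintegralD//; apply: eq_Rintegral => x _.
  by case: (f x) (h x) => ? ? [].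
have J1 := I _ _ _ ig1 mq1 qB1; have J2 := I _ _ _ ig2 mq2 qB2.
have J3 := I _ _ _ il1 mp1 pA1; have J4 := I _ _ _ il2 mp2 pA2.
have J5 := I _ _ _ ig1 mq2 qB2; have J6 := I _ _ _ ig2 mq1 qB1.
have J7 := I _ _ _ il1 mp2 pA2; have J8 := I _ _ _ il2 mp1 pA1.
rewrite (Re_ _ _ J1 J2) (Re_ _ _ J3 J4) (Im_ _ _ J5 J6) (Im_ _ _ J7 J8).
move: E1 E2 E3 E4 => /= -> -> -> ->.
by apply/eqP; rewrite eq_complex/= !opprD !opprK !eqxx.
Qed.
End WeakPartial.

(** * Lines and translations *)

Section Lines.
Variable R : realType.
Variables (W : normedModType R) (e : W).

Lemma is_derive_line (h : W -> R) x (u : R) : derivable h (x + u *: e) e ->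
  is_derive u 1 (fun u : R => h (x + u *: e)) ('D_e h (x + u *: e)).
Proof.
move=> dh.
have E : (fun t : R => t^-1 *: (((fun u => h (x + u *: e)) \o shift u) (t *: 1) - h (x + u *: e))) =
         (fun t : R => t^-1 *: ((h \o shift (x + u *: e)) (t *: e) - h (x + u *: e))).
  apply/funext => t /=; congr (_ *: (h _ - _)).
  by rewrite /shift/= scalerDl /GRing.scale/= mulr1 addrCA.
by apply: DeriveDef; rewrite /derivable /derive E.
Qed.

Lemma continuous_line (h : W -> R) x (u : R) : {for x + u *: e, continuous h} ->
  {for u, continuous (fun u : R => h (x + u *: e))}.
Proof.
move=> ch; apply: (@continuous_comp _ _ _ (fun u : R => x + u *: e) h) => //.
by apply: cvgD; [exact: cvg_cst|apply: cvgZr_tmp; exact: cvg_id].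
Qed.

Lemma compact_radius (K U : set W) : compact K -> open U -> K `<=` U ->
  exists2 r : R, 0 < r & forall x y, K x -> `|x - y| < r -> U y.
Proof.
move=> /compact_near_coveringP cK oU KU.
have [|r r0 H] := cK R (0^'+) (fun r x => forall y, `|x - y| < r -> U y) _ _.
  move=> x /KU Ux; have /nbhs_ballP[d /= d0 dU] : nbhs x U by exact: open_nbhs_nbhs.
  exists (ball x (d / 2), [set r | 0 < r < d / 2]).
    split; first by apply: nbhsx_ballx; rewrite divr_gt0.
    exists (d / 2); rewrite /= ?divr_gt0// => s /=.
    by rewrite sub0r normrN => + s0; rewrite s0 gtr0_norm.
  move=> [x' s] [] /=; rewrite -ball_normE/= => xx' /andP[s0 sd] y x'y; apply: dU.
  rewrite -ball_normE/= (_ : x - y = (x - x') + (x' - y)); last by rewrite subrKA.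
  by apply: le_lt_trans (ler_normD _ _) _; lra.
exists (r / 2); first by rewrite divr_gt0.
move=> x y Kx xy; apply: (H (r / 2) _ _ x Kx y xy) => /=.
- by rewrite sub0r normrN gtr0_norm ?divr_gt0// ltr_pdivrMr// ltr_pMr// ltr1n.
- by rewrite divr_gt0.
Qed.

Lemma compact_support_bounded (h : W -> R) (K : set W) : compact K -> continuous h ->
  (forall x, ~ K x -> h x = 0) -> exists2 B : R, 0 <= B & forall x, `|h x| <= B.
Proof.
move=> cK ch hK.
have [M [_ HM]] := compact_bounded (continuous_compact (continuous_subspaceT ch) cK).
exists (`|M| + 1) => [|x]; first by rewrite addr_ge0.
have [Kx|/hK->] := pselect (K x); last by rewrite normr0 addr_ge0.
by apply: HM; [rewrite (le_lt_trans (ler_norm M))// ltrDl|exists x].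
Qed.

Lemma derive_support (h : W -> R) (K : set W) : compact K ->
  (forall x, ~ K x -> h x = 0) -> forall x, ~ K x -> 'D_e h x = 0.
Proof.
move=> cK hK x nKx.
have cl := compact_closed (@norm_hausdorff _ W) cK.
rewrite (@near_eq_derive _ _ _ h (cst 0)) ?derive_cst//.
have : nbhs x (~` K) by apply: open_nbhs_nbhs; split => //; exact: closed_openC.
by apply: filterS => y /hK ->.
Qed.

Lemma line_lipschitz (h : W -> R) (B : R) : 0 <= B -> (forall x, derivable h x e) ->
  (forall x, `|'D_e h x| <= B) -> forall s x, `|h (x + s *: e) - h x| <= B * `|s|.
Proof.
move=> B0 dh DB s x.
have der u := is_derive_line (dh (x + u *: e)).
have [|||u [_ _]] := @mvt_between R (fun u => h (x + u *: e))
  (fun u => 'D_e h (x + u *: e)) (- `|s|) `|s| 0 s.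
- apply: continuous_subspaceT => u; apply: differentiable_continuous.
  by apply/derivable1_diffP; have [] := der u.
- by rewrite oppr_le0 !normr_ge0.
- by rewrite -ler_norml.
by rewrite scale0r addr0 subr0 => ->; rewrite normrM ler_wpM2r.
Qed.

Lemma line_quotient_cvg (h : W -> R) (r : R) x : 0 < r -> derivable h x e ->
  (h (x + (- (r / j.+1%:R)) *: e) - h x) / (r / j.+1%:R) @[j --> \oo] --> - 'D_e h x.
Proof.
move=> r0 /cvg_ex[l hl]; rewrite /derive (cvg_lim _ hl)//.
pose s (j : nat) := - (r / j.+1%:R).
have sc : s j @[j --> \oo] --> 0^'.
  have s0 : s j @[j --> \oo] --> (0 : R).
    rewrite -oppr0 -(mulr0 r); apply: cvgN; apply: cvgM; first exact: cvg_cst.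
    exact: cvg_harmonic.
  move=> A A0; have [N _ HN] := s0 _ A0; exists N => // j Nj; apply: (HN j Nj).
  by rewrite /s/= oppr_eq0 gt_eqF// divr_gt0.
have -> : (fun j => (h (x + (- (r / j.+1%:R)) *: e) - h x) / (r / j.+1%:R)) =
    (fun j => - ((s j)^-1 *: ((h \o shift x) (s j *: e) - h x))).
  apply/funext => j; rewrite /s /shift/= invrN.
  have E (c D : R) : - ((- c) *: D) = c * D by rewrite scaleNr opprK.
  rewrite E mulrC.
  by congr (_ * (h _ - _)); exact: addrC.
by apply: cvgN; exact: (cvg_comp _ _ sc hl).
Qed.

(** The points from which translations shorter than [dl] stay in [V]. With a strict inequality this
    set is closed, hence measurable. *)
Definition inner_points (V : set W) (dl : R) := [set x | forall y, `|x - y| < dl -> V y].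

Lemma closed_inner_points (V : set W) dl : closed (inner_points V dl).
Proof.
rewrite -openC openE => x /= /existsNP[y /not_implyP[xy nVy]].
apply/nbhs_ballP; exists (dl - `|x - y|); first by rewrite /= subr_gt0.
move=> z; rewrite -ball_normE/= => xz /(_ y) h; apply/nVy/h.
rewrite (_ : z - y = (x - y) - (x - z)); last by rewrite opprB [RHS]addrC addrA subrK.
by apply: le_lt_trans (ler_normB _ _) _; lra.
Qed.

(** [compact_radius] separates the support from the complement of [V], and [j0] is reached when
    [2 * r / j.+1%:R] falls below that distance. *)
Lemma line_test (h : W -> R) (V K : set W) (r : R) : 0 < r -> open V ->
  compact K -> K `<=` V -> (forall x, ~ K x -> h x = 0) -> continuous h ->
  (forall x, derivable h x e) -> continuous ('D_e h) ->
  [/\ exists B, forall x, `|h x| <= B,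
    exists j0, forall j, (j0 <= j)%N -> forall x,
      ~ inner_points V (2 * r / j.+1%:R) x -> h x = 0,
    exists B, forall s x, `|h (x + s *: e) - h x| <= B * `|s| &
    forall x, (h (x + (- (r / j.+1%:R)) *: e) - h x) / (r / j.+1%:R) @[j --> \oo] -->
      - 'D_e h x].
Proof.
move=> r0 oV cK KV hK ch dh cdh.
have [B _ HB] := compact_support_bounded cK ch hK.
have [B' B'0 HB'] := compact_support_bounded cK cdh (derive_support cK hK).
split; [by exists B| |by exists B'; exact: line_lipschitz|by move=> x; exact: line_quotient_cvg].
have [dl dl0 Hdl] := compact_radius cK oV KV.
exists (Num.truncn (2 * r / dl)) => j j0j x nx; apply: hK => Kx; apply: nx => y xy.
apply: (Hdl x) => //; apply: lt_le_trans xy _; rewrite ler_pdivrMr// -ler_pdivrMl// mulrC.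
by apply/ltW/(lt_le_trans (truncnS_gt _)); rewrite ler_nat ltnS.
Qed.

Lemma taylor_like_line (d : nat -> W -> R[i]) (K : set W) (M : R) k (x : W) (s t : R) : (0 < k)%N ->
  (forall l, (l < k)%N -> forall y, K y ->
    [/\ derivable (@complex.Re R \o d l) y e, derivable (@complex.Im R \o d l) y e &
     d l.+1 y = ('D_e (@complex.Re R \o d l) y +i* 'D_e (@complex.Im R \o d l) y)%C]) ->
  (forall l, (l < k)%N -> cpart_all (fun h => forall y, K y -> {for y, continuous h}) (d l)) ->
  (forall l, (l <= k)%N -> forall y, K y -> nc (d l y) <= M) ->
  (forall u, s <= u <= t -> K (x + u *: e)) ->
  taylor_like s t k (2 * M) (fun u => d 0%N (x + u *: e)).
Proof.
move=> k0 dd cd dM xK.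
apply: (@taylor_like_derivatives _ s t M k (fun l u => d l (x + u *: e))) => //.
- move=> l lk u /andP[su ut].
  have Ku : K (x + u *: e) by apply: xK; rewrite !ltW.
  have [h1 h2 ->] := dd l lk _ Ku; split; exact: is_derive_line.
- move=> l lk; have [c1 c2] := cd l lk.
  split; apply: continuous_in_subspaceT => u; rewrite inE/= in_itv/= => /xK Ku.
    exact: (continuous_line (c1 _ Ku)).
  exact: (continuous_line (c2 _ Ku)).
- by move=> l lk u /xK Ku; exact: dM.
Qed.
End Lines.

Section LebesgueShift.
Variable R : realType.
Local Notation leb := (@lebesgue_measure R).

Lemma measurable_shift (s : R) : measurable_fun setT (fun x : R => x + s).
Proof. by apply: measurable_funD; [exact: measurable_id|exact: measurable_cst]. Qed.

Lemma lebesgue_shift (s : R) (A : set R) : measurable A ->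
  leb ((fun x => x + s) @^-1` A) = leb A.
Proof.
move=> mA; have ms : measurable_fun setT ((fun x => x + s) : R -> measurableTypeR R).
  exact: measurable_shift.
have -> : leb ((fun x => x + s) @^-1` A) = pushforward leb ((fun x => x + s) : R -> measurableTypeR R) A.
  by [].
apply/esym/lebesgue_measure_unique => //= _ [[a b]] _ <-.
rewrite /pushforward (_ : _ @^-1` _ = `]a - s, b - s]%classic); last first.
  by apply/seteqP; split => x /=; rewrite !in_itv/= ltrBlDr lerBrDr.
rewrite /= !lebesgue_measure_itv/= !lte_fin ltrD2r.
by case: ifP => // _; congr EFin; rewrite opprB addrA subrK.
Qed.

Lemma ge0_integral_shift (s : R) (g : R -> \bar R) : measurable_fun setT g ->
  (forall x, (0 <= g x)%E) -> (\int[leb]_x g (x + s)%R = \int[leb]_x g x)%E.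
Proof.
move=> mg g0; have ms : measurable_fun setT ((fun x => x + s) : R -> measurableTypeR R).
  exact: measurable_shift.
have := @ge0_integral_pushforward _ _ (measurableTypeR R) (measurableTypeR R) R _ ms leb setT g measurableT mg (fun x _ => g0 x).
rewrite preimage_setT => <-.
by apply: eq_measure_integral => A mA _; exact: (lebesgue_shift s mA).
Qed.

End LebesgueShift.

Section RowVectors.
Variable R : realType.
Variable m : nat.
Implicit Types x y v : 'rV[R]_m.

Lemma rV_coord_le x i : `|x ord0 i| <= `|x|.
Proof. by rewrite [leRHS]/Num.norm /= mx_normrE; apply/bigmax_geP; right => /=; exists (ord0, i). Qed.

Lemma rV_norm_lt x (c : R) : 0 < c -> (forall i, `|x ord0 i| < c) -> `|x| < c.
Proof.
move=> c0 H; rewrite [ltLHS]/Num.norm /= mx_normrE; apply/bigmax_ltP; split => // -[i j] _ /=.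
by rewrite ord1.
Qed.

(** The sigma-algebra is generated by the coordinates, so the open set is written as a countable
    union of boxes with rational centre and radius the inverse of a positive integer. *)
Lemma open_measurable_rV (U : set 'rV[R]_m) : open U -> measurable U.
Proof.
move=> oU.
pose B (p : 'rV[rat]_m * nat) := [set v : 'rV[R]_m | forall i,
  `](ratr (p.1 ord0 i) - p.2.+1%:R^-1), (ratr (p.1 ord0 i) + p.2.+1%:R^-1)[%classic (v ord0 i)].
have -> : U = \bigcup_p (if `[< B p `<=` U >] then B p else set0).
  apply/seteqP; split => [x Ux|x [p _]]; last by case: ifPn => // /asboolP h /h.
  have /nbhs_ballP[d /= d0 dU] : nbhs x U by exact: open_nbhs_nbhs.
  pose N := Num.truncn (2 / d).
  have Nd : 2 * N.+1%:R^-1 < d.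
    by rewrite ltr_pdivrMr// -ltr_pdivrMl// mulrC truncnS_gt.
  have N0 : 0 < N.+1%:R^-1 :> R by rewrite invr_gt0.
  have /boolp.choice[q Hq] i : exists q : rat, x ord0 i - N.+1%:R^-1 < ratr q < x ord0 i + N.+1%:R^-1.
    have [|q] := @rat_in_itvoo R (x ord0 i - N.+1%:R^-1) (x ord0 i + N.+1%:R^-1).
      by rewrite ltrD2l gt0_cp.
    by rewrite in_itv; exists q.
  pose p := (\row_i q i, N).
  have Bx : B p x.
    move=> i /=; rewrite in_itv/= mxE; have /andP[] := Hq i.
    by move: (N.+1%:R^-1) => c q1 q2; apply/andP; split; lra.
  exists p => //; rewrite asboolT// => y By; apply: dU; rewrite -ball_normE/=.
  apply: rV_norm_lt => // i; rewrite !mxE.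
  have := Bx i; have := By i; rewrite /= !in_itv/=.
  move: (ratr _) (N.+1%:R^-1) Nd => w c Nd /andP[h1 h2] /andP[h3 h4].
  by rewrite ltr_norml; apply/andP; split; lra.
apply: countable_bigcupT_measurable => [|p]; first exact: countableP.
case: ifP => // _; apply: (measurable_box (A := fun i =>
  `](ratr (p.1 ord0 i) - p.2.+1%:R^-1), (ratr (p.1 ord0 i) + p.2.+1%:R^-1)[%classic)) => i.
exact: measurable_itv.
Qed.

Lemma closed_measurable_rV (K : set 'rV[R]_m) : closed K -> measurable K.
Proof. by move=> cK; rewrite -(setCK K); apply: measurableC; apply: open_measurable_rV; exact: closed_openC. Qed.

Lemma continuous_measurable_rV (V : set 'rV[R]_m) (h : 'rV[R]_m -> R) : open V ->
  (forall x, V x -> {for x, continuous h}) -> measurable_fun V h.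
Proof.
move=> oV ch; apply: (measurability _ (RGenOInfty.measurableE R)).
move=> /= _ [_ [a ->]] <-; apply: open_measurable_rV.
rewrite openE => x [Vx /= hx]; rewrite /interior.
have h1 : nbhs x V by exact: open_nbhs_nbhs.
have h2 : \forall y \near x, (h @^-1` `]a, +oo[%classic) y.
  apply: (ch x Vx); apply: open_nbhs_nbhs; split => //; exact: interval_open.
by near=> y; split; near: y.
Unshelve. all: by end_near. Qed.

Lemma bounded_rV_finite (B : R) :
  let A := [set v : 'rV[R]_m | forall i, `[(- B), B]%classic (v ord0 i)] in
  measurable A /\ (lebesgue_rV m A < +oo)%E.
Proof.
split; first by apply: (measurable_box (A := fun=> `[(- B), B]%classic)) => i; exact: measurable_itv.
rewrite (lebesgue_rV_box (A := fun=> `[(- B), B]%classic)); last by move=> i; exact: measurable_itv.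
rewrite -ge0_fin_numE; last by apply: prode_ge0.
apply: prode_fin_num => i _.
by rewrite lebesgue_measure_itv/=; case: ifP.
Qed.

Lemma measurable_line (i : 'I_m) (s : R) :
  measurable_fun setT (fun x : 'rV[R]_m => x + s *: delta_mx ord0 i).
Proof.
apply: measurable_fun_coordP => j; under eq_fun do rewrite !mxE.
by apply: measurable_funD; [exact: measurable_coord|exact: measurable_cst].
Qed.

Lemma norm_delta_rV (i : 'I_m) : `|delta_mx ord0 i : 'rV[R]_m| <= 1.
Proof.
rewrite leNgt; apply/negP => h.
have := @rV_norm_lt (delta_mx ord0 i) `|delta_mx ord0 i : 'rV[R]_m| (lt_trans ltr01 h).
rewrite ltxx => H; suff : false by []; apply: H => j; apply: le_lt_trans h.
by rewrite mxE; case: (_ && _); rewrite ?normr1 ?normr0.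
Qed.
End RowVectors.

(** Induction along the construction of the measure as a product: a shift of the first coordinate is
    the invariance on the line, any other shift acts inside the sections. *)
Lemma lebesgue_rV_line (R : realType) m (i : 'I_m) (s : R) (A : set 'rV[R]_m) : measurable A ->
  lebesgue_rV m ((fun x => x + s *: delta_mx ord0 i) @^-1` A) = lebesgue_rV m A.
Proof.
elim: m i A => [[]//|m IH] i A mA.
have mB : measurable (@rV_cons R m @^-1` A).
  by rewrite -[X in measurable X]setTI; exact: measurable_rV_cons.
rewrite /= /cons_measure /pushforward /product_measure1.
have [j ->|->] := unliftP ord0 i; last first.
  rewrite -(ge0_integral_shift s (g := lebesgue_rV m \o xsection (@rV_cons R m @^-1` A))); last 2 first.
  - exact: measurable_fun_xsection.
  - by move=> x; exact: measure_ge0.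
  apply: eq_integral => x _ /=; congr (lebesgue_rV m _); apply/funext => v.
  apply/propext; rewrite /xsection/= !inE/=; suff -> : rV_cons (x, v) + s *: delta_mx ord0 ord0 = rV_cons (x + s, v) by [].
  apply/rowP => k; rewrite !mxE/=; have [l ->|->] := unliftP ord0 k.
    by rewrite eq_sym (negbTE (neq_lift _ _)) mulr0 addr0.
  by rewrite eqxx mulr1.
congr (integral _ _ _); apply/funext => x /=.
have mX : measurable (xsection (@rV_cons R m @^-1` A) x) by exact: measurable_xsection mB.
rewrite -(IH j _ mX).
congr (lebesgue_rV m _); apply/funext => v.
apply/propext; rewrite /xsection/= !inE/=; suff -> : rV_cons (x, v) + s *: delta_mx ord0 (lift ord0 j) = rV_cons (x, v + s *: delta_mx ord0 j) by [].
apply/rowP => k; rewrite !mxE/=; have [l ->|->] := unliftP ord0 k.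
  by rewrite /= !mxE/= (inj_eq lift_inj).
by rewrite mulr0 addr0.
Qed.

(** * Several variables *)

Section RootPartial.
Variable R : realType.
Local Notation C := R[i].
Variable n : nat.
Hypothesis n_gt0 : (0 < n)%N.
Local Notation N0 := (2 * n`!)%N.
Local Notation b0 := (3 * N0.-1)%N.
Local Notation k := (4 * n`!)%N.
Variable m : nat.
Local Notation mu := (lebesgue_rV m : {sigma_finite_measure set 'rV[R]_m -> \bar R}).

Lemma smoothness_gt0 : (0 < k)%N. Proof. by rewrite muln_gt0 fact_gt0. Qed.

Lemma root_monic_poly_bound (a : 'I_n -> C) z (M : R) : (forall j, nc (a j) <= M) ->
  root (monic_poly a) z -> nc z <= 1 + n%:R * (1 + `|M|).
Proof.
move=> aM; apply: root_bound; [|exact: monic_monic_poly|exact: size_monic_poly|].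
  by rewrite addr_ge0.
apply: coef_bounded_monic_poly; first by rewrite lerDl.
by move=> j; apply: le_trans (aM j) _; rewrite (le_trans (ler_norm M))// lerDr.
Qed.

Lemma continuous_on_measurable (V : set 'rV[R]_m) (l : 'rV[R]_m -> C) : open V ->
  continuous_on V l -> cpart_all (measurable_fun V) l.
Proof. by move=> oV [c1 c2]; split; exact: continuous_measurable_rV. Qed.

Lemma test_function_line (V : set 'rV[R]_m) (i : 'I_m) (r : R) phi : 0 < r -> open V ->
  test_function V phi ->
  let T s x := x + s *: delta_mx ord0 i in
  let Vj j := inner_points V (2 * r / j.+1%:R) in
  flow_test T Vj r (@complex.Re R \o phi) (@complex.Re R \o partial i phi) /\
  flow_test T Vj r (@complex.Im R \o phi) (@complex.Im R \o partial i phi).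
Proof.
move=> r0 oV [phiC [K [cK KV] phiK]] T Vj.
have [c0 _] := phiC 2%N [::]; have [c1 c2] := c0 isT.
have [_ d0] := phiC 2%N [::]; have [d1 d2] := d0 isT i.
have [e0 _] := phiC 2%N [:: i]; have [e1 e2] := e0 isT.
split.
  have [h1 h2 h3 h4] := line_test (e := delta_mx ord0 i) (h := @complex.Re R \o phi) r0 oV cK KV
    (fun x nK => congr1 (@complex.Re R) (phiK x nK)) (fun x => c1 x Logic.I) (fun x => d1 x Logic.I)
    (fun x => e1 x Logic.I).
  split=> //; apply: continuous_measurable_rV; [exact: openT|exact: c1].
have [h1 h2 h3 h4] := line_test (e := delta_mx ord0 i) (h := @complex.Im R \o phi) r0 oV cK KV
  (fun x nK => congr1 (@complex.Im R) (phiK x nK)) (fun x => c2 x Logic.I) (fun x => d2 x Logic.I)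
  (fun x => e2 x Logic.I).
split=> //; apply: continuous_measurable_rV; [exact: openT|exact: c2].
Qed.

(** A segment joining two points of [V] may leave [V], but if its length is at most [r] it stays in
    [K], the closure of [V] swept by translations up to [r], which is still a compact part of [U].
    [K] is provided before [M], since the bound on the coefficients can be taken only once the
    compact set is known. *)
Lemma root_partial (U V : set 'rV[R]_m) (i : 'I_m) : open U -> open V ->
  relatively_compact_in V U -> exists K, [/\ compact K, K `<=` U, V `<=` K &
  forall M : R, exists C0 C1 : R, [/\ 0 < C0, 0 <= C1 &
  forall (a : 'I_n -> 'rV[R]_m -> C) (l : 'rV[R]_m -> C),
  (forall j, in_Ck k U (a j)) ->
  (forall j s x, (size s <= k)%N -> K x -> nc (iter_partial s (a j) x) <= M) ->
  continuous_on V l -> (forall x, V x -> (monic_poly (a ^~ x)).[l x] = 0) ->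
  exists g, [/\ weak_partial V i l g, cpart_all (measurable_fun V) g &
    cpart_all (weak_type mu V b0 C0 C1) g]]].
Proof.
move=> oU oV [cV VU].
pose e : 'rV[R]_m := delta_mx ord0 i.
have eN s : `|s *: e| <= `|s|.
  by rewrite normrZ ler_piMr// norm_delta_rV.
have [r1 r10 Hr1] := compact_radius cV oU VU.
pose r := r1 / 2; have r0 : 0 < r by rewrite divr_gt0.
pose K := (fun p : 'rV[R]_m * R => p.1 + p.2 *: e) @` (closure V `*` `[0, r]%classic).
have KP x s : closure V x -> 0 <= s <= r -> K (x + s *: e).
  by move=> Vx sr; exists (x, s).
have VK : V `<=` K.
  move=> x Vx; rewrite -[x]addr0 -(scale0r e); apply: KP; first exact: subset_closure.
  by rewrite lexx ltW.
have KU : K `<=` U.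
  move=> y [[x s] [/= Vx]]; rewrite in_itv/= => /andP[s0 sr] <-.
  apply: (Hr1 x) => //; rewrite opprD addrA subrr add0r normrN.
  by apply: le_lt_trans (eN s) _; rewrite ger0_norm//; rewrite /r in sr; lra.
exists K; split => //.
  apply: continuous_compact; last by apply: compact_setX => //; exact: segment_compact.
  apply: continuous_subspaceT => -[x s] /=.
  apply: cvgD; first exact: cvg_fst.
  by apply: cvgZr_tmp; exact: cvg_snd.
move=> M.
have [B0 [_ HB0]] := compact_bounded cV.
pose B := `|B0| + 1 + r.
have HB x : V x -> `|x| <= `|B0| + 1.
  move=> Vx; apply: HB0; last exact: subset_closure.
  by rewrite (le_lt_trans (ler_norm B0))// ltrDl.
pose V' := [set v : 'rV[R]_m | forall i, `[(- B), B]%classic (v ord0 i)].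
have [mV' V'fin] := bounded_rV_finite m B.
pose T s x := x + s *: e.
(* The factor 2 leaves room for the strict inequality in [inner_points] when translating by as much
   as [r / j.+1%:R]. *)
pose Vj j := inner_points V (2 * r / j.+1%:R).
have T0 x : T 0 x = x by rewrite /T scale0r addr0.
have TD s t x : T (s + t) x = T s (T t x) by rewrite /T scalerDl addrAC addrA.
have mV := open_measurable_rV oV.
have VV' x s : 0 <= s <= r -> V (T s x) -> V' x.
  move=> /andP[s0 sr] /HB h j; rewrite /= in_itv/= -ler_norml.
  apply: le_trans (rV_coord_le x j) _; rewrite /B -(addrK (s *: e) x).
  apply: le_trans (ler_normB _ _) _; apply: lerD => //.
  by apply: le_trans (eN s) _; rewrite ger0_norm.
have VjV j x s : Vj j x -> 0 <= s <= r / j.+1%:R -> V (T s x).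
  move=> Vjx /andP[s0 sr]; apply: Vjx; rewrite /T opprD addrA subrr add0r normrN.
  apply: le_lt_trans (eN s) _; rewrite ger0_norm//.
  have : 0 < r / j.+1%:R by rewrite divr_gt0.
  by rewrite -mulrA mulr_natl mulr2n; move: sr; set w := r / _ => h1 h2; lra.
have mVj j : measurable (Vj j) by apply: closed_measurable_rV; exact: closed_inner_points.
have mT s : measurable_fun setT (T s) by exact: measurable_line.
have Tmu s A : measurable A -> mu (T s @^-1` A) = mu A by exact: lebesgue_rV_line.
have [C0 [C1 [C00 C10 H]]] := flow_root_derivative n_gt0 r0 T0 TD mT Tmu mV mV' V'fin VV' mVj VjV (2 * M).
exists C0, C1; split => // a l aC aM cl lroot.
have rl x : V x -> root (monic_poly (a ^~ x)) (l x) by move=> Vx; apply/rootP; exact: lroot.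
have lB x : V x -> nc (l x) <= 1 + n%:R * (1 + `|M|).
  move=> Vx; apply: root_monic_poly_bound (rl x Vx) => j.
  by apply: (aM j [::]) => //; exact: VK.
have ml := continuous_on_measurable oV cl.
have ta x s t j : s < t -> t - s <= r -> V (T s x) -> V (T t x) ->
    taylor_like s t k (2 * M) (fun u => a j (T u x)).
  move=> st tr Vs Vt.
  apply: (@taylor_like_line _ _ e (fun q => iter_partial (nseq q i) (a j)) K M).
  - exact: smoothness_gt0.
  - move=> q qk y Ky; have [_ h] := aC j (nseq q i).
    have qs : (size (nseq q i) < k)%N by rewrite size_nseq.
    by have [h1 h2] := h qs i; split; [exact/h1/KU|exact/h2/KU|].
  - move=> q qk; have [h _] := aC j (nseq q i).
    have qs : (size (nseq q i) <= k)%N by rewrite size_nseq ltnW.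
    have [h1 h2] := h qs.
    by split => y /KU Uy; [exact: h1|exact: h2].
  - by move=> q qk y Ky; apply: aM; rewrite ?size_nseq.
  move=> u /andP[su ut].
  have -> : x + u *: e = T s x + (u - s) *: e by rewrite /T -addrA -scalerDl [s + _]addrC subrK.
  apply: KP; first exact: subset_closure.
  by rewrite subr_ge0 su/= (le_trans _ tr)// lerD2r.
have cl' : cpart_all (flow_continuous T V) l.
  have fc h : (forall x, V x -> {for x, continuous h}) -> flow_continuous T V h.
    move=> ch x s t VT u ust eps eps0.
    have /cvgrPdist_lt/(_ _ eps0)/nbhs_ballP[dl /= dl0 Hdl] := continuous_line (ch _ (VT u ust)).
    by exists dl => // v _ uv; apply: Hdl; rewrite -ball_normE.
  by case: cl => c1 c2; split; exact: fc.
have [g [ig wg d1 d2]] := H a l ta rl (ex_intro _ _ lB) ml cl'.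
have loc_sub (h : 'rV[R]_m -> C) : cintegrable mu V h -> locally_cintegrable V h.
  move=> [h1 h2] K' cK' K'V.
  have mK' : measurable K' by apply: closed_measurable_rV; exact: compact_closed (@norm_hausdorff _ _) cK'.
  by split; [apply: integrableS h1|apply: integrableS h2].
have Vfin : (mu V < +oo)%E.
  apply: le_lt_trans V'fin; apply: le_measure; rewrite ?inE// => x Vx.
  by apply: (@VV' x 0); rewrite ?lexx ?(ltW r0)// T0.
have igV : cintegrable mu V g.
  by case: ig => h1 h2; split; [apply: integrableS h1|apply: integrableS h2].
have mg : cpart_all (measurable_fun V) g.
  by case: igV => /integrableP[/measurable_EFinP h1 _] /integrableP[/measurable_EFinP h2 _]; split.
exists g; split => //; split; [apply: loc_sub|exact: loc_sub|move=> phi tphi].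
  case: ml => m1 m2; split.
    by apply: (bounded_integrable_on mV Vfin m1) => x /lB; apply: le_trans; exact: ler_ncRe.
  by apply: (bounded_integrable_on mV Vfin m2) => x /lB; apply: le_trans; exact: ler_ncIm.
have [t1 t2] := test_function_line i r0 oV tphi.
exact: (cintegral_by_parts mV Vfin r0 mT ml lB ig d1 d2 t1 t2).
Qed.
End RootPartial.

(** * Sobolev bounds in several variables *)

Section SobolevRoots.
Variable R : realType.
Local Notation C := R[i].
Variable n : nat.
Hypothesis n_gt0 : (0 < n)%N.
Local Notation N0 := (2 * n`!)%N.
Local Notation b0 := (3 * N0.-1)%N.
Local Notation k := (4 * n`!)%N.

Lemma Lq_norm_root d (X : measurableType d) (mu : {sigma_finite_measure set X -> \bar R})
  (V : set X) (C0 C1 q : R) : measurable V -> (mu V < +oo)%E -> 0 < C0 -> 0 <= C1 ->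
  1 <= q -> q < 1 + 1 / b0%:R -> exists2 B : R, 0 <= B &
  forall g : X -> C, cpart_all (measurable_fun V) g ->
  cpart_all (weak_type mu V b0 C0 C1) g -> (Lq_norm mu V q g <= B%:E)%E.
Proof.
move=> mV Vfin C00 C10 q1 qb; have b00 := root_exponent_gt0 n.
have [B B0 H] := Lq_norm_weak_type mV Vfin b00 C00 C10 (lt_le_trans ltr01 q1) (decay_rate_lt1 b00 qb).
by exists B.
Qed.

Lemma bounded_weak_type_complex d (X : measurableType d) (mu : {sigma_finite_measure set X -> \bar R})
  (V : set X) (l : X -> C) (B : R) b : (forall x, V x -> nc (l x) <= B) ->
  cpart_all (weak_type mu V b (`|B| + 1) 0) l.
Proof.
move=> lB; split; apply: bounded_weak_type => x /lB; apply: le_trans.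
  exact: ler_ncRe.
exact: ler_ncIm.
Qed.

Variable m : nat.
Local Notation mu := (lebesgue_rV m : {sigma_finite_measure set 'rV[R]_m -> \bar R}).

Lemma relatively_compact_finite_measure (U V : set 'rV[R]_m) : open V ->
  relatively_compact_in V U -> (mu V < +oo)%E.
Proof.
move=> oV [cV _]; have [B0 [_ HB0]] := compact_bounded cV.
have [mV' V'fin] := bounded_rV_finite m (`|B0| + 1).
apply: le_lt_trans V'fin; apply: le_measure; rewrite ?inE//; first exact: open_measurable_rV.
move=> x Vx j; rewrite /= in_itv/= -ler_norml; apply: le_trans (rV_coord_le x j) _.
apply: HB0; last exact: subset_closure.
by rewrite (le_lt_trans (ler_norm B0))// ltrDl.
Qed.

Lemma finite_bound (I : finType) (F : I -> R) : exists M, 0 <= M /\ forall i, F i <= M.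
Proof.
exists (\sum_i `|F i|); split=> [|i]; first exact: sumr_ge0.
by rewrite (bigD1 i)//= (le_trans (ler_norm _))// lerDl sumr_ge0.
Qed.

Lemma finite_seq_bound (I : finType) (F : seq I -> R) q :
  exists M, forall s, (size s <= q)%N -> F s <= M.
Proof.
elim: q F => [|q IH] F; first by exists (F [::]) => -[].
have /boolp.choice[M HM] i := IH (fun s => F (i :: s)).
have [B [B0 HB]] := finite_bound M.
exists (`|F [::]| + B) => -[_|i s /= sq]; first by rewrite (le_trans (ler_norm _))// lerDl.
by apply: le_trans (HM i s sq) _; apply: le_trans (HB i) _; rewrite lerDr.
Qed.

(** A single polynomial is a family indexed by [unit], so its roots are covered by the uniform
    estimates. *)
Lemma in_Ck_bounded (U : set 'rV[R]_m) (a : 'I_n -> 'rV[R]_m -> C) q :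
  (forall j, in_Ck q U (a j)) -> bounded_in_Ck q U [set h | exists (nu : unit) j, h = a j].
Proof.
move=> aC; split; first by move=> _ [_ [j ->]].
move=> K cK KU.
have H j s : exists M, (size s <= q)%N -> forall x, K x -> nc (iter_partial s (a j) x) <= M.
  have [sq|_] := leqP (size s) q; last by exists 0.
  have [h _] := aC j s; have [c1 c2] := h sq.
  have bd (h' : 'rV[R]_m -> R) : (forall x, U x -> {for x, continuous h'}) ->
      exists B, forall x, K x -> `|h' x| <= B.
    move=> ch; have cw : {within K, continuous h'}.
      by apply: continuous_in_subspaceT => x /set_mem/KU; exact: ch.
    have [M [_ HM]] := compact_bounded (continuous_compact cw cK).
    exists (`|M| + 1) => x Kx; apply: HM; last by exists x.
    by rewrite (le_lt_trans (ler_norm M))// ltrDl.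
  have [B1 H1] := bd _ c1; have [B2 H2] := bd _ c2.
  by exists (B1 + B2) => _ x Kx; apply: le_trans (nc_leReIm _) _; apply: lerD; [exact: H1|exact: H2].
have /boolp.choice[F HF] : forall p : 'I_n * seq 'I_m, exists M,
    (size p.2 <= q)%N -> forall x, K x -> nc (iter_partial p.2 (a p.1) x) <= M.
  by move=> p; exact: H.
have /boolp.choice[M HM] j := finite_seq_bound (fun s => F (j, s)) q.
have [B [_ HB]] := finite_bound M.
exists B => _ [_ [j ->]] s sq x Kx; apply: le_trans (HB j).
by apply: le_trans (HM j s sq); exact: (HF (j, s)).
Qed.

(** The gradient is produced before any [q] is named, so one gradient serves all exponents; the
    constants come before [nu] and [l], which gives the uniformity. *)
Lemma family_weak_gradient (U V : set 'rV[R]_m) (N : Type) (a : N -> 'I_n -> 'rV[R]_m -> C) :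
  open U -> open V -> relatively_compact_in V U ->
  bounded_in_Ck k U [set h | exists nu j, h = a nu j] ->
  exists (C0 C1 : 'I_m -> R) (B : R), [/\ forall i, 0 < C0 i, forall i, 0 <= C1 i &
  forall nu l, continuous_on V l -> (forall x, V x -> (monic_poly (a nu ^~ x)).[l x] = 0) ->
  (forall x, V x -> nc (l x) <= B) /\
  exists g : 'I_m -> 'rV[R]_m -> C, [/\ weak_gradient V l g,
    forall i, cpart_all (measurable_fun V) (g i) &
    forall i, cpart_all (weak_type mu V b0 (C0 i) (C1 i)) (g i)]].
Proof.
move=> oU oV VU [aC aB].
have aCk nu j : in_Ck k U (a nu j) by apply: aC; exists nu, j.
have [M0 HM0] := aB _ VU.1 VU.2.
have H i : exists c : R * R, [/\ 0 < c.1, 0 <= c.2 & forall nu l, continuous_on V l ->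
    (forall x, V x -> (monic_poly (a nu ^~ x)).[l x] = 0) -> exists g,
    [/\ weak_partial V i l g, cpart_all (measurable_fun V) g &
     cpart_all (weak_type mu V b0 c.1 c.2) g]].
  have [K [cK KU VK HK]] := root_partial n_gt0 i oU oV VU.
  have [M HM] := aB K cK KU; have [C0 [C1 [C00 C10 HC]]] := HK M.
  exists (C0, C1); split => // nu l cl rl; apply: HC cl rl => //.
  by move=> j s x sk Kx; apply: HM => //; exists nu, j.
have [c Hc] := boolp.choice H.
exists (fun i => (c i).1), (fun i => (c i).2), (1 + n%:R * (1 + `|M0|)).
split => [i|i|nu l cl rl]; [by have [] := Hc i|by have [] := Hc i|split].
  move=> x Vx; apply: root_monic_poly_bound; last by apply/rootP; exact: (rl x Vx).
  move=> j; apply: (HM0 _ _ [::]) => //; first by exists nu, j.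
  exact: subset_closure.
have /boolp.choice[g Hg] i : exists g, [/\ weak_partial V i l g, cpart_all (measurable_fun V) g &
     cpart_all (weak_type mu V b0 (c i).1 (c i).2) g] by have [_ _ h] := Hc i; exact: h cl rl.
by exists g; split => i; have [] := Hg i.
Qed.

Lemma family_in_W1q (U V : set 'rV[R]_m) (N : Type) (a : N -> 'I_n -> 'rV[R]_m -> C) (q : R) :
  open U -> open V -> relatively_compact_in V U ->
  bounded_in_Ck k U [set h | exists nu j, h = a nu j] -> 1 <= q -> q < 1 + 1 / b0%:R ->
  bounded_in_W1q V q [set l | continuous_on V l /\ exists nu, forall x, V x ->
    (monic_poly (a nu ^~ x)).[l x] = 0].
Proof.
move=> oU oV VU aB q1 qb.
have [C0 [C1 [B [C00 C10 H]]]] := family_weak_gradient oU oV VU aB.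
have mV := open_measurable_rV oV; have Vfin := relatively_compact_finite_measure oV VU.
have B1 : 0 < `|B| + 1 by rewrite ltr_wpDl.
have [L0 L00 HL0] := Lq_norm_root mV Vfin B1 (lexx 0) q1 qb.
have /boolp.choice[L HL] i : exists L : R, forall g : 'rV[R]_m -> C, cpart_all (measurable_fun V) g ->
    cpart_all (weak_type mu V b0 (C0 i) (C1 i)) g -> (Lq_norm mu V q g <= L%:E)%E.
  by have [L _ HL] := Lq_norm_root mV Vfin (C00 i) (C10 i) q1 qb; exists L.
exists (L0 + \sum_i L i) => l [cl [nu rl]].
have [lB [g [dg mg wg]]] := H nu l cl rl.
have nl : (Lq_norm mu V q l <= L0%:E)%E.
  apply: HL0; first exact: continuous_on_measurable.
  exact: bounded_weak_type_complex.
have ng i : (Lq_norm mu V q (g i) <= (L i)%:E)%E by exact: HL.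
split; first by split; [exact: continuous_on_measurable|exact: le_lt_trans nl (ltry _)].
exists g; split => // [i|]; first by split => //; exact: le_lt_trans (ng i) (ltry _).
by rewrite EFinD -sumEFin; apply: leeD => //; apply: lee_sum.
Qed.

Lemma root_in_W1q (U V : set 'rV[R]_m) (a : 'I_n -> 'rV[R]_m -> C) (l : 'rV[R]_m -> C) :
  open U -> (forall j, in_Ck k U (a j)) -> open V -> relatively_compact_in V U ->
  continuous_on V l -> (forall x, V x -> (monic_poly (a ^~ x)).[l x] = 0) ->
  (exists2 g : 'I_m -> 'rV[R]_m -> C, weak_gradient V l g &
    forall q : R, 1 <= q -> q < 1 + 1 / b0%:R -> forall i, in_Lq (lebesgue_rV m) V q (g i)) /\
  forall q : R, 1 <= q -> q < 1 + 1 / b0%:R -> in_W1q V q l.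
Proof.
move=> oU aC oV VU cl rl.
have [C0 [C1 [B [C00 C10 H]]]] := family_weak_gradient (a := fun _ : unit => a) oU oV VU (in_Ck_bounded aC).
have [lB [g [dg mg wg]]] := H tt l cl rl.
have mV := open_measurable_rV oV; have Vfin := relatively_compact_finite_measure oV VU.
have gq q : 1 <= q -> q < 1 + 1 / b0%:R -> forall i, in_Lq (lebesgue_rV m) V q (g i).
  move=> q1 qb i; split; first exact: mg.
  have [L _ HL] := Lq_norm_root mV Vfin (C00 i) (C10 i) q1 qb.
  by apply: le_lt_trans (HL _ (mg i) (wg i)) _; rewrite ltry.
split; first by exists g.
move=> q q1 qb; split; last by exists g => // i; exact: gq.
split; first exact: continuous_on_measurable.
have B1 : 0 < `|B| + 1 by rewrite ltr_wpDl.
have [L _ HL] := Lq_norm_root mV Vfin B1 (lexx 0) q1 qb.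
have nl : (Lq_norm mu V q l <= L%:E)%E.
  apply: HL; first exact: continuous_on_measurable.
  exact: bounded_weak_type_complex.
exact: le_lt_trans nl (ltry _).
Qed.
End SobolevRoots.

(** * One variable *)

Section OneVariable.
Variable R : realType.
Local Notation C := R[i].
Variable n : nat.
Hypothesis n_gt0 : (0 < n)%N.
Local Notation N0 := (2 * n`!)%N.
Local Notation b0 := (3 * N0.-1)%N.
Local Notation k := (4 * n`!)%N.
Variables (a b : R).
Hypothesis ab : a < b.
Local Notation mu := (@lebesgue_measure R : {sigma_finite_measure set (measurableTypeR R) -> \bar R}).
Local Notation I := (`[a, b]%classic : set R).
Local Notation J := (`]a, b[%classic : set R).

(** From an interior point small increments stay in [I], so the relative limit is an ordinary
    derivative. *)
Lemma diff_quotient_derive (h : R -> R) x : J x ->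
  cvg (diff_quotient h x y @[y --> within I x^']) ->
  derivable h x 1 /\ 'D_1 h x = lim (diff_quotient h x y @[y --> within I x^']).
Proof.
move=> Jx /cvg_ex[L hL].
have E (t : R) : t^-1 *: ((h \o shift x) (t *: 1) - h x) = diff_quotient h x (t + x).
  by rewrite /diff_quotient /shift/= addrK /GRing.scale/= mulr1 mulrC.
have tI : (t + x) @[t --> (0 : R)^'] --> within I x^'.
  move=> A /= [d1 /= d10 H1].
  have /nbhs_ballP[d2 /= d20 H2] : nbhs x J by apply: open_nbhs_nbhs; split => //; exact: interval_open.
  exists (Num.min d1 d2); first by rewrite /= lt_min d10.
  move=> t; rewrite /= sub0r normrN lt_min => /andP[t1 t2] t0.
  apply: H1 => /=.
  - by rewrite opprD addrCA subrr addr0 normrN.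
  - by rewrite -subr_eq0 addrK.
  apply: subset_itv_oo_cc; apply: H2; rewrite -ball_normE/=.
  by rewrite opprD addrCA subrr addr0 normrN.
have hL' : t^-1 *: ((h \o shift x) (t *: 1) - h x) @[t --> (0 : R)^'] --> L.
  under eq_cvg do rewrite E.
  exact: (cvg_comp _ _ tI hL).
split; first by apply/cvg_ex; exists L.
(* Needed for the relative limit to be unique. *)
have PF : ProperFilter (within I x^').
  split; last exact: within_filter.
  by move=> w0; have /filter_ex[t] := tI _ w0.
by rewrite /derive (cvg_lim _ hL')// (cvg_lim _ hL).
Qed.

Lemma continuous_itv_interior (h : R -> R) x : {within I, continuous h} -> J x ->
  {for x, continuous h}.
Proof. by move=> /(continuous_within_itvP h ab)[ch _ _] Jx; exact: ch. Qed.

Lemma continuous_itv_measurable (l : R -> C) : continuous_itv a b l ->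
  cpart_all (measurable_fun J) l.
Proof.
have H (h : R -> R) : {within I, continuous h} -> measurable_fun J h.
  move=> ch; apply: open_continuous_measurable_fun; first exact: interval_open.
  by move=> x /set_mem Jx; exact: continuous_itv_interior.
by move=> [c1 c2]; split; exact: H.
Qed.

Lemma test_function_itv_line (r : R) phi : 0 < r -> test_function_itv a b phi ->
  let T s x := x + s *: (1 : R) in
  let Vj j := inner_points J (2 * r / j.+1%:R) in
  flow_test (X := measurableTypeR R) T Vj r (@complex.Re R \o phi) (@complex.Re R \o derive1c phi) /\
  flow_test (X := measurableTypeR R) T Vj r (@complex.Im R \o phi) (@complex.Im R \o derive1c phi).
Proof.
move=> r0 [phiC [K [cK KV] phiK]] T Vj.
have [d1 d2] := phiC 0%N; have [e1 e2] := phiC 1%N.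
have oJ : open J by exact: interval_open.
have cont (h : R -> R) : (forall x, derivable h x 1) -> continuous h.
  by move=> dh x; apply: differentiable_continuous; apply/derivable1_diffP.
have key (h : R -> R) : (forall x, derivable h x 1) -> (forall x, derivable (derive1 h) x 1) ->
    (forall x, ~ K x -> h x = 0) -> flow_test (X := measurableTypeR R) T Vj r h (derive1 h).
  move=> dh ddh hK.
  have E : 'D_1 h = derive1 h by apply/funext => x; rewrite derive1E.
  have [|h1 h2 h3 h4] := line_test (e := 1 : R) r0 oJ cK KV hK (cont _ dh) dh.
    by rewrite E; exact: cont.
  split; [|exact: h1|exact: h2|exact: h3|by move=> x; rewrite derive1E; exact: h4].
  by apply: continuous_measurable_fun; exact: cont.
split.
  exact: (key (@complex.Re R \o phi) d1 e1 (fun x nK => congr1 (@complex.Re R) (phiK x nK))).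
exact: (key (@complex.Im R \o phi) d2 e2 (fun x nK => congr1 (@complex.Im R) (phiK x nK))).
Qed.

(** The open interval is convex, so segments between its points stay in it, and [J] itself takes the
    place of the compact set used in several variables. *)
Lemma root_derivative_itv (M : R) : exists C0 C1 : R, [/\ 0 < C0, 0 <= C1 &
  forall (c : 'I_n -> R -> C) (l : R -> C),
  (forall j, in_Ck_itv a b k (c j)) ->
  (forall j p x, (p <= k)%N -> I x -> nc (iter p (derive_itv a b) (c j) x) <= M) ->
  continuous_itv a b l -> (forall t, a <= t <= b -> (monic_poly (c ^~ t)).[l t] = 0) ->
  exists g, [/\ weak_derivative_itv a b l g, cpart_all (measurable_fun J) g &
    cpart_all (weak_type mu J b0 C0 C1) g]].
Proof.
pose r := b - a; have r0 : 0 < r by rewrite subr_gt0.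
pose T s (x : R) := x + s *: (1 : R).
have TE s x : T s x = x + s by rewrite /T /GRing.scale/= mulr1.
pose Vj j := inner_points J (2 * r / j.+1%:R).
pose V' : set R := `]a - r, b[%classic.
have T0 x : T 0 x = x by rewrite TE addr0.
have TD s t x : T (s + t) x = T s (T t x) by rewrite !TE addrAC addrA.
have JI x : J x -> I x by exact: subset_itv_oo_cc.
have mV : measurable (J : set (measurableTypeR R)) by exact: measurable_itv.
have mV' : measurable (V' : set (measurableTypeR R)) by exact: measurable_itv.
have fin_itv (u v : R) : (mu `]u, v[%classic < +oo)%E.
  by rewrite /= lebesgue_measure_itv/=; case: ifP => // _; rewrite -EFinD ltry.
have VV' x s : 0 <= s <= r -> J (T s x) -> V' x.
  rewrite TE /V' /= !in_itv/= => /andP[s0 sr] /andP[h1 h2]; apply/andP; split; lra.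
have VjV j x s : Vj j x -> 0 <= s <= r / j.+1%:R -> J (T s x).
  move=> Vjx /andP[s0 sr]; apply: Vjx; rewrite TE opprD addrA subrr add0r normrN.
  rewrite ger0_norm//; have : 0 < r / j.+1%:R by rewrite divr_gt0.
  by rewrite -mulrA mulr_natl mulr2n; move: sr; set w := r / _ => h1 h2; lra.
have mVj j : measurable (Vj j : set (measurableTypeR R)).
  by apply: closed_measurable; exact: closed_inner_points.
have mT s : @measurable_fun _ _ (measurableTypeR R) (measurableTypeR R) setT (T s).
  have -> : T s = fun x => x + s by apply/funext => x; exact: TE.
  exact: measurable_shift.
have Tmu s (A : set (measurableTypeR R)) : measurable A -> mu (T s @^-1` A) = mu A.
  have -> : T s = fun x => x + s by apply/funext => x; exact: TE.
  exact: lebesgue_shift.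
have [C0 [C1 [C00 C10 H]]] := @flow_root_derivative R n n_gt0 _ (measurableTypeR R) mu T J V' Vj r r0 T0 TD mT Tmu mV mV' (fin_itv _ _) VV' mVj VjV (2 * M).
exists C0, C1; split; [exact: C00|exact: C10|move=> c l cC cM cl lroot].
have rl x : J x -> root (monic_poly (c ^~ x)) (l x).
  by move=> /JI/= ; rewrite in_itv/= => Ix; apply/rootP; exact: lroot.
have lB x : J x -> nc (l x) <= 1 + n%:R * (1 + `|M|).
  move=> Jx; apply: root_monic_poly_bound (rl x Jx) => j.
  exact: (cM j 0%N x (leq0n _) (JI x Jx)).
have ml := continuous_itv_measurable cl.
have ta x s t j : s < t -> t - s <= r -> J (T s x) -> J (T t x) ->
    taylor_like s t k (2 * M) (fun u => c j (T u x)).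
  move=> st tr Js Jt.
  apply: (@taylor_like_line _ _ (1 : R) (fun q => iter q (derive_itv a b) (c j)) J M).
  - exact: (smoothness_gt0 n).
  - move=> q qk y Jy; have [_ h] := cC j q; have [h1 h2] := h qk.
    have [d1 E1] := diff_quotient_derive Jy (h1 y (JI y Jy)).
    have [d2 E2] := diff_quotient_derive Jy (h2 y (JI y Jy)).
    by split; [exact: d1|exact: d2|rewrite iterS /derive_itv /cpart_map -E1 -E2].
  - move=> q qk; have [h _] := cC j q; have [h1 h2] := h (ltnW qk).
    by split => y Jy; [exact: continuous_itv_interior h1 Jy|exact: continuous_itv_interior h2 Jy].
  - by move=> q qk y Jy; apply: cM => //; exact: JI.
  move=> u /andP[su ut]; move: Js Jt; rewrite -/(T u x) !TE /= !in_itv/=.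
  by move=> /andP[h1 h2] /andP[h3 h4]; apply/andP; split; lra.
have cl' : cpart_all (flow_continuous (X := measurableTypeR R) T J) l.
  have fc (h : R -> R) : {within I, continuous h} -> flow_continuous (X := measurableTypeR R) T J h.
    move=> ch x s t VT u ust eps eps0.
    have /cvgrPdist_lt/(_ _ eps0)/nbhs_ballP[dl /= dl0 Hdl] :=
      continuous_line (continuous_itv_interior ch (VT u ust)).
    by exists dl => // v _ uv; apply: Hdl; rewrite -ball_normE.
  by case: cl => c1 c2; split; exact: fc.
have [g [ig wg d1 d2]] := H c l ta rl (ex_intro _ _ lB) ml cl'.
have loc_sub (h : R -> C) : cintegrable mu J h -> locally_cintegrable_itv a b h.
  move=> [h1 h2] K' cK' K'V.
  have mK' : measurable (K' : set (measurableTypeR R)) by exact: compact_measurable.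
  by split; [apply: integrableS h1|apply: integrableS h2].
have igV : cintegrable mu J g.
  by case: ig => h1 h2; split; [apply: integrableS h1|apply: integrableS h2].
have mg : cpart_all (measurable_fun J) g.
  by case: igV => /integrableP[/measurable_EFinP h1 _] /integrableP[/measurable_EFinP h2 _]; split.
exists g; split; [|exact: mg|exact: wg]; split; [apply: loc_sub|exact: loc_sub|move=> phi tphi].
  case: ml => m1 m2; split.
    by apply: (bounded_integrable_on mV (fin_itv _ _) m1) => x /lB; apply: le_trans; exact: ler_ncRe.
  by apply: (bounded_integrable_on mV (fin_itv _ _) m2) => x /lB; apply: le_trans; exact: ler_ncIm.
have [t1 t2] := test_function_itv_line r0 tphi.
exact: (cintegral_by_parts mV (fin_itv _ _) r0 mT ml lB ig d1 d2 t1 t2).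
Qed.

Lemma in_Ck_itv_bounded (c : 'I_n -> R -> C) q : (forall j, in_Ck_itv a b q (c j)) ->
  exists M, forall j p x, (p <= q)%N -> I x -> nc (iter p (derive_itv a b) (c j) x) <= M.
Proof.
move=> cC.
have bd (h : R -> R) : {within I, continuous h} -> exists B, forall x, I x -> `|h x| <= B.
  move=> ch; have [B [_ HB]] := compact_bounded (continuous_compact ch (@segment_compact R a b)).
  exists (`|B| + 1) => x Ix; apply: HB; last by exists x.
  by rewrite (le_lt_trans (ler_norm B))// ltrDl.
have /boolp.choice[F HF] (p : 'I_n * 'I_q.+1) : exists M, forall x, I x ->
    nc (iter p.2 (derive_itv a b) (c p.1) x) <= M.
  have [h _] := cC p.1 p.2; have [|c1 c2] := h; first by rewrite -ltnS.
  have [B1 H1] := bd _ c1; have [B2 H2] := bd _ c2.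
  by exists (B1 + B2) => x Ix; apply: le_trans (nc_leReIm _) _; apply: lerD; [exact: H1|exact: H2].
have [B [_ HB]] := finite_bound F.
exists B => j p x pq Ix; have pq' : (p < q.+1)%N by [].
exact: le_trans (HF (j, Ordinal pq') x Ix) (HB _).
Qed.

Let mJ : measurable (J : set (measurableTypeR R)). Proof. exact: measurable_itv. Qed.

Let Jfin : (mu J < +oo)%E.
Proof. by rewrite /= lebesgue_measure_itv/=; case: ifP => // _; rewrite -EFinD ltry. Qed.

Lemma roots_weakly_derivable (c l : 'I_n -> R -> C) :
  (forall j, in_Ck_itv a b k (c j)) -> (forall j, continuous_itv a b (l j)) ->
  (forall t, a <= t <= b -> monic_poly (c ^~ t) = \prod_(j < n) ('X - (l j t)%:P)) ->
  forall j, exists2 g, weak_derivative_itv a b (l j) g &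
    forall q, 1 <= q -> q < 1 + 1 / b0%:R -> in_Lq (@lebesgue_measure R) J q g.
Proof.
move=> cC cl cE j; have [M cM] := in_Ck_itv_bounded cC.
have [C0 [C1 [C00 C10 H]]] := root_derivative_itv M.
have [|g [dg mg wg]] := H c (l j) cC cM (cl j).
  by move=> t tab; rewrite cE// horner_prod (bigD1 j)//= hornerXsubC subrr mul0r.
exists g => // q q1 qb; split => //.
have [L _ HL] := Lq_norm_root mJ Jfin C00 C10 q1 qb.
exact: le_lt_trans (HL g mg wg) (ltry _).
Qed.

Lemma roots_bounded_in_W1q_itv (N : Type) (c : N -> 'I_n -> R -> C) :
  bounded_in_Ck_itv a b k [set h | exists nu j, h = c nu j] ->
  forall q, 1 <= q -> q < 1 + 1 / b0%:R ->
  bounded_in_W1q_itv a b q [set l | continuous_itv a b l /\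
    exists nu, forall t, a <= t <= b -> (monic_poly (c nu ^~ t)).[l t] = 0].
Proof.
move=> [cC [M cM]] q q1 qb.
have [C0 [C1 [C00 C10 H]]] := root_derivative_itv M.
pose B := 1 + n%:R * (1 + `|M|); have B1 : 0 < `|B| + 1 by rewrite ltr_wpDl.
have [L0 _ HL0] := Lq_norm_root mJ Jfin B1 (lexx 0) q1 qb.
have [L1 _ HL1] := Lq_norm_root mJ Jfin C00 C10 q1 qb.
exists (L0 + L1) => l [cl [nu rl]].
have [||g [dg mg wg]] := H (c nu) l _ _ cl rl.
- by move=> j; apply: cC; exists nu, j.
- by move=> j p x pk Ix; apply: cM => //; exists nu, j.
have ml := continuous_itv_measurable cl.
have lB x : J x -> nc (l x) <= B.
  move=> /subset_itv_oo_cc Ix; have := Ix; rewrite /= in_itv/= => Ix'.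
  apply: root_monic_poly_bound; last by apply/rootP; exact: (rl x Ix').
  by move=> j; apply: (cM _ _ 0%N) => //; exists nu, j.
have nl := HL0 l ml (bounded_weak_type_complex mu b0 lB).
have ng := HL1 g mg wg.
split; first by split; [exact: ml|exact: le_lt_trans nl (ltry _)].
exists g; split; [exact: dg|by split; [exact: mg|exact: le_lt_trans ng (ltry _)]|].
by rewrite EFinD; exact: leeD.
Qed.
End OneVariable.

Theorem mainTheorem2 (R : realType) (n : nat) (n_gt0 : (0 < n)%N) :
  exists (k : nat) (p : R),
  [/\ (0 < k)%N, 1 < p, one_parameter_regularity n k p &
  forall (m : nat) (U : set 'rV[R]_m), (0 < m)%N -> open U ->
  (forall a : 'I_n -> 'rV[R]_m -> R[i], (forall j, in_Ck k U (a j)) ->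
   forall V : set 'rV[R]_m, open V -> relatively_compact_in V U ->
   forall l : 'rV[R]_m -> R[i], continuous_on V l ->
   (forall x, V x -> (monic_poly (a ^~ x)).[l x] = 0) ->
   (exists2 g : 'I_m -> 'rV[R]_m -> R[i], weak_gradient V l g &
     forall q : R, 1 <= q -> q < p -> forall i, in_Lq (lebesgue_rV m) V q (g i)) /\
   forall q : R, 1 <= q -> q < p -> in_W1q V q l)
  /\
  (forall (N : Type) (a : N -> 'I_n -> 'rV[R]_m -> R[i]),
   bounded_in_Ck k U [set h | exists nu j, h = a nu j] ->
   forall V : set 'rV[R]_m, open V -> relatively_compact_in V U ->
   forall q : R, 1 <= q -> q < p ->
   bounded_in_W1q V q
     [set l | continuous_on V l /\ exists nu, forall x, V x ->
       (monic_poly (a nu ^~ x)).[l x] = 0])].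
Proof.
(* The second witness is the exponent below which [decay_rate] is less than 1. *)
exists (4 * n`!)%N, (1 + 1 / (3 * (2 * n`!).-1)%:R); split.
- exact: smoothness_gt0.
- by rewrite ltrDl divr_gt0// ltr0n root_exponent_gt0.
- move=> a b ab; split; first exact: roots_weakly_derivable.
  by move=> N c cN q; exact: roots_bounded_in_W1q_itv.
move=> m U m0 oU; split.
  by move=> a aC V oV VU l cl rl; exact: (root_in_W1q n_gt0 oU aC oV VU cl rl).
by move=> N a aB V oV VU q q1 qb; exact: (family_in_W1q n_gt0 oU oV VU aB q1 qb).
Qed.
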